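(* Let $1\le d\le n-1$ and let $M\subset\mathbb{C}^n$ be a Bloom-Graham model graph of real codimension $d$ with $C^1$ graphing map $h=(h_1,\ldots,h_d):\mathbb{R}^d\times\mathbb{C}^{n-d}\to\mathbb{R}^d$. Assume that there are uniform constants $N\ge 0$ and $C$ such that $$|Dh(x,w)|\le C(1+|x|^N+|w|^N)\quad\text{for all }x\in\mathbb{R}^d,\ w\in\mathbb{C}^{n-d},$$ where $D$ denotes the real derivative. Let $K$ be a compact subset of $M$. Then there exists a compact subset $K'$ of $M$ with $K\subset K'$ such that if $f$ is a continuous CR function on a neighbourhood of $K'$ in $M$, then there is a sequence of entire functions on $\mathbb{C}^n$ which converges to $f$ uniformly on $K$.
   Context: Coordinates on $\mathbb{C}^n$ are $(z,w)\in\mathbb{C}^d\times\mathbb{C}^{n-d}$ with $z_j=x_j+iy_j$ ($1\le j\le d$) and $w_j=u_j+iv_j$ ($1\le j\le n-d$). A generic CR submanifold $M$ of $\mathbb{C}^n$ of real codimension $d$, $1\le d\le n-1$, is a Bloom-Graham model graph if it is given globally as $$M=\{(z,w)\in\mathbb{C}^n : y_j=h_j(x_1,\ldots,x_{j-1},w),\ j=1,\ldots,d\},$$ where $h=(h_1,\ldots,h_d):\mathbb{R}^d\times\mathbb{C}^{n-d}\to\mathbb{R}^d$ is a $C^1$ map; that is, $h_j$ depends only on $x_1,\ldots,x_{j-1}$ and $w$ (so $h_1$ depends only on $w$). A continuous CR function on an open subset of $M$ is a continuous complex-valued function satisfying the tangential Cauchy-Riemann equations in the weak (distribution) sense: $\int_M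 f\,\overline{\partial}\varphi=0$ for every smooth $(n,n-d-1)$-form $\varphi$ on an open subset of $\mathbb{C}^n$ whose restriction to $M$ has compact support in that open subset of $M$. *)

(* Defs.v *)
From HB Require Import structures.
From mathcomp Require Import all_boot all_order all_algebra complex.
From mathcomp Require Import all_classical all_reals all_analysis.

Set Implicit Arguments.
Unset Strict Implicit.
Unset Printing Implicit Defensive.

Import Order.TTheory GRing.Theory Num.Theory.
Import numFieldNormedType.Exports.

Local Open Scope classical_set_scope.
Local Open Scope ring_scope.

Section ConsMeasure.
Context d (T : measurableType d) (R : realType) (n : nat).
Variables (mu : {sigma_finite_measure set T -> \bar R}).
Variables (nu : {sigma_finite_measure set (n.-tuple T) -> \bar R}).

Let cons_tuple (p : T * n.-tuple T) : n.+1.-tuple T := [tuple of p.1 :: p.2].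

Let measurable_cons_tuple : measurable_fun setT cons_tuple.
Proof. exact: measurable_cons. Qed.

Definition cons_measure : set (n.+1.-tuple T) -> \bar R :=
  pushforward (mu \x nu)%E cons_tuple.

Let cons_measure0 : cons_measure set0 = 0%E.
Proof. by rewrite /cons_measure /pushforward preimage_set0 measure0. Qed.

Let cons_measure_ge0 A : (0 <= cons_measure A)%E.
Proof. exact: measure_ge0. Qed.

Let cons_measure_sigma_additive : semi_sigma_additive cons_measure.
Proof.
move=> F mF tF mUF; rewrite /cons_measure /pushforward preimage_bigcup.
apply: measure_semi_sigma_additive.
- by move=> k; rewrite -[X in measurable X]setTI; exact: measurable_cons_tuple.
- apply/trivIsetP => /= i j _ _ ij; rewrite -preimage_setI.
  by move/trivIsetP : tF => /(_ _ _ _ _ ij) ->//; rewrite preimage_set0.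
- rewrite -preimage_bigcup -[X in measurable X]setTI.
  exact: measurable_cons_tuple.
Qed.

HB.instance Definition _ := isMeasure.Build _ _ _ cons_measure
  cons_measure0 cons_measure_ge0 cons_measure_sigma_additive.

Let cons_measure_sigma_finite : sigma_finite setT cons_measure.
Proof.
have /sigma_finiteP[F [FT ndF Foo]] := sigma_finiteT mu.
have /sigma_finiteP[G [GT ndG Goo]] := sigma_finiteT nu.
pose uncons (t : n.+1.-tuple T) := (thead t, [tuple of behead t]).
have muncons : measurable_fun setT uncons.
  apply/measurable_fun_pairP; split; first exact: measurable_tnth.
  exact: measurable_behead.
have unconsK p : uncons (cons_tuple p) = p.
  by case: p => x t; congr pair; apply/val_inj.
exists (fun k => uncons @^-1` (F k `*` G k)).
  apply/seteqP; split=> // t _.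
  have [i _ Fi] : (\bigcup_k F k) (thead t) by rewrite -FT.
  have [j _ Gj] : (\bigcup_k G k) [tuple of behead t] by rewrite -GT.
  exists (maxn i j) => //; split.
  - by have /subsetPset := ndF _ _ (leq_maxl i j); exact.
  - by have /subsetPset := ndG _ _ (leq_maxr i j); exact.
move=> k; have [mF Fk] := Foo k; have [mG Gk] := Goo k.
split.
  rewrite -[X in measurable X]setTI; apply: muncons => //.
  exact: measurableX.
rewrite /cons_measure /pushforward (_ : _ @^-1` _ = F k `*` G k).
  by rewrite product_measure1E// lte_mul_pinfty// ge0_fin_numE.
by apply/seteqP; split=> p; rewrite /preimage /mkset unconsK.
Qed.

HB.instance Definition _ :=
  @Measure_isSigmaFinite.Build _ _ _ cons_measure cons_measure_sigma_finite.

End ConsMeasure.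

(* Lebesgue measure on R^n, as the iterated product of the one on R. *)
Fixpoint lebesgue_tuple (R : realType) (n : nat) :
    {sigma_finite_measure set (n.-tuple (measurableTypeR R)) -> \bar R} :=
  match n with
  | 0 => dirac [tuple]
  | k.+1 => cons_measure lebesgue_measure (lebesgue_tuple R k)
  end.

Section Forms.
Variable R : realType.
(* [R[i]^o] is [R[i]] with its topology and its norm over itself. *)
Local Notation C := (R[i]^o).

Section Smooth.
Variable n : nat.
Implicit Types (U : set 'rV[C]_n) (g : 'rV[C]_n -> C) (p v : 'rV[C]_n).

Definition entire g := forall p, differentiable g p.

Definition line_Re g p v (t : R) : R := complex.Re (g (p + (t%:C)%C *: v)).
Definition line_Im g p v (t : R) : R := complex.Im (g (p + (t%:C)%C *: v)).

(* Derivability and derivative of [g] along [v] in the real sense, i.e. with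
   respect to a real parameter. *)
Definition rderivable g p v :=
  derivable (line_Re g p v) 0 1 /\ derivable (line_Im g p v) 0 1.

Definition rderive v g : 'rV[C]_n -> C := fun p =>
  (derive1 (line_Re g p v) 0 +i* derive1 (line_Im g p v) 0)%C.

Fixpoint rCk (k : nat) U g : Prop :=
  {within U, continuous g} /\
  if k is l.+1 then
    forall v, (forall p, U p -> rderivable g p v) /\ rCk l U (rderive v g)
  else True.

Definition smooth_on U g := forall k, rCk k U g.

Definition dbar_coord (j : 'I_n) g : 'rV[C]_n -> C := fun p =>
  2^-1 * (rderive (delta_mx 0 j) g p
          + 'i%C * rderive ('i%C *: delta_mx 0 j) g p).

Definition dzeta (j : 'I_n) (v : 'rV[C]_n) : C := v 0 j.
Definition dzetabar (j : 'I_n) (v : 'rV[C]_n) : C := ((v 0 j)^*)%C.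

(* Value of the wedge product of the [k] covectors listed in [s] on the
   tangent vectors [v 0], ..., [v (k - 1)]; only meant for [size s = k]. *)
Definition wedge (s : seq ('rV[C]_n -> C)) (k : nat) (v : 'I_k -> 'rV[C]_n)
  : C := \det (\matrix_(a, b) nth (fun=> 0) s a (v b)).

(* A form of bidegree (n, q) is given by its coefficients: [phi] stands for
   the sum over #|J| = q of
     phi_J dzeta_1 /\ ... /\ dzeta_n /\ dzetabar_J,
   with J listed increasingly; the other values of [phi] are irrelevant. *)
Definition nq_form := {set 'I_n} -> 'rV[C]_n -> C.

Definition nq_covectors (J : {set 'I_n}) : seq ('rV[C]_n -> C) :=
  [seq dzeta j | j <- enum 'I_n] ++ [seq dzetabar j | j <- enum J].

Definition nq_smooth q U (phi : nq_form) :=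
  forall J : {set 'I_n}, #|J| = q -> smooth_on U (phi J).

Definition nq_eval q (phi : nq_form) p (v : 'I_(n + q) -> 'rV[C]_n) : C :=
  \sum_(J : {set 'I_n} | #|J| == q) phi J p * wedge (nq_covectors J) v.

(* dbar phi is the sum over J and j of
     (d phi_J / d zetabar_j) dzetabar_j /\ dzeta_1 /\ ... /\ dzetabar_J;
   it has degree n + q + 1. *)
Definition dbar_eval q (phi : nq_form) p k (v : 'I_k -> 'rV[C]_n) : C :=
  \sum_(J : {set 'I_n} | #|J| == q) \sum_(j < n)
    dbar_coord j (phi J) p * wedge (dzetabar j :: nq_covectors J) v.

End Smooth.

Section ModelGraph.
Variables (d m : nat) (h : 'rV[R]_d -> 'rV[C]_m -> 'rV[R]_d).

(* R^d x C^m is parametrised by the real coordinates (x, u, v), w = u + iv. *)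
Local Notation par := 'rV[R]_(d + (m + m)).

Definition par_x (t : par) : 'rV[R]_d := lsubmx t.
Definition par_w (t : par) : 'rV[C]_m :=
  \row_j (lsubmx (rsubmx t) 0 j +i* rsubmx (rsubmx t) 0 j)%C.

Definition h_real (t : par) : 'rV[R]_d := h (par_x t) (par_w t).

Definition C1_graphing :=
  (forall t, differentiable h_real t) /\ continuous (fun t => 'J h_real t).

Definition bloom_graham :=
  forall (j : 'I_d) (x x' : 'rV[R]_d) (w : 'rV[C]_m),
    (forall k : 'I_d, (k < j)%N -> x 0 k = x' 0 k) -> h x w 0 j = h x' w 0 j.

Definition euclidean_norm p q (A : 'M[R]_(p, q)) : R :=
  Num.sqrt (\sum_i \sum_j A i j ^+ 2).

(* [rsubmx t] is (u, v), whose Euclidean norm is |w|. *)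
Definition polynomial_growth (N c : R) := forall t : par,
  euclidean_norm ('J h_real t) <=
    c * (1 + euclidean_norm (lsubmx t) `^ N + euclidean_norm (rsubmx t) `^ N).

Definition model_graph : set 'rV[C]_(d + m) :=
  [set p : 'rV[C]_(d + m) | forall j, complex.Im (p 0 (lshift m j)) =
     h (\row_k complex.Re (p 0 (lshift m k))) (rsubmx p) 0 j].

Definition graph_map (t : par) : 'rV[C]_(d + m) :=
  row_mx (\row_j (par_x t 0 j +i* h_real t 0 j)%C) (par_w t).

Definition graph_tangent (t : par) (a : 'I_(d + (m + m))) : 'rV[C]_(d + m) :=
  \row_j ('D_(delta_mx 0 a) (fun s => complex.Re (graph_map s 0 j)) t
          +i* 'D_(delta_mx 0 a) (fun s => complex.Im (graph_map s 0 j)) t)%C.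

Definition graph_open (omega : set 'rV[C]_(d + m)) :=
  exists2 V : set 'rV[C]_(d + m), open V & omega = model_graph `&` V.

(* The restriction (pullback) to the graph of the form [phi] on [U] has
   compact support contained in [omega]. *)
Definition compact_support_in q (U omega : set 'rV[C]_(d + m))
    (phi : nq_form (d + m)) :=
  exists S : set 'rV[C]_(d + m),
    [/\ compact S, S `<=` U `&` omega &
      forall t, U (graph_map t) -> ~ S (graph_map t) ->
        forall b : 'I_(d + m + q) -> 'I_(d + (m + m)),
          nq_eval phi (graph_map t) (fun i => graph_tangent t (b i)) = 0].

Definition dbar_integrand q (f : 'rV[C]_(d + m) -> C) (phi : nq_form (d + m))
    (t : par) : C :=
  f (graph_map t) * dbar_eval q phi (graph_map t) (graph_tangent t).

Definition cplx_Rintegral (D : set par) (F : par -> C) : C :=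
  let mu := lebesgue_tuple R (d + (m + m)) in
  let row (s : (d + (m + m)).-tuple R) : par := \row_i tnth s i in
  ((\int[mu]_(s in row @^-1` D) complex.Re (F (row s))) +i*
   (\int[mu]_(s in row @^-1` D) complex.Im (F (row s))))%C.

(* Outside the compact support of the restriction of [phi] the integrand
   vanishes, so the integral over the graph is the one over [U `&` omega]. *)
Definition continuous_CR (omega : set 'rV[C]_(d + m))
    (f : 'rV[C]_(d + m) -> C) :=
  {within omega, continuous f} /\
  forall (U : set 'rV[C]_(d + m)) (phi : nq_form (d + m)),
    open U -> nq_smooth m.-1 U phi ->
    compact_support_in m.-1 U omega phi ->
    cplx_Rintegral (graph_map @^-1` (U `&` omega))
      (dbar_integrand m.-1 f phi) = 0.

End ModelGraph.
End Forms.

(* Main.v *)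
(* Near a point of the graph, take the Gaussian kernel with weights: weight 1 on
   the w directions and a rapidly decreasing weight on z_1, ..., z_d.  Since h_j
   only depends on x_1, ..., x_(j-1) and w, the weights can be chosen one after
   the other so that the real part of the phase is positive up to the v = Im w
   directions; there the kernel is completed by a mollifier of width tau in v.
   The product of the two is an approximate identity: integrating over x_d, ...,
   x_1, u, v in this order, each factor is a shifted Gaussian of integral 1.
   The mollifier centred at v(p) is then moved to a fixed centre, one coordinate
   at a time.  The difference is the v_k-derivative of a compactly supported
   function, so the CR equations (tested on one form) turn it into terms
   supported far from p in x or u, where the Gaussian is O(exp(-1/(2 tau^2))).
   With a fixed mollifier, the integral depends on p through the Gaussian only,
   which is the uniform limit of the polynomials (1 + phase / n)^n. *)
Require Import Defs.
From HB Require Import structures.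
From mathcomp Require Import all_boot all_order all_algebra complex.
From mathcomp Require Import all_classical all_reals all_analysis.
From mathcomp Require Import perm measurable_realfun ring lra.
Set Implicit Arguments.
Unset Strict Implicit.
Unset Printing Implicit Defensive.
Import Order.TTheory GRing.Theory Num.Theory.
Import numFieldNormedType.Exports.
Local Open Scope classical_set_scope.
Local Open Scope ring_scope.

(** The graph has dimension d + 2m with m = n - d, while a Gaussian in the d + m holomorphic
    coordinates only concentrates along a totally real slice v = const: exp(- w^2) grows in the v
    directions. Hence the mollifier in v, whose width equals the scale tau of the Gaussian: on its
    support the growth is bounded independently of tau. Once the mollifier sits at a fixed centre,
    the growth may reach exp(W / (2 tau^2)), with W determined by the size of K. The radii of the
    cutoffs in x and u are so large that the Gaussian gains W + 1 there, and the surplus 1 gives the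
    exponential that beats every power of 1 / tau.

    Since these radii are large, the slopes of h cannot be made small by localising. The weights
    replace localisation: a small weight on z_j makes its imaginary part negligible against the real
    parts on which h_j depends, at the price of a larger radius in x_j.

    In the test form, the coefficient of the v_k derivative is constant: for triangular h, the
    relevant Jacobian is unipotent. *)

Section RealDerivatives.
Variable R : realType.
Implicit Types (f g : R -> R) (x a b : R).

(** * Calculus of one real variable and smooth step functions *)

Lemma rderD f g x a b : is_derive x (1 : R) f a -> is_derive x (1 : R) g b ->
  is_derive x (1 : R) (fun t => f t + g t) (a + b).
Proof. by move=> df dg; exact: is_deriveD. Qed.

Lemma rderM f g x a b : is_derive x (1 : R) f a -> is_derive x (1 : R) g b ->
  is_derive x (1 : R) (fun t => f t * g t) (a * g x + f x * b).
Proof.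
move=> df dg; apply: is_derive_eq (is_deriveM df dg) _.
by rewrite addrC /GRing.scale/= mulrC.
Qed.

Lemma rder_comp f g x a b : is_derive (g x) (1 : R) f a ->
  is_derive x (1 : R) g b -> is_derive x (1 : R) (fun t => f (g t)) (a * b).
Proof. by move=> df dg; exact: is_derive1_comp. Qed.

Lemma rder_cst x c : is_derive x (1 : R) (fun=> c : R) 0.
Proof. exact: is_derive_cst. Qed.

Lemma rder_id x : is_derive x (1 : R) (fun t : R => t) 1.
Proof. exact: is_derive_id. Qed.

Lemma rder_eq f x a b : is_derive x (1 : R) f a -> a = b ->
  is_derive x (1 : R) f b.
Proof. by move=> ? <-. Qed.

Lemma rderV f x a : f x != 0 -> is_derive x (1 : R) f a ->
  is_derive x (1 : R) (fun t => (f t)^-1) (- a / f x ^+ 2).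
Proof.
move=> fx0 df; apply: rder_eq (is_deriveV fx0 df) _.
by rewrite /GRing.scale/= mulNr mulNr mulrC.
Qed.

Lemma rder_affine x a b : is_derive x (1 : R) (fun t => a * t + b) a.
Proof.
apply: rder_eq (rderD (rderM (rder_cst x a) (rder_id x)) (rder_cst x b)) _.
by rewrite mul0r mulr1 addr0 add0r.
Qed.

Lemma rderX f x a k : is_derive x (1 : R) f a ->
  is_derive x (1 : R) (fun t => f t ^+ k) (k%:R * a * f x ^+ k.-1).
Proof.
move=> df; elim: k => [|k ih].
  by rewrite !mul0r; exact: rder_cst.
have -> : (fun t => f t ^+ k.+1) = (fun t => f t * f t ^+ k).
  by apply/funext => t; rewrite exprS.
apply: rder_eq (rderM df ih) _.
case: k {ih} => [|k]; first by rewrite !expr0 mul0r mul0r mulr0 addr0 mulr1 mul1r mulr1.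
by rewrite -(natr1 k.+1) /= exprS; ring.
Qed.

Lemma rder_derive1 f x a : is_derive x (1 : R) f a -> derive1 f x = a.
Proof. by move=> df; rewrite derive1E; exact: derive_val. Qed.

Lemma rder_continuous f x a : is_derive x (1 : R) f a ->
  {for x, continuous f}.
Proof.
by move=> df; apply: differentiable_continuous; apply/derivable1_diffP.
Qed.

Lemma expR_powD_le n x : 0 <= x -> x ^+ n <= n`!%:R * expR x.
Proof.
case: n => [|n] x0; first by rewrite expr0 fact0 mul1r -expR0 ler_expR.
rewrite mulrC -ler_pdivrMr ?ltr0n ?fact_gt0//.
by apply: le_trans (expR_ge1Dxn n x0); rewrite lerDr.
Qed.

(** The derivatives of exp(-1/x), extended by 0, are linear combinations of these functions;
    carrying the power as a parameter closes the family under differentiation. *)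
Definition flat (k : nat) x : R := if 0 < x then x ^- k * expR (- x^-1) else 0.

Lemma flat_gt0 x : 0 < x -> 0 < flat 0 x.
Proof. by move=> x0; rewrite /flat x0 expr0 invr1 mul1r expR_gt0. Qed.

Lemma flat_ge0 k x : 0 <= flat k x.
Proof.
rewrite /flat; case: ifP => // x0.
by rewrite mulr_ge0 ?expR_ge0// invr_ge0 exprn_ge0 ?ltW.
Qed.

(** Comes from the term of degree k + 2 of the exponential series at 1/x. The exponent 2 on the
    right is what makes [flat k] differentiable at 0, with derivative 0. *)
Lemma flat_le k x : flat k x <= (k.+2)`!%:R * x ^+ 2.
Proof.
rewrite /flat; case: ifPn => [x0|_]; last by rewrite mulr_ge0 ?sqr_ge0.
have /(expR_powD_le k.+2) : 0 <= x^-1 by rewrite invr_ge0 ltW.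
rewrite expRN -addn2 exprD => le.
have xn0 : x != 0 by rewrite gt_eqF.
rewrite -[x ^- k]exprVn ler_pdivrMr ?expR_gt0//.
rewrite -(@ler_pM2r _ (x^-1 ^+ 2)) ?exprn_gt0 ?invr_gt0//.
apply: (le_trans le); rewrite le_eqVlt; apply/orP; left; apply/eqP.
by rewrite exprVn; field.
Qed.

Lemma rder_flat k x :
  is_derive x (1 : R) (flat k) (flat k.+2 x - k%:R * flat k.+1 x).
Proof.
have [x0|x0|x0] := ltgtP x 0.
- rewrite /flat ltNge (ltW x0)/= mulr0 subr0.
  apply: near_eq_is_derive (rder_cst x 0).
  near=> y; suff -> : (0 < y) = false by [].
  apply/negbTE; rewrite -leNgt ltW//; near: y; exact: lt_nbhsl.
- have xn0 : x != 0 by rewrite gt_eqF.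
  have E : is_derive x (1 : R) (fun t => (t^-1) ^+ k * expR (- t^-1))
      (flat k.+2 x - k%:R * flat k.+1 x).
    have dV : is_derive x (1 : R) (fun t => t^-1) (- 1 / x ^+ 2).
      exact: rderV (rder_id x).
    have dE : is_derive x (1 : R) (fun t => expR (- t^-1))
        (expR (- x^-1) * - (- 1 / x ^+ 2)).
      exact: (@rder_comp expR (fun t => - t^-1) _ _ _ (is_derive_expR _)
        (is_deriveN (df := - 1 / x ^+ 2) _)).
    apply: rder_eq (rderM (rderX k dV) dE) _.
    rewrite /flat x0 -![x ^- _]exprVn.
    set e := expR _;
    case: k => [|k]; rewrite !exprVn.
      by rewrite /= !expr0; field.
    by rewrite /= !exprS; field; rewrite expf_neq0.
  apply: near_eq_is_derive E.
  near=> y; rewrite /flat exprVn; suff -> : (0 < y) by [].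
  near: y; exact: lt_nbhsr.
(* At the origin the difference quotient is O(|h|) by the quadratic bound [flat_le]. *)
- rewrite x0; have -> : flat k.+2 0 - k%:R * flat k.+1 0 = 0.
    by rewrite /flat ltxx mulr0 subr0.
  suff : h^-1 *: (flat k (h *: 1 + 0) - flat k 0) @[h --> 0^'] --> (0 : R).
    move=> cv; apply: DeriveDef; first by apply/cvg_ex; exists 0; exact: cv.
    by apply/cvg_lim => //; exact: cv.
  rewrite {2}/flat ltxx.
  apply/cvgrPdist_le => e e0; near=> h.
  rewrite sub0r normrN subr0 addr0 /GRing.scale/= mulr1 normrM normfV.
  rewrite ger0_norm ?flat_ge0//.
  have h0 : 0 < `|h| by rewrite normr_gt0; near: h; exact: nbhs_dnbhs_neq.
  rewrite mulrC ler_pdivrMr//; apply: (le_trans (flat_le k h)).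
  rewrite -(real_normK (num_real h)) expr2 mulrA ler_wpM2r// ?normr_ge0//.
  rewrite -ler_pdivlMl ?ltr0n ?fact_gt0//.
  near: h; apply: dnbhs0_le.
  by rewrite mulr_gt0// invr_gt0 ltr0n fact_gt0.
Unshelve. all: by end_near. Qed.

(* A class of functions closed under differentiation, hence all smooth. *)
Inductive smooth1 : (R -> R) -> Prop :=
| smooth1_flat k : smooth1 (flat k)
| smooth1_cst c : smooth1 (fun=> c)
| smooth1_affine f a b : smooth1 f -> smooth1 (fun t => f (a * t + b))
| smooth1D f g : smooth1 f -> smooth1 g -> smooth1 (fun t => f t + g t)
| smooth1M f g : smooth1 f -> smooth1 g -> smooth1 (fun t => f t * g t)
| smooth1V f : smooth1 f -> (forall t, f t != 0) ->
    smooth1 (fun t => (f t)^-1).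

Lemma smooth1_derive f : smooth1 f ->
  exists2 g, smooth1 g & forall x, is_derive x (1 : R) f (g x).
Proof.
elim=> {f}.
- move=> k; exists (fun t => flat k.+2 t + (- k%:R) * flat k.+1 t).
    apply: smooth1D; first exact: smooth1_flat.
    by apply: smooth1M; [exact: smooth1_cst|exact: smooth1_flat].
  by move=> x; rewrite mulNr; exact: rder_flat.
- by move=> c; exists (fun=> 0); [exact: smooth1_cst|move=> x; exact: rder_cst].
- move=> f a b _ [g sg dg]; exists (fun t => g (a * t + b) * a).
    by apply: smooth1M; [exact: smooth1_affine|exact: smooth1_cst].
  by move=> x; exact: (@rder_comp f _ _ _ _ (dg _) (rder_affine x a b)).
- move=> f1 f2 _ [g1 sg1 dg1] _ [g2 sg2 dg2].
  exists (fun t => g1 t + g2 t); first exact: smooth1D.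
  by move=> x; exact: rderD.
- move=> f1 f2 sf1 [g1 sg1 dg1] sf2 [g2 sg2 dg2].
  exists (fun t => g1 t * f2 t + f1 t * g2 t).
    by apply: smooth1D; exact: smooth1M.
  by move=> x; exact: rderM.
- move=> f sf [g sg dg] f0.
  exists (fun t => (- 1 * g t) * ((f t)^-1 * (f t)^-1)).
    apply: smooth1M; first by apply: smooth1M => //; exact: smooth1_cst.
    by apply: smooth1M; exact: smooth1V.
  move=> x; apply: rder_eq (rderV (f0 x) (dg x)) _.
  by have := f0 x => fx0; field.
Qed.

Lemma smooth1_rder f x : smooth1 f -> is_derive x (1 : R) f (derive1 f x).
Proof.
by case/smooth1_derive => g _ dg; rewrite (rder_derive1 (dg x)).
Qed.

Lemma smooth1_derive1 f : smooth1 f -> smooth1 (derive1 f).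
Proof.
case/smooth1_derive => g sg dg; suff -> : derive1 f = g by [].
by apply/funext => x; rewrite (rder_derive1 (dg x)).
Qed.

Lemma smooth1_continuous f : smooth1 f -> continuous f.
Proof. by move=> sf x; exact: (rder_continuous (smooth1_rder x sf)). Qed.

Lemma smooth_step : exists f, [/\ smooth1 f, forall x, x <= 0 -> f x = 0 &
  forall x, 1 <= x -> f x = 1].
Proof.
(* The step is e(t) / (e(t) + e(1 - t)) with e = [flat 0]; the denominator is positive because t and
   1 - t are never both nonpositive. *)
pose D t : R := flat 0 t + flat 0 ((- 1) * t + 1).
have D0 t : D t != 0.
  rewrite gt_eqF// /D; have [t0|t0] := ltP 0 t.
    by rewrite ltr_pwDl ?flat_gt0// flat_ge0.
  rewrite ltr_pwDr ?flat_ge0// flat_gt0//; lra.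
exists (fun t => flat 0 t * (D t)^-1); split.
- apply: smooth1M; first exact: smooth1_flat.
  apply: smooth1V => //; apply: smooth1D; first exact: smooth1_flat.
  by apply: smooth1_affine; exact: smooth1_flat.
- by move=> x x0; rewrite {1}/flat ltNge x0/= mul0r.
- move=> x x1; have := D0 x; rewrite /D.
  have -> : flat 0 ((- 1) * x + 1) = 0.
    by rewrite /flat; case: ifP => //; lra.
  by rewrite addr0 => ?; rewrite divff.
Qed.

End RealDerivatives.

(** * Complex numbers with a real-valued norm, and the complex exponential *)

Section ComplexNumbers.
Variable R : realType.
Local Notation C := (R[i]^o).
Local Notation Re := (@complex.Re R).
Local Notation Im := (@complex.Im R).
Implicit Types (z w : C) (x y : R).

Lemma complex_ext z w : Re z = Re w -> Im z = Im w -> z = w.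
Proof. by case: z w => [a b] [c d] /= -> ->. Qed.

Lemma cReD z w : Re (z + w) = Re z + Re w. Proof. by case: z w => [? ?] []. Qed.
Lemma cImD z w : Im (z + w) = Im z + Im w. Proof. by case: z w => [? ?] []. Qed.
Lemma cReN z : Re (- z) = - Re z. Proof. by case: z. Qed.
Lemma cImN z : Im (- z) = - Im z. Proof. by case: z. Qed.
Lemma cReM z w : Re (z * w) = Re z * Re w - Im z * Im w.
Proof. by case: z w => [? ?] []. Qed.
Lemma cImM z w : Im (z * w) = Re z * Im w + Im z * Re w.
Proof. by case: z w => [? ?] []. Qed.
Lemma cRe0 : Re 0 = 0. Proof. by []. Qed.
Lemma cIm0 : Im 0 = 0. Proof. by []. Qed.
Lemma cRe1 : Re 1 = 1. Proof. by []. Qed.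
Lemma cIm1 : Im 1 = 0. Proof. by []. Qed.

Definition ReImE := (cReD, cImD, cReN, cImN, cReM, cImM, cRe0, cIm0, cRe1, cIm1).

Lemma Re_sum I (r : seq I) (P : pred I) (F : I -> C) :
  Re (\sum_(i <- r | P i) F i) = \sum_(i <- r | P i) Re (F i).
Proof. exact: (big_morph Re cReD cRe0). Qed.

Definition rc (x : R) : C := (x%:C)%C.

Lemma Re_rc x : Re (rc x) = x. Proof. by []. Qed.
Lemma rcD x y : rc (x + y) = rc x + rc y.
Proof. by apply: complex_ext; rewrite !ReImE ?addr0. Qed.
Lemma rcN x : rc (- x) = - rc x.
Proof. by apply: complex_ext; rewrite !ReImE ?oppr0. Qed.
Lemma rcM x y : rc (x * y) = rc x * rc y.
Proof. by apply: complex_ext; rewrite !ReImE /=; ring. Qed.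
Lemma rc0 : rc 0 = 0. Proof. by []. Qed.
Lemma rc1 : rc 1 = 1. Proof. by []. Qed.
Lemma rcX x n : rc (x ^+ n) = rc x ^+ n.
Proof. by elim: n => // n ih; rewrite !exprS rcM ih. Qed.
Lemma rc_nat n : rc n%:R = n%:R.
Proof. by elim: n => // n ih; rewrite !mulrS rcD ih. Qed.
Lemma rc_prod I (r : seq I) (P : pred I) (F : I -> R) :
  rc (\prod_(i <- r | P i) F i) = \prod_(i <- r | P i) rc (F i).
Proof. exact: (big_morph rc rcM rc1). Qed.
(* The l^1 norm; unlike the modulus it is real-valued, and it is still
   submultiplicative. *)
Definition nm z : R := `|Re z| + `|Im z|.

Lemma nm_ge0 z : 0 <= nm z. Proof. by rewrite addr_ge0. Qed.
Lemma Re_le_nm z : `|Re z| <= nm z. Proof. by rewrite lerDl. Qed.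
Lemma Im_le_nm z : `|Im z| <= nm z. Proof. by rewrite lerDr. Qed.
Lemma nm_rc x : nm (rc x) = `|x|. Proof. by rewrite /nm /= normr0 addr0. Qed.
Lemma nm0 : nm 0 = 0. Proof. by rewrite (nm_rc 0) normr0. Qed.
Lemma nm1 : nm 1 = 1. Proof. by rewrite (nm_rc 1) normr1. Qed.
Lemma nmN z : nm (- z) = nm z.
Proof. by rewrite /nm !ReImE !normrN. Qed.
Lemma nmB z w : nm (z - w) = nm (w - z).
Proof. by rewrite -nmN opprB. Qed.
Lemma nmD z w : nm (z + w) <= nm z + nm w.
Proof.
by rewrite /nm !ReImE addrACA lerD// ler_normD.
Qed.
Lemma nmM z w : nm (z * w) <= nm z * nm w.
Proof.
rewrite /nm !ReImE; apply: (le_trans (lerD (ler_normB _ _) (ler_normD _ _))).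
by rewrite !normrM le_eqVlt; apply/orP; left; apply/eqP; ring.
Qed.
Lemma nm_scale x z : nm (rc x * z) = `|x| * nm z.
Proof. by rewrite /nm !ReImE /= !mul0r subr0 addr0 !normrM mulrDr. Qed.
Lemma nm_sum I (r : seq I) (P : pred I) (F : I -> C) :
  nm (\sum_(i <- r | P i) F i) <= \sum_(i <- r | P i) nm (F i).
Proof.
elim/big_ind2 : _ => //; first by rewrite nm0.
by move=> z x w y zx wy; rewrite (le_trans (nmD _ _))// lerD.
Qed.
Lemma nm_prod I (r : seq I) (P : pred I) (F : I -> C) :
  nm (\prod_(i <- r | P i) F i) <= \prod_(i <- r | P i) nm (F i).
Proof.
elim/big_rec2 : _ => [|i x z _ zx]; first by rewrite nm1.
by rewrite (le_trans (nmM _ _))// ler_wpM2l// nm_ge0.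
Qed.
Lemma nmX z n : nm (z ^+ n) <= nm z ^+ n.
Proof.
elim: n => [|n ih]; first by rewrite !expr0 nm1.
by rewrite !exprS (le_trans (nmM _ _))// ler_wpM2l// nm_ge0.
Qed.
(** Telescoping with z^(n+1) - w^(n+1) = z (z^n - w^n) + (z - w) w^n. Since 1 <= m, the natural
    factor m^(n-1) can be relaxed to m^n, which avoids a predecessor. *)
Lemma nmX_sub z w (m : R) n : 1 <= m -> nm z <= m -> nm w <= m ->
  nm (z ^+ n - w ^+ n) <= n%:R * nm (z - w) * m ^+ n.
Proof.
move=> m1 zm wm; have m0 : 0 <= m by rewrite (le_trans _ m1).
elim: n => [|n ih]; first by rewrite !expr0 subrr nm0 !mul0r.
have -> : z ^+ n.+1 - w ^+ n.+1 = z * (z ^+ n - w ^+ n) + (z - w) * w ^+ n.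
  by rewrite !exprS; ring.
apply: (le_trans (nmD _ _)).
rewrite -natr1 2![in leRHS]mulrDl mul1r lerD//.
- rewrite (le_trans (nmM _ _))// exprS mulrCA.
  by apply: ler_pM => //; exact: nm_ge0.
- rewrite (le_trans (nmM _ _))// ler_wpM2l ?nm_ge0//.
  rewrite (le_trans (nmX _ _))// exprS.
  apply: le_trans (_ : m ^+ n <= _); first by rewrite lerXn2r// nnegrE nm_ge0.
  by rewrite ler_peMl// exprn_ge0.
Qed.

Definition cexp z : C := (expR (Re z) * cos (Im z) +i* (expR (Re z) * sin (Im z)))%C.

Lemma cRe_cexp z : Re (cexp z) = expR (Re z) * cos (Im z). Proof. by []. Qed.
Lemma cIm_cexp z : Im (cexp z) = expR (Re z) * sin (Im z). Proof. by []. Qed.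

Lemma cexp0 : cexp 0 = 1.
Proof.
by apply: complex_ext; rewrite /= expR0 ?cos0 ?sin0 ?mulr1 ?mulr0.
Qed.

Lemma cexpD z w : cexp (z + w) = cexp z * cexp w.
Proof.
by apply: complex_ext; rewrite !(ReImE, cRe_cexp, cIm_cexp) expRD (cosD, sinD); ring.
Qed.

Lemma cexpX z n : cexp z ^+ n = cexp (n%:R * z).
Proof.
elim: n => [|n ih]; first by rewrite mul0r cexp0.
by rewrite exprS ih -cexpD -natr1 mulrDl mul1r addrC.
Qed.

Lemma nm_cexp_le z : nm (cexp z) <= 2 * expR (Re z).
Proof.
rewrite /nm cRe_cexp cIm_cexp !normrM ger0_norm ?expR_ge0// -mulrDr mulrC.
by rewrite ler_wpM2r ?expR_ge0// (natrD _ 1 1) lerD// (cos_max, sin_max).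
Qed.

Lemma MVT_bound (f g : R -> R) y M :
  (forall c, `|c| <= `|y| -> is_derive c (1 : R) f (g c)) ->
  (forall c, `|c| <= `|y| -> `|g c| <= M) -> `|f y - f 0| <= M * `|y|.
Proof.
move=> df gM.
have cf (a b : R) : (forall c, c \in `[a, b] -> `|c| <= `|y|) ->
    {within `[a, b], continuous f}.
  move=> ab; apply: derivable_within_continuous => c /ab/df [].
  by [].
have [y0|y0] := leP 0 y.
- have ab c : c \in `[0, y] -> `|c| <= `|y|.
    by rewrite in_itv /= => /andP[c0 cy]; rewrite !ger0_norm.
  have [c /ab cy ->] := @MVT_segment R f g 0 y y0
    (fun x xy => df x (ab x (subset_itv_oo_cc xy))) (cf _ _ ab).
  by rewrite subr0 normrM ler_wpM2r// gM.
- have ab c : c \in `[y, 0] -> `|c| <= `|y|.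
    rewrite in_itv /= => /andP[c0 cy]; rewrite !ler0_norm// ?lerN2//.
    exact: ltW.
  have [c /ab cy E] := @MVT_segment R f g y 0 (ltW y0)
    (fun x xy => df x (ab x (subset_itv_oo_cc xy))) (cf _ _ ab).
  by rewrite distrC E sub0r normrM normrN ler_wpM2r// gM.
Qed.

Lemma sin_le_norm y : `|sin y| <= `|y|.
Proof.
have := @MVT_bound (@sin R) (@cos R) y 1 (fun c _ => is_derive_sin c)
  (fun c _ => cos_max c).
by rewrite sin0 subr0 mul1r.
Qed.

Lemma cosB1_le y : `|cos y - 1| <= `|y| ^+ 2.
Proof.
have := @MVT_bound (@cos R) (fun t => - sin t) y `|y|
  (fun c _ => is_derive_cos c).
rewrite cos0 -expr2; apply=> c cy.
by rewrite normrN (le_trans (sin_le_norm _)).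
Qed.

Lemma sinB_le y : `|y| <= 1 -> `|sin y - y| <= `|y| ^+ 2.
Proof.
move=> y1.
have ds c : is_derive c (1 : R) (fun t => sin t + (- 1) * t) (cos c - 1).
  apply: rder_eq (rderD (is_derive_sin c)
    (rderM (rder_cst c (- 1)) (rder_id c))) _.
  by rewrite mul0r add0r mulr1.
have := @MVT_bound (fun t => sin t + (- 1) * t) (fun t => cos t - 1) y `|y|
  (fun c _ => ds c).
rewrite sin0 mulr0 addr0 subr0 mulN1r -expr2; apply=> c cy.
apply: (le_trans (cosB1_le _)); apply: (le_trans (_ : _ <= `|y| ^+ 2)).
  by rewrite lerXn2r// nnegrE.
by rewrite expr2 ler_piMr.
Qed.

(** The upper bound is 1 + y <= exp y at y = - x, multiplied by exp x: it gives (1 - x) exp x <= 1,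
    which is quadratic information when |x| <= 1/2. *)
Lemma expRB1D_le x : `|x| <= 2^-1 -> `|expR x - 1 - x| <= 2 * `|x| ^+ 2.
Proof.
rewrite ler_norml => /andP[x1 x2].
have h1 := expR_ge1Dx x; have h2 := expR_ge1Dx (- x).
rewrite ger0_norm; last by lra.
rewrite real_normK ?num_real//.
have {}h1 : 0 <= expR x - 1 - x by lra.
have e0 := expR_gt0 x; have E : expR (- x) * expR x = 1.
  by rewrite mulrC expRxMexpNx_1.
have : (1 - x) * expR x <= expR (- x) * expR x by rewrite ler_wpM2r// ltW.
rewrite E => {}E.
nra.
Qed.

Lemma expRB1_le x : `|x| <= 2^-1 -> `|expR x - 1| <= 2 * `|x|.
Proof.
move=> x1; have h := expRB1D_le x1.
have -> : expR x - 1 = (expR x - 1 - x) + x by ring.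
apply: (le_trans (ler_normD _ _)); have := normr_ge0 x; nra.
Qed.

Lemma cexpB1D_le w : nm w <= 2^-1 -> nm (cexp w - 1 - w) <= 8 * nm w ^+ 2.
Proof.
move=> w1; have x1 := le_trans (Re_le_nm w) w1; have y1 := le_trans (Im_le_nm w) w1.
set x := Re w in x1 *; set y := Im w in y1 *.
have E0 := expRB1_le x1; have E1 := expRB1D_le x1; have E2 := cosB1_le y.
have E3 : `|sin y - y| <= `|y| ^+ 2 by apply: sinB_le; lra.
have ex : `|expR x| <= 2.
  have -> : expR x = (expR x - 1) + 1 by ring.
  by rewrite (le_trans (ler_normD _ _))// normr1; lra.
rewrite /nm !ReImE cRe_cexp cIm_cexp -/x -/y.
have -> : expR x * cos y - 1 - x = expR x * (cos y - 1) + (expR x - 1 - x) by ring.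
have -> : expR x * sin y - 0 - y = expR x * (sin y - y) + (expR x - 1) * y by ring.
apply: (le_trans (lerD (ler_normD _ _) (ler_normD _ _))).
rewrite !normrM.
have A : `|expR x| * `|cos y - 1| <= 2 * `|y| ^+ 2 by apply: ler_pM.
have B : `|expR x| * `|sin y - y| <= 2 * `|y| ^+ 2 by apply: ler_pM.
have D : `|expR x - 1| * `|y| <= 2 * `|x| * `|y| by apply: ler_wpM2r.
have := normr_ge0 x; have := normr_ge0 y; nra.
Qed.

(** Follows from |cos y| + |sin y| <= 1 + |y| <= exp |y|. The constant 1 matters: the bound is
    raised to the power n + 1 in [cexp_approx], where the factor 2 of [nm_cexp_le] would be
    fatal. *)
Lemma nm_cexp_le_exp w : nm (cexp w) <= expR (nm w).
Proof.
rewrite /nm cRe_cexp cIm_cexp !normrM ger0_norm ?expR_ge0// -mulrDr expRD.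
apply: ler_pM => //; rewrite ?expR_ge0 ?ler_expR ?ler_norm//.
apply: le_trans (expR_ge1Dx _); rewrite lerD// ?cos_max//.
exact: sin_le_norm.
Qed.

(** With N = n + 1, compare the N-th powers of 1 + w/N and exp(w/N): the bases differ by O(1/N^2)
    and both are bounded by exp(B'/N), so [nmX_sub] gives an error O(1/N), uniform for w in the
    ball. *)
Lemma cexp_approx (B e : R) : 0 < e -> exists n : nat, forall w, nm w <= B ->
  nm ((1 + rc n.+1%:R^-1 * w) ^+ n.+1 - cexp w) <= e.
Proof.
move=> e0; pose B' := `|B| + 1; have B'0 : 0 < B' by rewrite ltr_wpDl.
have K0 : 0 < 8 * B' ^+ 2 * expR B' / e + 2 * B'.
  by rewrite addr_gt0 ?mulr_gt0 ?expR_gt0 ?invr_gt0 ?exprn_gt0.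
(* The summand [2 * B'] forces B'/N <= 1/2, the range of [cexpB1D_le]; the other one brings the
   final error 8 B'^2 exp(B') / N below e. *)
have [n hn] : exists n : nat, 8 * B' ^+ 2 * expR B' / e + 2 * B' < n.+1%:R.
  exists (Num.truncn (8 * B' ^+ 2 * expR B' / e + 2 * B')).
  by have /andP[] := truncn_itv (ltW K0).
exists n => w wB; have {}wB : nm w <= B'.
  by rewrite (le_trans wB)// (le_trans (ler_norm _))// lerDl.
set N : R := n.+1%:R in hn *; have N0 : 0 < N by rewrite ltr0n.
have NV : `|N^-1| = N^-1 by rewrite ger0_norm// invr_ge0 ltW.
set u := rc N^-1 * w.
have uw : nm u = nm w / N by rewrite /u nm_scale NV mulrC.
have N0' : N != 0 by rewrite gt_eqF.
have -> : cexp w = cexp u ^+ n.+1.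
  rewrite cexpX /u; congr cexp; have -> : n.+1%:R = rc N.
    by rewrite rc_nat.
  by rewrite mulrA -rcM divff// mul1r.
have u2 : nm u <= B' / N by rewrite uw ler_wpM2r// invr_ge0 ltW.
have hN : 8 * B' ^+ 2 * expR B' / e < N.
  by rewrite (le_lt_trans _ hn)// lerDl; lra.
have hN2 : 2 * B' < N.
  rewrite (le_lt_trans _ hn)// lerDr divr_ge0 ?ltW// mulr_gt0 ?expR_gt0//.
  by rewrite mulr_gt0// exprn_gt0.
have BN : B' / N <= 2^-1 by rewrite ler_pdivrMr//; lra.
pose m := expR (B' / N).
have m1 : 1 <= m.
  by rewrite -expR0 ler_expR divr_ge0// ltW.
have zm : nm (1 + u) <= m.
  rewrite (le_trans (nmD _ _))// nm1 (le_trans _ (expR_ge1Dx _))//.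
  by rewrite lerD2l.
have wm : nm (cexp u) <= m.
  by rewrite (le_trans (nm_cexp_le_exp _))// ler_expR.
apply: (le_trans (nmX_sub n.+1 m1 zm wm)).
have -> : m ^+ n.+1 = expR B'.
  by rewrite /m -expRM_natl -/N mulrC divfK.
rewrite nmB opprD addrA.
apply: (le_trans (_ : _ <= N * (8 * (B' / N) ^+ 2) * expR B')).
  rewrite ler_wpM2r ?expR_ge0// ler_wpM2l ?(ltW N0)//.
  apply: (le_trans (cexpB1D_le (le_trans u2 BN))).
  by rewrite ler_wpM2l// lerXn2r// nnegrE ?nm_ge0// divr_ge0// ltW.
have -> : N * (8 * (B' / N) ^+ 2) * expR B' = 8 * B' ^+ 2 * expR B' / N.
  by field.
by rewrite ler_pdivrMr// [e * _]mulrC -ler_pdivrMr// ltW.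
Qed.

End ComplexNumbers.

(** * Integrals of complex-valued functions *)

Section ComplexIntegral.
Context d {T : measurableType d} {R : realType}.
Variable mu : {measure set T -> \bar R}.
Local Notation C := (R[i]^o).
Local Notation Re := (@complex.Re R).
Local Notation Im := (@complex.Im R).
Implicit Types (F G : T -> C) (f : T -> R).

Definition cmfun F := measurable_fun setT (fun t => Re (F t)) /\
  measurable_fun setT (fun t => Im (F t)).

Definition cint F : C := ((\int[mu]_t Re (F t)) +i* (\int[mu]_t Im (F t)))%C.

Definition cintegrable F := mu.-integrable setT (EFin \o (fun t => Re (F t))) /\
  mu.-integrable setT (EFin \o (fun t => Im (F t))).

Lemma cmfun_cst (z : C) : cmfun (fun=> z).
Proof. by split; exact: measurable_cst. Qed.

Lemma cmfun_rc f : measurable_fun setT f -> cmfun (fun t => rc (f t)).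
Proof. by split => //=; exact: measurable_cst. Qed.

Lemma cmfunD F G : cmfun F -> cmfun G -> cmfun (fun t => F t + G t).
Proof.
move=> [f1 f2] [g1 g2]; split; under eq_fun do rewrite ReImE;
  exact: measurable_funD.
Qed.

Lemma cmfunN F : cmfun F -> cmfun (fun t => - F t).
Proof.
by move=> [f1 f2]; split; under eq_fun do rewrite ReImE; exact: measurable_funN.
Qed.

Lemma cmfunB F G : cmfun F -> cmfun G -> cmfun (fun t => F t - G t).
Proof. by move=> f g; apply: cmfunD => //; exact: cmfunN. Qed.

Lemma cmfunM F G : cmfun F -> cmfun G -> cmfun (fun t => F t * G t).
Proof.
move=> [f1 f2] [g1 g2]; split; under eq_fun do rewrite ReImE.
  by apply: measurable_funB; exact: measurable_funM.
by apply: measurable_funD; exact: measurable_funM.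
Qed.

Lemma cmfunX F n : cmfun F -> cmfun (fun t => F t ^+ n).
Proof.
move=> mF; elim: n => [|n ih].
  by under eq_fun do rewrite expr0; exact: cmfun_cst.
by under eq_fun do rewrite exprS; exact: cmfunM.
Qed.

Lemma cmfun_sum I (r : seq I) (P : pred I) (F : I -> T -> C) :
  (forall i, cmfun (F i)) -> cmfun (fun t => \sum_(i <- r | P i) F i t).
Proof.
move=> mF; elim: r => [|i r ih].
  by under eq_fun do rewrite big_nil; exact: cmfun_cst.
under eq_fun do rewrite big_cons.
by case: (P i) => //; exact: cmfunD.
Qed.

Lemma cmfun_prod I (r : seq I) (P : pred I) (F : I -> T -> C) :
  (forall i, cmfun (F i)) -> cmfun (fun t => \prod_(i <- r | P i) F i t).
Proof.
move=> mF; elim: r => [|i r ih].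
  by under eq_fun do rewrite big_nil; exact: cmfun_cst.
under eq_fun do rewrite big_cons.
by case: (P i) => //; exact: cmfunM.
Qed.

Lemma cmfun_cexp F : cmfun F -> cmfun (fun t => cexp (F t)).
Proof.
move=> [f1 f2]; split => /=; apply: measurable_funM.
- by apply: measurableT_comp => //; exact: measurable_expR.
- apply: measurableT_comp => //; apply: continuous_measurable_fun.
  exact: continuous_cos.
- by apply: measurableT_comp => //; exact: measurable_expR.
- apply: measurableT_comp => //; apply: continuous_measurable_fun.
  exact: continuous_sin.
Qed.

Lemma cmfun_complex (f g : T -> R) : measurable_fun setT f ->
  measurable_fun setT g -> cmfun (fun t => (f t +i* g t)%C : C).
Proof. by []. Qed.

Lemma integrable_bounded_by (g f : T -> R) : measurable_fun setT f ->
  (forall t, `|f t| <= g t) -> mu.-integrable setT (EFin \o g) ->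
  mu.-integrable setT (EFin \o f).
Proof.
move=> mf fg ig; apply: (le_integrable measurableT _ _ ig).
  exact/measurable_EFinP.
by move=> t _; rewrite /= lee_fin (le_trans (fg t))// ler_norm.
Qed.

Lemma cintegrable_bounded_by (g : T -> R) F : cmfun F ->
  (forall t, nm (F t) <= g t) -> mu.-integrable setT (EFin \o g) ->
  cintegrable F.
Proof.
move=> [f1 f2] Fg ig; split; apply: integrable_bounded_by ig => // t.
  exact: le_trans (Re_le_nm _) (Fg t).
exact: le_trans (Im_le_nm _) (Fg t).
Qed.

(** The factor 2 is the price of the l^1 norm: real and imaginary parts are bounded separately. *)
Lemma nm_cint_le (g : T -> R) F : cmfun F -> (forall t, nm (F t) <= g t) ->
  mu.-integrable setT (EFin \o g) -> nm (cint F) <= 2 * \int[mu]_t g t.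
Proof.
move=> mF Fg ig; have [i1 i2] := cintegrable_bounded_by mF Fg ig.
rewrite /nm (natrD _ 1 1) mulrDl mul1r.
by apply: lerD; apply: (le_trans (le_normr_Rintegral _ _)) => //;
  apply: le_Rintegral => //; try exact: integrable_norm;
  move=> t _; rewrite (le_trans _ (Fg t))// (Re_le_nm, Im_le_nm).
Qed.

Lemma cintegrableD F G : cintegrable F -> cintegrable G ->
  cintegrable (fun t => F t + G t).
Proof.
move=> [f1 f2] [g1 g2]; split.
  have := integrableD measurableT f1 g1.
  by apply: eq_integrable => // t _; rewrite /= ReImE.
have := integrableD measurableT f2 g2.
by apply: eq_integrable => // t _; rewrite /= ReImE.
Qed.

Lemma cintegrableZ (z : C) F : cintegrable F -> cintegrable (fun t => z * F t).
Proof.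
move=> [f1 f2]; split.
  have := integrableB measurableT (integrableZl measurableT (Re z) f1)
    (integrableZl measurableT (Im z) f2).
  by apply: eq_integrable => // t _; rewrite /= ReImE.
have := integrableD measurableT (integrableZl measurableT (Re z) f2)
  (integrableZl measurableT (Im z) f1).
by apply: eq_integrable => // t _; rewrite /= ReImE.
Qed.

Lemma cintD F G : cintegrable F -> cintegrable G ->
  cint (fun t => F t + G t) = cint F + cint G.
Proof.
move=> [f1 f2] [g1 g2]; apply: complex_ext; rewrite !ReImE /=.
  by under eq_Rintegral do rewrite ReImE; rewrite RintegralD.
by under eq_Rintegral do rewrite ReImE; rewrite RintegralD.
Qed.

Lemma cintZ (z : C) F : cintegrable F -> cint (fun t => z * F t) = z * cint F.
Proof.
move=> [f1 f2]; have Z (a : R) (g : T -> R) : mu.-integrable setT (EFin \o g) ->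
    mu.-integrable setT (EFin \o (fun t => a * g t)).
  by move=> ig; exact: (integrableZl measurableT a ig).
apply: complex_ext; rewrite !ReImE /=.
  under eq_Rintegral do rewrite ReImE.
  by rewrite RintegralB ?RintegralZl//; exact: Z.
under eq_Rintegral do rewrite ReImE.
by rewrite RintegralD ?RintegralZl//; exact: Z.
Qed.

Lemma cintegrableN F : cintegrable F -> cintegrable (fun t => - F t).
Proof. by move=> /(cintegrableZ (- 1)); under eq_fun do rewrite mulN1r. Qed.

Lemma cintB F G : cintegrable F -> cintegrable G ->
  cint (fun t => F t - G t) = cint F - cint G.
Proof.
move=> iF iG; rewrite cintD//; last exact: cintegrableN.
congr (_ + _); rewrite -mulN1r -cintZ//; congr cint.
by apply/funext => t; rewrite mulN1r.
Qed.

End ComplexIntegral.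

(** * Gaussian integrals along shifted horizontal lines *)

Section OneDimensionalKernels.
Variable R : realType.
Local Notation C := (R[i]^o).
Local Notation mu := (@lebesgue_measure R).
Implicit Types (f F : R -> R) (m s x a : R).

(** The integral is the limit of those over growing intervals centred at m; there it equals a
    difference of boundary values of F, which the decay hypothesis makes O(1/n). *)
Lemma integral_derivative_eq0 f F m B : continuous f ->
  (forall x, is_derive x (1 : R) F (f x)) -> mu.-integrable setT (EFin \o f) ->
  (forall x, `|F x| * (1 + `|x - m|) <= B) -> \int[mu]_x f x = 0.
Proof.
move=> cf dF intf FB.
pose D (n : nat) : set R := `[m - n.+1%:R, m + n.+1%:R]%classic.
have mf : measurable_fun setT f by exact: continuous_measurable_fun.
have mD n : measurable (D n) by exact: measurable_itv.
have mfD n : measurable_fun setT (fun x => ((f \_ (D n)) x)%:E).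
  apply/measurable_EFinP; apply: (measurable_restrictT f (mD n)).1.
  exact: measurable_funTS.
have cvgf x : ((f \_ (D n)) x)%:E @[n --> \oo] --> (f x)%:E.
  apply: cvg_near_cst; near=> n; congr EFin.
  rewrite patchE ifT// inE /D /= in_itv /=.
  have : `|x - m| <= n.+1%:R.
    apply: (@le_trans _ _ n%:R); last by rewrite ler_nat.
    near: n; exact: nbhs_infty_ger.
  by rewrite ler_norml => /andP[? ?]; apply/andP; split; lra.
pose I n := (\int[mu]_x ((f \_ (D n)) x)%:E)%E.
have cvI : I @ \oo --> (\int[mu]_x (f x)%:E)%E.
  apply: (@dominated_cvg _ (measurableTypeR R) R mu setT measurableT
    (fun n x => ((f \_ (D n)) x)%:E) (EFin \o f) (abse \o (EFin \o f))) => //.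
  - exact: integrable_abse.
  - move=> n x _; rewrite /= lee_fin patchE.
    by case: ifP => // _; rewrite normr0.
have IE n : I n = (F (m + n.+1%:R) - F (m - n.+1%:R))%:E.
  have -> : I n = (\int[mu]_(x in D n) (f x)%:E)%E.
    by rewrite [RHS]integral_mkcond restrict_EFin.
  rewrite EFinB.
  have cF x : {for x, continuous F} by exact: rder_continuous (dF x).
  apply: continuous_FTC2.
  - have : 0 < n.+1%:R :> R by rewrite ltr0n.
    lra.
  - exact: continuous_subspaceT.
  - split.
    + by move=> x _; have [] := dF x.
    + by apply: cvg_at_right_filter; exact: cF.
    + by apply: cvg_at_left_filter; exact: cF.
  - by move=> x _; exact: rder_derive1.
have B0 : 0 <= B by apply: le_trans (FB m); rewrite mulr_ge0// addr_ge0.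
have FB' n e : `|e| = 1 -> `|F (m + e * n.+1%:R)| <= B * harmonic n.
  move=> e1; rewrite /= ler_pdivlMr ?ltr0n//; apply: le_trans (FB (m + e * n.+1%:R)).
  rewrite ler_wpM2l// [m + _]addrC addrK normrM e1 mul1r ger0_norm//.
  by rewrite lerDr.
have : I @ \oo --> 0%:E.
  rewrite (_ : I = EFin \o (fun n => F (m + n.+1%:R) - F (m - n.+1%:R))); last first.
    by apply/funext => n; rewrite IE.
  apply: cvg_EFin; first exact: nearW.
  apply: norm_cvg0.
  apply: (@squeeze_cvgr _ _ _ _ (cst 0) (fun n => B * harmonic n + B * harmonic n)).
  - apply: nearW => n /=; rewrite normr_ge0/= (le_trans (ler_normB _ _))// lerD//.
      by have := FB' n 1; rewrite mul1r normr1; exact.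
    by have := FB' n (- 1); rewrite mulN1r normrN1; exact.
  - exact: cvg_cst.
  - rewrite -[X in _ --> X](addr0 0) -(mulr0 B).
    by apply: cvgD; apply: cvgMr; exact: cvg_harmonic.
move=> cv0; rewrite /Rintegral.
by rewrite (cvg_unique (@ereal_hausdorff R) cvI cv0).
Unshelve. all: by end_near. Qed.

Lemma ler_sqr_affine (c y : R) : 0 < c ->
  `|y| <= (1 + c^-1) * (1 + c * y ^+ 2).
Proof.
move=> c0; have c'0 : 0 < c^-1 by rewrite invr_gt0.
rewrite -(real_normK (num_real y)); set z := `|y|.
have z0 : 0 <= z by exact: normr_ge0.
have -> : (1 + c^-1) * (1 + c * z ^+ 2) = 1 + c * z ^+ 2 + c^-1 + z ^+ 2.
  by field; rewrite gt_eqF.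
have : 0 <= c * z ^+ 2 by rewrite mulr_ge0 ?sqr_ge0// ltW.
nra.
Qed.

(** The centred normal density of standard deviation [s], extended to an entire function. *)
Definition gkern s (z : C) : C :=
  rc (normal_peak s) * cexp (rc (- (s ^+ 2 *+ 2)^-1) * z ^+ 2).

Section GaussianShift.
Variables (m s : R).
Hypothesis s0 : s != 0.
Let k := (s ^+ 2 *+ 2)^-1.
Let P := normal_pdf m s.

Let k0 : 0 < k.
Proof. by rewrite invr_gt0 pmulrn_lgt0// exprn_even_gt0. Qed.

Let PE x : P x = normal_peak s * expR (- k * (x - m) ^+ 2).
Proof.
by rewrite /P normal_pdfE// /normal_fun -/k; congr (_ * expR _); ring.
Qed.

Let GR a x := expR (k * a ^+ 2) * P x * cos (2 * k * (x - m) * a).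
Let GI a x := - (expR (k * a ^+ 2) * P x * sin (2 * k * (x - m) * a)).

Lemma gkernE a x : gkern s ((x - m) +i* a)%C = (GR a x +i* GI a x)%C.
Proof.
have E : rc (- k) * ((x - m) +i* a)%C ^+ 2 =
    ((k * a ^+ 2 + - k * (x - m) ^+ 2) +i* (- (2 * k * (x - m) * a)))%C :> C.
  by apply: complex_ext; rewrite expr2 !ReImE /=; ring.
rewrite /gkern -/k E /cexp /= cosN sinN expRD /GR /GI PE.
by apply: complex_ext; rewrite !ReImE /=; ring.
Qed.

Let DR a x := expR (k * a ^+ 2) * P x *
  (2 * k * a * cos (2 * k * (x - m) * a) -
   2 * k * (x - m) * sin (2 * k * (x - m) * a)).
Let DI a x := - (expR (k * a ^+ 2) * P x *
  (2 * k * a * sin (2 * k * (x - m) * a) +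
   2 * k * (x - m) * cos (2 * k * (x - m) * a))).

Let dexpa a : is_derive a (1 : R) (fun b => expR (k * b ^+ 2))
  (expR (k * a ^+ 2) * (2 * k * a)).
Proof.
apply: rder_eq (rder_comp (is_derive_expR _)
  (rderM (rder_cst a k) (rderX 2 (rder_id a)))) _.
by rewrite /=; ring.
Qed.

Let dP x : is_derive x (1 : R) P (P x * (- (2 * k * (x - m)))).
Proof.
have -> : P = fun x => normal_peak s * expR (- k * (1 * x + - m) ^+ 2).
  by apply/funext => y; rewrite PE; congr (_ * expR (_ * _ ^+ 2)); ring.
apply: rder_eq (rderM (rder_cst x _) (rder_comp (is_derive_expR _)
  (rderM (rder_cst x (- k)) (rderX 2 (rder_affine x 1 (- m)))))) _.
by rewrite /=; ring.
Qed.

Let darg_a (f g : R -> R) a x : (forall t, is_derive t (1 : R) f (g t)) ->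
  is_derive a (1 : R) (fun b => f (2 * k * (x - m) * b))
    (2 * k * (x - m) * g (2 * k * (x - m) * a)).
Proof.
move=> df; have := @rder_comp _ f (fun t => 2 * k * (x - m) * t + 0) _ _ _ (df _)
  (rder_affine a (2 * k * (x - m)) 0).
have -> : (fun t => f (2 * k * (x - m) * t + 0)) =
  (fun t => f (2 * k * (x - m) * t)) by apply/funext => t; rewrite addr0.
by move=> h; apply: rder_eq h _; rewrite addr0 [RHS]mulrC.
Qed.

Let darg_x (f g : R -> R) a x : (forall t, is_derive t (1 : R) f (g t)) ->
  is_derive x (1 : R) (fun y => f (2 * k * (y - m) * a))
    (2 * k * a * g (2 * k * (x - m) * a)).
Proof.
move=> df; have := @rder_comp _ f (fun t => 2 * k * a * t + - (2 * k * a * m)) _ _ _ (df _)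
  (rder_affine x (2 * k * a) (- (2 * k * a * m))).
have E y : 2 * k * a * y + - (2 * k * a * m) = 2 * k * (y - m) * a by ring.
have -> : (fun t => f (2 * k * a * t + - (2 * k * a * m))) =
  (fun t => f (2 * k * (t - m) * a)) by apply/funext => t; rewrite E.
by move=> h; apply: rder_eq h _; rewrite E [RHS]mulrC.
Qed.

Let dGR_a a x : is_derive a (1 : R) (fun b => GR b x) (DR a x).
Proof.
apply: rder_eq (rderM (rderM (dexpa a) (rder_cst a (P x)))
  (darg_a a x (@is_derive_cos R))) _.
by rewrite /DR; ring.
Qed.

Let dGI_a a x : is_derive a (1 : R) (fun b => GI b x) (DI a x).
Proof.
apply: rder_eq (is_deriveN (rderM (rderM (dexpa a) (rder_cst a (P x)))
  (darg_a a x (@is_derive_sin R)))) _.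
by rewrite /DI; ring.
Qed.

Let dGR_x a x : is_derive x (1 : R) (GR a) (DI a x).
Proof.
apply: rder_eq (rderM (rderM (rder_cst x _) (dP x))
  (darg_x a x (@is_derive_cos R))) _.
by rewrite /DI; ring.
Qed.

Let dGI_x a x : is_derive x (1 : R) (GI a) (- DR a x).
Proof.
apply: rder_eq (is_deriveN (rderM (rderM (rder_cst x _) (dP x))
  (darg_x a x (@is_derive_sin R)))) _.
by rewrite /DR; ring.
Qed.

Let P0 x : 0 <= P x. Proof. exact: normal_pdf_ge0. Qed.

(** A linear factor is absorbed by doubling the standard deviation. *)
Let P_moment : exists2 K, 0 <= K & forall x, (1 + `|x - m|) * P x <= K * normal_pdf m (2 * s) x.
Proof.
have s20 : 2 * s != 0 by rewrite mulf_neq0// pnatr_eq0.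
(* Doubling s divides the rate k by 4, so 3/4 k is the rate left to dominate 1 + |x - m|. *)
pose c := 3 / 4 * k; have c0 : 0 < c by rewrite mulr_gt0// divr_gt0.
have p0 := normal_peak_gt0 s0; have p20 := normal_peak_gt0 s20.
exists ((2 + c^-1) * (normal_peak s / normal_peak (2 * s))).
  by rewrite mulr_ge0// ?divr_ge0 ?ltW// addr_gt0// invr_gt0.
move=> x; rewrite PE normal_pdfE//= /normal_fun.
have -> : - (x - m) ^+ 2 / ((2 * s) ^+ 2 *+ 2) = - k * (x - m) ^+ 2 + c * (x - m) ^+ 2.
  by rewrite /c /k; field.
rewrite expRD; set e := expR (- k * _); set y := x - m.
have -> : (2 + c^-1) * (normal_peak s / normal_peak (2 * s)) *
  (normal_peak (2 * s) * (e * expR (c * y ^+ 2))) =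
  (2 + c^-1) * expR (c * y ^+ 2) * (normal_peak s * e) by field; rewrite !gt_eqF.
apply: ler_wpM2r; first by rewrite mulr_ge0 ?expR_ge0// ltW.
have E : 1 + c * y ^+ 2 <= expR (c * y ^+ 2) by exact: expR_ge1Dx.
have c'0 : 0 < c^-1 by rewrite invr_gt0.
apply: (@le_trans _ _ ((2 + c^-1) * (1 + c * y ^+ 2))); last first.
  by apply: ler_wpM2l => //; lra.
have := ler_sqr_affine y c0; have : 0 <= c * y ^+ 2 by rewrite mulr_ge0 ?sqr_ge0// ltW.
lra.
Qed.

Let integrableZ_pdf (K t : R) :
  mu.-integrable setT (EFin \o (fun x => K * normal_pdf m t x)).
Proof. exact: (integrableZl measurableT K (integrable_normal_pdf m t)). Qed.

Let trig_bound (a b y : R) : `|a * cos y - b * sin y| <= `|a| + `|b| /\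
  `|a * sin y + b * cos y| <= `|a| + `|b|.
Proof.
by split; [apply: (le_trans (ler_normB _ _))|apply: (le_trans (ler_normD _ _))];
  rewrite !normrM lerD// ler_piMr// (cos_max, sin_max).
Qed.

Let DRI_le : exists2 K, 0 <= K & forall a x, (`|DR a x| <=
    expR (k * a ^+ 2) * (1 + `|a|) * (K * normal_pdf m (2 * s) x)) /\ (`|DI a x| <=
    expR (k * a ^+ 2) * (1 + `|a|) * (K * normal_pdf m (2 * s) x)).
Proof.
have [K K0 PK] := P_moment; exists (2 * k * K).
  by rewrite !mulr_ge0// ltW.
move=> a x.
have main z : `|z| <= `|2 * k * a| + `|2 * k * (x - m)| ->
  `|expR (k * a ^+ 2) * P x * z| <=
  expR (k * a ^+ 2) * (1 + `|a|) * (2 * k * K * normal_pdf m (2 * s) x).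
  move=> zle; rewrite !normrM (ger0_norm (expR_ge0 _)) (ger0_norm (P0 x)).
  rewrite -!mulrA ler_wpM2l ?expR_ge0//.
  apply: (@le_trans _ _ (P x * ((1 + `|a|) * ((2 * k) * (1 + `|x - m|))))).
    apply: ler_wpM2l => //; apply: (le_trans zle).
    have k20 : 0 < 2 * k by rewrite mulr_gt0.
    rewrite !(normrM (2 * k)) (gtr0_norm k20).
    have := normr_ge0 a; have := normr_ge0 (x - m).
    set u := `|a|; set v := `|x - m| => v0 u0.
    have : 0 <= 2 * k * (1 + u * v) by rewrite mulr_ge0 ?(ltW k20)// addr_ge0// mulr_ge0.
    lra.
  rewrite mulrCA; apply: ler_wpM2l; first by rewrite addr_ge0.
  rewrite mulrCA -!mulrA; apply: ler_wpM2l => //; rewrite ler_wpM2l ?(ltW k0)//.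
  by rewrite mulrC.
have [t1 t2] := trig_bound (2 * k * a) (2 * k * (x - m)) (2 * k * (x - m) * a).
by split; rewrite /DR /DI ?normrN; exact: main.
Qed.

Let cont_of (f g : R -> R) : (forall x, is_derive x (1 : R) f (g x)) -> continuous f.
Proof. by move=> df x; exact: rder_continuous (df x). Qed.

Let cont_P : continuous P. Proof. exact: cont_of dP. Qed.

Let cont_trig a : continuous (fun x => cos (2 * k * (x - m) * a)) /\
   continuous (fun x => sin (2 * k * (x - m) * a)).
Proof.
by split; [exact: cont_of (fun x => darg_x a x (@is_derive_cos R))|
           exact: cont_of (fun x => darg_x a x (@is_derive_sin R))].
Qed.

Let cont_DR a : continuous (DR a).
Proof.
have [c1 c2] := cont_trig a => x; apply: cvgM.
  by apply: cvgM; [exact: cvg_cst|exact: cont_P].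
apply: cvgB; apply: cvgM; [exact: cvg_cst|exact: c1| |exact: c2].
by apply: cvgM; [exact: cvg_cst|apply: cvgB; [exact: cvg_id|exact: cvg_cst]].
Qed.

Let cont_DI a : continuous (DI a).
Proof.
have [c1 c2] := cont_trig a => x; apply: cvgN; apply: cvgM.
  by apply: cvgM; [exact: cvg_cst|exact: cont_P].
apply: cvgD; apply: cvgM; [exact: cvg_cst|exact: c2| |exact: c1].
by apply: cvgM; [exact: cvg_cst|apply: cvgB; [exact: cvg_id|exact: cvg_cst]].
Qed.

Let GRI_le a x : `|GR a x| <= expR (k * a ^+ 2) * P x /\
  `|GI a x| <= expR (k * a ^+ 2) * P x.
Proof.
by split; rewrite /GR /GI ?normrN normrM ger0_norm ?mulr_ge0 ?expR_ge0//;
  rewrite ler_piMr ?mulr_ge0 ?expR_ge0// (cos_max, sin_max).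
Qed.

Lemma nm_gkern_le a x : nm (gkern s ((x - m) +i* a)%C) <=
  2 * expR (k * a ^+ 2) * P x.
Proof.
have [h1 h2] := GRI_le a x; rewrite gkernE /nm /=; lra.
Qed.

(** Cauchy's theorem for a strip. By the Cauchy-Riemann equations the derivative D of G in the
    height a is also the x-derivative of a decaying function H, so its integral over x vanishes and
    the integral of G does not depend on a. *)
Let int_shift (G D H : R -> R -> R) :
  (forall a x, is_derive a (1 : R) (fun b => G b x) (D a x)) ->
  (forall a x, is_derive x (1 : R) (H a) (D a x)) ->
  (forall a, continuous (D a)) -> (forall a, continuous (G a)) ->
  (exists2 K, 0 <= K & forall a x, `|D a x| <=
    expR (k * a ^+ 2) * (1 + `|a|) * (K * normal_pdf m (2 * s) x)) ->
  (forall a x, `|G a x| <= expR (k * a ^+ 2) * P x) ->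
  (forall a x, `|H a x| <= expR (k * a ^+ 2) * P x) ->
  forall a, \int[mu]_x G a x = \int[mu]_x G 0 x.
Proof.
move=> dG dH cD cG [K K0 DK] GP HP.
have [K' K'0 PK'] := P_moment.
have iG a : mu.-integrable setT (EFin \o G a).
  apply: (@integrable_bounded_by _ (measurableTypeR R) R mu
    (fun x => expR (k * a ^+ 2) * P x) (G a)) => //; last first.
    exact: (integrableZl measurableT _ (integrable_normal_pdf m s)).
  by apply: continuous_measurable_fun; exact: cG.
have iD a : mu.-integrable setT (EFin \o D a).
  apply: (@integrable_bounded_by _ (measurableTypeR R) R mu (fun x =>
    (expR (k * a ^+ 2) * (1 + `|a|) * K) * normal_pdf m (2 * s) x) (D a)) => //.
    by apply: continuous_measurable_fun; exact: cD.
  by move=> x; rewrite -mulrA.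
have s20 : 2 * s != 0 by rewrite mulf_neq0// pnatr_eq0.
have D0 a : \int[mu]_x D a x = 0.
  apply: (@integral_derivative_eq0 _ (H a) m
    (expR (k * a ^+ 2) * (K' * normal_peak (2 * s)))) => //.
  move=> x; apply: (@le_trans _ _ (expR (k * a ^+ 2) * P x * (1 + `|x - m|))).
    by rewrite ler_wpM2r// addr_ge0.
  rewrite -mulrA ler_wpM2l ?expR_ge0// mulrC (le_trans (PK' x))// ler_wpM2l//.
  exact: normal_pdf_ub.
have dJ a : is_derive a (1 : R) (fun b => \int[mu]_x G b x) 0.
  (* Differentiation under the integral needs a majorant that is uniform in the height; on the
     window |b| < A the factor exp(k b^2) (1 + |b|) is bounded by its value at A. *)
  pose A := `|a| + 1.
  have Ia : (`]- A, A[%classic : set R) a.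
    by rewrite /= in_itv /= -ltr_norml /A ltrDl.
  pose Gb x := (expR (k * A ^+ 2) * (1 + A) * K) * normal_pdf m (2 * s) x.
  have A0 : 0 <= A by rewrite addr_ge0.
  have Gb0 x : 0 <= Gb x.
    by rewrite !mulr_ge0 ?expR_ge0 ?normal_pdf_ge0// addr_ge0.
  have pE b x : partial1of2 G b x = D b x.
    by rewrite /partial1of2; exact: rder_derive1.
  have Gub b x : (`]- A, A[%classic : set R) b -> setT x -> `|partial1of2 G b x| <= Gb x.
    rewrite pE /= in_itv /= -ltr_norml => bA _; apply: (le_trans (DK b x)).
    rewrite /Gb -[leRHS]mulrA ler_wpM2r//; first by rewrite mulr_ge0 ?normal_pdf_ge0.
    apply: ler_pM => //; rewrite ?expR_ge0 ?addr_ge0//; last by rewrite lerD2l ltW.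
    rewrite ler_expR ler_wpM2l ?(ltW k0)// -(real_normK (num_real b)).
    by rewrite lerXn2r// ?nnegrE// ltW.
  have iGb : mu.-integrable setT (EFin \o Gb) by exact: integrableZ_pdf.
  have dG' b x : (`]- A, A[%classic : set R) b -> setT x -> derivable (G ^~ x) b 1.
    by move=> _ _; have [] := dG b x.
  have hd := derivable_under_integral measurableT Ia (fun b _ => iG b) dG' Gb0 iGb Gub.
  have he := differentiation_under_integral measurableT Ia (fun b _ => iG b) dG' Gb0 iGb Gub.
  apply: DeriveDef => //; rewrite -derive1E he -(D0 a).
  by apply: eq_Rintegral => x _; rewrite pE.
by move=> a; apply: is_derive_0_is_cst.
Qed.

(** At height 0 this is the total mass of the normal law. [int_shift] is applied to the real part
    with H minus the imaginary part, and to the imaginary part with H the real part. *)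
Lemma cint_gkern a : cint mu (fun x => gkern s ((x - m) +i* a)%C) = 1.
Proof.
have [K K0 DK] := DRI_le.
have dGI_x' b x : is_derive x (1 : R) (fun y => - GI b y) (DR b x).
  by apply: rder_eq (is_deriveN (dGI_x b x)) _; exact: opprK.
have eR : \int[mu]_x GR a x = 1.
  rewrite (@int_shift GR DR (fun a x => - GI a x) dGR_a dGI_x' cont_DR
    (fun b => cont_of (dGR_x b))
    (ex_intro2 _ _ K K0 (fun b x => (DK b x).1))
    (fun b x => (GRI_le b x).1)).
    rewrite /Rintegral; under eq_integral => x _.
      by rewrite /GR expr0n /= !mulr0 expR0 cos0 mul1r mulr1; over.
    by rewrite integral_normal_pdf.
  by move=> b x; rewrite normrN; have [] := GRI_le b x.
have eI : \int[mu]_x GI a x = 0.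
  rewrite (@int_shift GI DI GR dGI_a dGR_x cont_DI
    (fun b => cont_of (dGI_x b))
    (ex_intro2 _ _ K K0 (fun b x => (DK b x).2))
    (fun b x => (GRI_le b x).2)
    (fun b x => (GRI_le b x).1)).
  under eq_Rintegral => x _ do rewrite /GI !mulr0 sin0 mulr0 oppr0.
  by rewrite Rintegral_cst// mul0r.
rewrite /cint; under eq_Rintegral do rewrite gkernE /=; rewrite eR.
by under eq_Rintegral do rewrite gkernE /=; rewrite eI.
Qed.

End GaussianShift.

Lemma integral_derivative_step (f F : R -> R) a b : a < b -> continuous f ->
  (forall x, is_derive x (1 : R) F (f x)) ->
  (forall x, x <= a -> F x = 0) -> (forall x, b <= x -> F x = 1) ->
  \int[mu]_x f x = 1 /\ (forall x, x < a \/ b < x -> f x = 0).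
Proof.
move=> ab cf dF Fa Fb.
have f0 x : x < a \/ b < x -> f x = 0.
  case=> hx.
    have d0 : is_derive x (1 : R) F 0.
      apply: near_eq_is_derive (rder_cst x 0); near=> y; rewrite Fa//.
      by rewrite ltW//; near: y; exact: lt_nbhsl.
    by have [_ <-] := dF x; have [_ ->] := d0.
  have d0 : is_derive x (1 : R) F 0.
    apply: near_eq_is_derive (rder_cst x 1); near=> y; rewrite Fb//.
    by rewrite ltW//; near: y; exact: lt_nbhsr.
  by have [_ <-] := dF x; have [_ ->] := d0.
split => //.
have -> : f = f \_ `[a, b].
  apply/funext => x; rewrite patchE; case: ifPn => //.
  rewrite notin_setE /= in_itv /= => /negP; rewrite negb_and -!ltNge => /orP hx.
  by apply: f0.
rewrite -Rintegral_mkcond /Rintegral (@continuous_FTC2 _ f F)//.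
- by rewrite (Fa a)// (Fb b)//= subr0.
- exact: continuous_subspaceT.
- have cF x : {for x, continuous F} by exact: rder_continuous (dF x).
  split.
  + by move=> x _; have [] := dF x.
  + by apply: cvg_at_right_filter; exact: cF.
  + by apply: cvg_at_left_filter; exact: cF.
- by move=> x _; exact: rder_derive1.
Unshelve. all: by end_near. Qed.

End OneDimensionalKernels.

(** * Lebesgue integration over tuples, one coordinate at a time *)

Section TupleIntegral.
Variable R : realType.
Local Notation RM := (measurableTypeR R).
Local Notation mu := (@lebesgue_measure R).
Local Notation ltup n := (lebesgue_tuple R n).

Let consp n (p : RM * n.-tuple RM) : n.+1.-tuple RM := [tuple of p.1 :: p.2].

Let measurable_consp n : measurable_fun setT (@consp n).
Proof. exact: measurable_cons. Qed.

Lemma ge0_integral_tuple_cons n (f : n.+1.-tuple RM -> \bar R) :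
  measurable_fun setT f -> (forall t, (0 <= f t)%E) ->
  (\int[ltup n.+1]_t f t =
   \int[mu]_x \int[ltup n]_t f [tuple of x :: t])%E.
Proof.
move=> mf f0.
have -> : (\int[ltup n.+1]_t f t =
    \int[pushforward (mu \x ltup n)%E (@consp n)]_t f t)%E by [].
rewrite (ge0_integral_pushforward (@measurable_consp n) (mu \x ltup n)%E measurableT mf (fun y _ => f0 y)).
transitivity (\int[(mu \x ltup n)%E]_p (f (consp p)))%E; first by [].
have mfc := measurableT_comp mf (@measurable_consp n).
by rewrite (fubini_tonelli1 _ mfc)//= => p; exact: f0.
Qed.

Lemma integral_tuple_cons n (f : n.+1.-tuple RM -> \bar R) :
  measurable_fun setT f -> (ltup n.+1).-integrable setT f ->
  (\int[ltup n.+1]_t f t = \int[mu]_x \int[ltup n]_t f [tuple of x :: t])%E /\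
  (\int[ltup n.+1]_t f t = \int[ltup n]_t \int[mu]_x f [tuple of x :: t])%E.
Proof.
move=> mf /integrableP[_ fi].
have mfc : measurable_fun setT (f \o @consp n).
  exact: (measurableT_comp mf (@measurable_consp n)).
have if' : (mu \x ltup n)%E.-integrable setT (f \o @consp n).
  apply/integrableP; split => //; apply: le_lt_trans fi; rewrite le_eqVlt.
  apply/orP; left; apply/eqP.
  have -> : (\int[ltup n.+1]_t `|f t| =
    \int[pushforward (mu \x ltup n)%E (@consp n)]_t `|f t|)%E by [].
  have mnf : measurable_fun setT (fun t => `|f t|%E) by exact: measurableT_comp.
  by rewrite (ge0_integral_pushforward (@measurable_consp n) (mu \x ltup n)%E
    measurableT mnf (fun y _ => abse_ge0 _)).
have -> : (\int[ltup n.+1]_t f t =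
    \int[pushforward (mu \x ltup n)%E (@consp n)]_t f t)%E by [].
rewrite (integral_pushforward (@measurable_consp n) mf)//.
have -> : (\int[(mu \x ltup n)%E]_(p in @consp n @^-1` setT) (f \o @consp n) p =
  \int[(mu \x ltup n)%E]_p (f \o @consp n) p)%E by [].
by split; [rewrite -fubini1|rewrite -fubini2].
Qed.

Lemma integral_tuple0 (f : 0.-tuple RM -> \bar R) :
  (\int[ltup 0]_t f t = f [tuple])%E.
Proof.
have -> : f = cst (f [tuple]) by apply/funext => t; rewrite (tuple0 t).
by rewrite integral_cst//= diracT mule1.
Qed.

Lemma measurable_prod_tuple n (w : 'I_n -> R -> R) :
  (forall i, measurable_fun setT (w i)) ->
  measurable_fun setT (fun t : n.-tuple RM => \prod_(i < n) w i (tnth t i)).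
Proof.
move=> mw; elim: (index_enum _) => [|i r ih].
  by under eq_fun do rewrite big_nil; exact: measurable_cst.
under eq_fun do rewrite big_cons; apply: measurable_funM => //.
exact: (measurableT_comp (mw i) (measurable_tnth i)).
Qed.

Lemma integral_prod_tuple n (w : 'I_n -> R -> R) (c : 'I_n -> R) :
  (forall i, measurable_fun setT (w i)) -> (forall i x, 0 <= w i x) ->
  (forall i, (\int[mu]_x (w i x)%:E = (c i)%:E)%E) ->
  (\int[ltup n]_t (\prod_(i < n) w i (tnth t i))%:E = (\prod_(i < n) c i)%:E)%E.
Proof.
elim: n w c => [|n ih] w c mw w0 wc.
  by rewrite integral_tuple0 !big_ord0.
rewrite ge0_integral_tuple_cons//; first last.
- by move=> t; rewrite lee_fin prodr_ge0.
- by apply/measurable_EFinP; exact: measurable_prod_tuple.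
have E x : (\int[ltup n]_t (\prod_(i < n.+1) w i (tnth [tuple of x :: t] i))%:E
    = (w ord0 x)%:E * (\prod_(i < n) c (lift ord0 i))%:E)%E.
  under eq_integral => t _.
    rewrite big_ord_recl tnth0 EFinM.
    under eq_bigr do rewrite tnthS.
    over.
  rewrite ge0_integralZl_EFin//.
  - by rewrite (ih (fun i => w (lift ord0 i)) (fun i => c (lift ord0 i))).
  - by move=> t _; rewrite lee_fin prodr_ge0.
  - apply/measurable_EFinP.
    exact: (@measurable_prod_tuple n (fun i => w (lift ord0 i))).
under eq_integral do rewrite E muleC.
have c0 i : 0 <= c i by rewrite -lee_fin -wc integral_ge0// => x _; rewrite lee_fin.
rewrite ge0_integralZl_EFin//.
- by rewrite wc -EFinM mulrC big_ord_recl.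
- by move=> x _; rewrite lee_fin.
- by apply/measurable_EFinP; exact: mw.
- by rewrite prodr_ge0.
Qed.

Definition integrable_weights n (w : 'I_n -> R -> R) := forall i,
  [/\ measurable_fun setT (w i), forall x, 0 <= w i x &
      mu.-integrable setT (EFin \o w i)].

Lemma integrable_prod_tuple n (w : 'I_n -> R -> R) : integrable_weights w ->
  (ltup n).-integrable setT
    (EFin \o (fun t : n.-tuple RM => \prod_(i < n) w i (tnth t i))).
Proof.
move=> hw; apply/integrableP; split.
  by apply/measurable_EFinP; apply: measurable_prod_tuple => i; have [] := hw i.
under eq_integral => t _.
  rewrite /= ger0_norm; last by rewrite prodr_ge0// => i _; have [_ + _] := hw i; exact.
  over.
rewrite (@integral_prod_tuple _ _ (fun i => \int[mu]_x w i x)) ?ltry//.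
- by move=> i; have [] := hw i.
- by move=> i; have [] := hw i.
- move=> i; rewrite /Rintegral fineK//; apply: integrable_fin_num => //.
  by have [] := hw i.
Qed.

Definition tupd n (t : n.-tuple RM) k x : n.-tuple RM :=
  [tuple (if i == k then x else tnth t i) | i < n].

Lemma tupd0 n x y (t : n.-tuple RM) :
  tupd [tuple of y :: t] ord0 x = [tuple of x :: t].
Proof.
apply: eq_from_tnth => i; rewrite tnth_mktuple.
case: (unliftP ord0 i) => [j ->|->]; last by rewrite eqxx !tnth0.
by rewrite !tnthS eq_sym (negbTE (neq_lift _ _)).
Qed.

Lemma tupdS n k x y (t : n.-tuple RM) :
  tupd [tuple of y :: t] (lift ord0 k) x = [tuple of y :: tupd t k x].
Proof.
apply: eq_from_tnth => i; rewrite tnth_mktuple.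
case: (unliftP ord0 i) => [j ->|->].
  by rewrite !tnthS tnth_mktuple (inj_eq lift_inj).
by rewrite !tnth0 (negbTE (neq_lift _ _)).
Qed.

(* Fubini, with an arbitrary coordinate integrated first. *)
Lemma integral_slice_eq0 n (k : 'I_n) (F : n.-tuple RM -> R) (w : 'I_n -> R -> R)
    (K : R) :
  measurable_fun setT F -> integrable_weights w ->
  (forall t, `|F t| <= K * \prod_(i < n) w i (tnth t i)) ->
  (forall t, (\int[mu]_x (F (tupd t k x))%:E = 0)%E) ->
  (\int[ltup n]_t (F t)%:E = 0)%E.
Proof.
elim: n k F w K => [|n ih] k F w K mF hw Fw F0; first by case: k F0.
have iF : (ltup n.+1).-integrable setT (EFin \o F).
  apply: (integrable_bounded_by mF Fw).
  exact: (integrableZl measurableT K (integrable_prod_tuple hw)).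
have [e1 e2] := integral_tuple_cons ((measurable_EFinP _ _).2 mF) iF.
case: (unliftP ord0 k) F0 => [j ->|->] F0.
  rewrite e1 -[RHS](@integral0 _ _ _ mu setT).
  apply: eq_integral => x _ /=.
  apply: (ih j (fun t => F [tuple of x :: t]) (fun i => w (lift ord0 i))
    (K * w ord0 x)).
  - exact: (measurableT_comp mF
      (measurableT_comp (@measurable_consp n) (pair1_measurable (x : RM)))).
  - by move=> i; exact: hw.
  - move=> t; apply: (le_trans (Fw _)); rewrite big_ord_recl tnth0 mulrA.
    by under eq_bigr do rewrite tnthS.
  - by move=> t; rewrite -[RHS](F0 [tuple of x :: t]); under [RHS]eq_integral do rewrite tupdS.
rewrite e2 -[RHS](@integral0 _ _ _ (ltup n) setT).
apply: eq_integral => t _ /=; rewrite -[RHS](F0 [tuple of 0 :: t]).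
by apply: eq_integral => x _; rewrite tupd0.
Qed.

Definition row_tuple n (s : n.-tuple RM) : 'rV[R]_n := \row_i tnth s i.

(** Tuples carry the product sigma-algebra and rows carry a topology. The two are linked by writing
    an open set as the countable union of the boxes with rational centre and radius 1/(k+1) that it
    contains. *)
Lemma measurable_open_row_tuple n (A : set 'rV[R]_n) : open A ->
  measurable (@row_tuple n @^-1` A).
Proof.
move=> oA.
pose box (q : n.-tuple rat * nat) : set (n.-tuple RM) :=
  \bigcap_(i in [set: 'I_n])
    (fun s => tnth s i) @^-1` `]ratr (tnth q.1 i) - q.2.+1%:R^-1, ratr (tnth q.1 i) + q.2.+1%:R^-1[.
have mbox q : measurable (box q).
  apply: fin_bigcap_measurable => // i _; rewrite -[X in measurable X]setTI.
  by apply: measurable_tnth => //; exact: measurable_itv.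
pose G q : set (n.-tuple RM) := if `[< box q `<=` @row_tuple n @^-1` A >] then box q else set0.
have -> : @row_tuple n @^-1` A = \bigcup_q G q.
  apply/seteqP; split => [s As|s [q _]]; last first.
    by rewrite /G; case: asboolP => // h /h.
  have /nbhs_ballP[e /= e0 eA] : nbhs (row_tuple s) A by exact: open_nbhs_nbhs.
  (* The point is within 1/(k+1) of the rational centre and so is any other point of the box, hence
     the factor 2. *)
  have [k hk] : exists k : nat, 2 * k.+1%:R^-1 < e.
    exists (Num.trunc (2 / e)); rewrite ltr_pdivrMr ?ltr0n// mulrC -ltr_pdivrMr//.
    exact: truncnS_gt.
  have k0 : 0 < k.+1%:R^-1 :> R by rewrite invr_gt0 ltr0n.
  have hq i : exists q : rat, ratr q \in `]tnth s i - k.+1%:R^-1, tnth s i + k.+1%:R^-1[.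
    by apply: rat_in_itvoo; rewrite ltrBlDr -addrA ltrDl addr_gt0.
  pose q : n.-tuple rat := [tuple sval (cid (hq i)) | i < n].
  have qE i : ratr (tnth q i) \in `]tnth s i - k.+1%:R^-1, tnth s i + k.+1%:R^-1[.
    by rewrite tnth_mktuple; case: cid.
  exists (q, k) => //; rewrite /G; case: asboolP => [_|].
    move=> i _ /=; have := qE i; rewrite !in_itv /= => /andP[q1 q2].
    by apply/andP; split; [rewrite ltrBlDr|rewrite -ltrBlDr].
  case=> s' bs'; apply: eA; rewrite mx_norm_ball /ball_ /= [X in X < _]mx_normrE.
  apply/bigmax_ltP; split => // -[i0 i] _ /=; rewrite !mxE.
  have aux (a b c dl : R) : 2 * dl < e -> c - dl < b < c + dl ->
      a - dl < c < a + dl -> `|a - b| < e.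
    by move=> ? ? ?; rewrite ltr_norml; apply/andP; split; lra.
  move: (bs' i I) (qE i); rewrite /= !in_itv /=; exact: aux hk.
apply: countable_bigcupT_measurable => [|q]; first exact: countableP.
by rewrite /G; case: ifP.
Qed.

End TupleIntegral.

(** * Triangular products of kernels have integral 1 *)

Section TupleNormalization.
Variable R : realType.
Local Notation C := (R[i]^o).
Local Notation Re := (@complex.Re R).
Local Notation Im := (@complex.Im R).
Local Notation RM := (measurableTypeR R).
Local Notation mu := (@lebesgue_measure R).
Local Notation ltup n := (lebesgue_tuple R n).

Lemma integrable_real_weights n (w : 'I_n -> R -> R) (K : R) :
  integrable_weights w -> (ltup n).-integrable setT
    (EFin \o (fun t : n.-tuple RM => K * \prod_(i < n) w i (tnth t i))).
Proof.
by move=> hw; exact: (integrableZl measurableT K (integrable_prod_tuple hw)).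
Qed.

Lemma cint_slice_eq0 n (k : 'I_n) (F : n.-tuple RM -> C) (w : 'I_n -> R -> R)
    (K : R) :
  cmfun F -> integrable_weights w ->
  (forall t, nm (F t) <= K * \prod_(i < n) w i (tnth t i)) ->
  (forall t, cintegrable mu (fun x => F (tupd t k x))) ->
  (forall t, cint mu (fun x => F (tupd t k x)) = 0) ->
  cint (ltup n) F = 0.
Proof.
move=> [mF1 mF2] hw Fw iF F0; apply: complex_ext; rewrite /= /Rintegral.
  rewrite (integral_slice_eq0 (k := k) mF1 hw (K := K)) //.
  - by move=> t; exact: le_trans (Re_le_nm _) (Fw t).
  - move=> t; have [i1 _] := iF t; have /(congr1 Re) := F0 t.
    by rewrite /= /Rintegral => /eqP; rewrite fine_eq0 ?integrable_fin_num// => /eqP.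
rewrite (integral_slice_eq0 (k := k) mF2 hw (K := K)) //.
- by move=> t; exact: le_trans (Im_le_nm _) (Fw t).
- move=> t; have [_ i2] := iF t; have /(congr1 Im) := F0 t.
  by rewrite /= /Rintegral => /eqP; rewrite fine_eq0 ?integrable_fin_num// => /eqP.
Qed.

Lemma tnth_tupd n (s : n.-tuple RM) k x i :
  tnth (tupd s k x) i = if i == k then x else tnth s i.
Proof. by rewrite tnth_mktuple. Qed.

Section Normalization.
Variables (n : nat) (kap : 'I_n -> R -> R -> C) (a : 'I_n -> n.-tuple RM -> R).
Variables (rank : 'I_n -> nat) (w : 'I_n -> R -> R).
Hypothesis mkap : forall i, cmfun (fun s : n.-tuple RM => kap i (tnth s i) (a i s)).
Hypothesis ikap : forall i s, cintegrable mu (fun x => kap i x (a i s)).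
Hypothesis kap1 : forall i s, cint mu (fun x => kap i x (a i s)) = 1.
Hypothesis hw : integrable_weights w.
Hypothesis kapw : forall i s x, nm (kap i x (a i s)) <= w i x.
Hypothesis arank : forall i l s x, (rank i <= rank l)%N -> a i (tupd s l x) = a i s.

Let g (x : R) := normal_pdf 0 1 x.
(** Majorises both a kernel and the density that replaces it, so one weight serves all the products
    [PS S]. *)
Let W i x := w i x + g x.

Let hW : integrable_weights W.
Proof.
move=> i; have [mw w0 iw] := hw i; split.
- by apply: measurable_funD => //; exact: measurable_normal_pdf.
- by move=> x; rewrite addr_ge0 ?normal_pdf_ge0.
- exact: (integrableD measurableT iw (integrable_normal_pdf 0 1)).
Qed.

(** Integrating out a factor is expressed as replacing it by the fixed probability density g: the
    number of variables never changes, and the induction runs over the set S of factors already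
    replaced. *)
Let PS (S : {set 'I_n}) (s : n.-tuple RM) : C :=
  \prod_i (if i \in S then rc (g (tnth s i)) else kap i (tnth s i) (a i s)).

Let cmfun_PS S : cmfun (PS S).
Proof.
apply: cmfun_prod => i; case: (i \in S) => //.
apply: cmfun_rc; apply: (measurableT_comp (measurable_normal_pdf 0 1)).
exact: measurable_tnth.
Qed.

Let nm_PS S s : nm (PS S s) <= \prod_i W i (tnth s i).
Proof.
apply: (le_trans (nm_prod _ _ _)); apply: ler_prod => i _; rewrite nm_ge0 /=.
have [_ w0 _] := hw i; case: ifP => _.
  by rewrite nm_rc ger0_norm ?normal_pdf_ge0// lerDr.
by rewrite (le_trans (kapw _ _ _))// lerDl normal_pdf_ge0.
Qed.

Let cintegrable_PS S : cintegrable (ltup n) (PS S).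
Proof.
apply: (cintegrable_bounded_by (cmfun_PS S) (nm_PS S)).
exact: integrable_prod_tuple hW.
Qed.

Let cintegrable_g : cintegrable mu (fun x => rc (g x)).
Proof. by split; [exact: integrable_normal_pdf|exact: integrable0]. Qed.

Let cint_g : cint mu (fun x => rc (g x)) = 1.
Proof.
apply: complex_ext; rewrite /=; last by rewrite Rintegral_cst// mul0r.
by rewrite /Rintegral integral_normal_pdf.
Qed.

(** As a function of coordinate i alone, the difference of the two products is a constant times
    [kap i - g], of integral 0: by maximality of its rank, no remaining shift depends on that
    coordinate. *)
Let cint_PS_step (S : {set 'I_n}) i : i \notin S -> (forall l, l \notin S -> (rank l <= rank i)%N) ->
  cint (ltup n) (PS S) = cint (ltup n) (PS (i |: S)).
Proof.
move=> iS imax; apply/eqP; rewrite -subr_eq0 -cintB//; apply/eqP.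
pose D (s : n.-tuple RM) : C := \prod_(l | l != i)
  (if l \in S then rc (g (tnth s l)) else kap l (tnth s l) (a l s)).
have E s x : PS S (tupd s i x) - PS (i |: S) (tupd s i x) =
    D s * (kap i x (a i s) - rc (g x)).
  rewrite [RHS]mulrC mulrBl; congr (_ - _); rewrite /PS (bigD1 i)//=.
    rewrite (negbTE iS) !tnth_tupd eqxx arank//; congr (_ * _).
    apply: eq_bigr => l li; rewrite tnth_tupd (negbTE li).
    by case: ifPn => // lS; rewrite arank// imax.
  rewrite finset.setU11 !tnth_tupd eqxx; congr (_ * _); apply: eq_bigr => l li.
  rewrite finset.in_setU1 (negbTE li) /= tnth_tupd (negbTE li).
  by case: ifPn => // lS; rewrite arank// imax.
apply: (@cint_slice_eq0 n i _ W 2) => //.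
- exact: cmfunB.
- move=> t; rewrite (natrD _ 1 1) mulrDl mul1r (le_trans (nmD _ _))// nmN.
  by rewrite lerD.
- move=> s; under eq_fun do rewrite E; apply: cintegrableZ.
  by apply: cintegrableD => //; exact: cintegrableN.
- move=> s; under eq_fun do rewrite E; rewrite cintZ ?cintB//.
    by rewrite kap1 cint_g subrr mulr0.
  by apply: cintegrableD => //; exact: cintegrableN.
Qed.

(* The factors are integrated one at a time, from the highest rank downwards. *)
Lemma cint_prod_triangular :
  cint (ltup n) (fun s => \prod_i kap i (tnth s i) (a i s)) = 1.
Proof.
suff H k (S : {set 'I_n}) : #|~: S| = k -> cint (ltup n) (PS S) = 1.
  rewrite -[RHS](H _ (finset.set0) erefl); congr (cint _ _); apply/funext => s.
  by apply: eq_bigr => i _; rewrite finset.in_set0.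
elim: k S => [|k ih] S Sk.
  have ST : S = finset.setT by rewrite -[S]finset.setCK (cards0_eq Sk) finset.setC0.
  have -> : PS S = (fun s => rc (\prod_i g (tnth s i))).
    by apply/funext => s; rewrite /PS rc_prod; apply: eq_bigr => i _; rewrite ST finset.in_setT.
  apply: complex_ext; rewrite /=; last by rewrite Rintegral_cst// mul0r.
  rewrite /Rintegral (@integral_prod_tuple R n (fun=> g) (fun=> 1)) ?big1//.
  - by move=> i; exact: measurable_normal_pdf.
  - by move=> i x; exact: normal_pdf_ge0.
  - by move=> i; exact: integral_normal_pdf.
have [i0 i0S] : exists i, i \in ~: S by apply/finset.set0Pn; rewrite -cards_eq0 Sk.
have [i /= iS imax] := @arg_maxnP _ i0 (fun i => i \in ~: S) rank i0S.
rewrite (@cint_PS_step S i).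
- by apply: ih; move: Sk; rewrite (cardsD1 i) iS finset.setCU => -[<-]; rewrite finset.setDE finset.setIC.
- by rewrite -finset.in_setC.
- by move=> l lS; apply: imax; rewrite finset.in_setC.
Qed.

End Normalization.

Lemma measurable_row_tuple_in n (D : set 'rV[R]_n) (f : 'rV[R]_n -> R) :
  open D -> (forall t, D t -> {for t, continuous f}) ->
  measurable_fun (@row_tuple R n @^-1` D) (fun s => f (row_tuple s)).
Proof.
move=> oD cf mD; apply: (measurability _ (RGenOpens.measurableE R)) => //.
move=> _ [_ [a [b ->]] <-].
have -> : (@row_tuple R n @^-1` D) `&` (fun s => f (row_tuple s)) @^-1` `]a, b[ =
    @row_tuple R n @^-1` (D `&` f @^-1` `]a, b[) by [].
apply: measurable_open_row_tuple; rewrite openE => t [Dt ft].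
rewrite /interior; apply: filterI; first exact: open_nbhs_nbhs.
by apply: (cf t Dt); apply: open_nbhs_nbhs; split => //; exact: interval_open.
Qed.

Lemma measurable_row_tuple n (f : 'rV[R]_n -> R) : continuous f ->
  measurable_fun setT (fun s : n.-tuple RM => f (row_tuple s)).
Proof.
move=> cf; apply: (@measurable_row_tuple_in n setT f openT) => t _; exact: cf.
Qed.

End TupleNormalization.

(** * Convergence of complex-valued functions *)

Section ComplexTopology.
Variable R : realType.
Local Notation C := (R[i]^o).
Local Notation Re := (@complex.Re R).
Local Notation Im := (@complex.Im R).

Lemma norm_le_nm (z : C) : `|z| <= rc (nm z).
Proof.
rewrite normc_def lecR -[leRHS](ger0_norm (nm_ge0 z)) -sqrtr_sqr ler_wsqrtr//.
rewrite /nm sqrrD -[Re z ^+ 2](real_normK (num_real _)).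
rewrite -[Im z ^+ 2](real_normK (num_real _)) addrAC lerDl mulrn_wge0// mulr_ge0.
Qed.

Lemma nm_le_norm (z : C) : rc (nm z) <= 2 * `|z|.
Proof.
have -> : (2 : C) = rc 2 by rewrite -rc_nat.
rewrite normc_def -[(_)%:C%C]/(rc _) -rcM lecR mulr_natl mulr2n lerD//.
  by rewrite -sqrtr_sqr ler_wsqrtr// lerDl sqr_ge0.
by rewrite -sqrtr_sqr ler_wsqrtr// lerDr sqr_ge0.
Qed.

Lemma gt0_rc (e : C) : 0 < e -> e = rc (Re e) /\ 0 < Re e.
Proof.
by rewrite ltcE /= => /andP[/eqP i0 r0]; split => //; apply: complex_ext.
Qed.

Lemma cvg_nmP T (F : set_system T) {FF : Filter F} (f : T -> C) (z : C) :
  f @ F --> z <-> (forall e : R, 0 < e -> \forall t \near F, nm (z - f t) < e).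
Proof.
split => [/cvgrPdist_lt h e e0|h].
  have e20 : 0 < rc (e / 2) by rewrite ltcR divr_gt0.
  near=> t; have : `|z - f t| < rc (e / 2) by near: t; exact: h.
  move=> zf; rewrite -ltcR -[(_)%:C%C]/(rc _) -[ltRHS]/(rc e).
  apply: (le_lt_trans (nm_le_norm _)).
  have -> : rc e = 2 * rc (e / 2).
    have -> : (2 : C) = rc 2 by rewrite -rc_nat.
    by rewrite -rcM mulrC divfK.
  by rewrite ltr_pM2l.
apply/cvgrPdist_lt => e /gt0_rc[-> e0].
near=> t; apply: (le_lt_trans (norm_le_nm _)); rewrite ltcR.
by near: t; exact: h.
Unshelve. all: by end_near. Qed.

Lemma cvg_Re T (F : set_system T) {FF : Filter F} (f : T -> C) (z : C) :
  f @ F --> z -> (Re (f t) @[t --> F] --> Re z) /\ (Im (f t) @[t --> F] --> Im z).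
Proof.
move=> /cvg_nmP h; split; apply/cvgrPdist_lt => e /h fz;
  apply: filterS fz => t; apply: le_lt_trans.
  by rewrite -cReN -cReD; exact: Re_le_nm.
by rewrite -cImN -cImD; exact: Im_le_nm.
Qed.

Lemma cvg_complex T (F : set_system T) {FF : Filter F} (f : T -> C) (z : C) :
  Re (f t) @[t --> F] --> Re z -> Im (f t) @[t --> F] --> Im z -> f @ F --> z.
Proof.
move=> /cvgrPdist_lt hR /cvgrPdist_lt hI; apply/cvg_nmP => e e0.
have e20 : 0 < e / 2 by rewrite divr_gt0.
near=> t; rewrite /nm !ReImE [e](splitr e) ltrD//.
  by near: t; exact: hR.
by near: t; exact: hI.
Unshelve. all: by end_near. Qed.

Lemma cvg_rc T (F : set_system T) {FF : Filter F} (f : T -> R) (x : R) :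
  f @ F --> x -> (rc (f t) : C) @[t --> F] --> (rc x : C).
Proof. by move=> fx; apply: cvg_complex => //=; exact: cvg_cst. Qed.

Lemma cvg_cexp T (F : set_system T) {FF : Filter F} (f : T -> C) (z : C) :
  f @ F --> z -> cexp (f t) @[t --> F] --> cexp z.
Proof.
move=> /cvg_Re[fR fI]; have fE : expR (Re (f t)) @[t --> F] --> expR (Re z).
  by apply: (cvg_comp _ expR fR); exact: continuous_expR.
apply: cvg_complex; rewrite /=; apply: cvgM => //.
  by apply: (cvg_comp _ cos fI); exact: continuous_cos.
by apply: (cvg_comp _ sin fI); exact: continuous_sin.
Qed.

End ComplexTopology.

(** * Real directional derivatives and smooth functions on complex space *)

Section SmoothFunctions.
Variables (R : realType) (n : nat).
Local Notation C := (R[i]^o).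
Local Notation Re := (@complex.Re R).
Local Notation Im := (@complex.Im R).
Implicit Types (g : 'rV[C]_n -> C) (p v : 'rV[C]_n) (z : C).

Definition rd g p v z :=
  is_derive (0 : R) (1 : R) (line_Re g p v) (Re z) /\
  is_derive (0 : R) (1 : R) (line_Im g p v) (Im z).

Lemma rd_rderivable g p v z : rd g p v z -> rderivable g p v.
Proof. by move=> [[d1 _] [d2 _]]. Qed.

Lemma rd_rderive g p v z : rd g p v z -> rderive v g p = z.
Proof.
move=> [d1 d2]; apply: complex_ext; rewrite /rderive /=; exact: rder_derive1.
Qed.

Lemma rd_eq g p v z z' : rd g p v z -> z = z' -> rd g p v z'.
Proof. by move=> ? <-. Qed.

Lemma rd_cst c p v : rd (fun=> c) p v 0.
Proof. by split; exact: rder_cst. Qed.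

Let move_coord p v (t : R) j : (p + (t%:C)%C *: v) 0 j = p 0 j + rc t * v 0 j.
Proof. by rewrite !mxE. Qed.

Let line0 p v : p + ((0 : R)%:C)%C *: v = p.
Proof. by rewrite scale0r addr0. Qed.

Let line_coord p v j :
  line_Re (fun p => p 0 j) p v = (fun t => Re (v 0 j) * t + Re (p 0 j)) /\
  line_Im (fun p => p 0 j) p v = (fun t => Im (v 0 j) * t + Im (p 0 j)).
Proof.
split; apply/funext => t; rewrite /line_Re /line_Im move_coord !ReImE /=; ring.
Qed.

Lemma rd_coord p v j : rd (fun p => p 0 j) p v (v 0 j).
Proof.
have [e1 e2] := line_coord p v j.
by split; rewrite ?e1 ?e2; exact: rder_affine.
Qed.

Lemma rd_Re (f : R -> R) p v j : smooth1 f ->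
  rd (fun p => rc (f (Re (p 0 j)))) p v (rc (derive1 f (Re (p 0 j)) * Re (v 0 j))).
Proof.
move=> sf; split; last exact: rder_cst.
have -> : line_Re (fun p => rc (f (Re (p 0 j)))) p v =
    fun t => f (Re (v 0 j) * t + Re (p 0 j)).
  by apply/funext => t; have [/funeqP/(_ t) <- _] := line_coord p v j.
apply: (@rder_comp _ f (fun t => Re (v 0 j) * t + Re (p 0 j))); last exact: rder_affine.
by rewrite mulr0 add0r; exact: smooth1_rder.
Qed.

Lemma rd_Im (f : R -> R) p v j : smooth1 f ->
  rd (fun p => rc (f (Im (p 0 j)))) p v (rc (derive1 f (Im (p 0 j)) * Im (v 0 j))).
Proof.
move=> sf; split; last exact: rder_cst.
have -> : line_Re (fun p => rc (f (Im (p 0 j)))) p v =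
    fun t => f (Im (v 0 j) * t + Im (p 0 j)).
  by apply/funext => t; have [_ /funeqP/(_ t) <-] := line_coord p v j.
apply: (@rder_comp _ f (fun t => Im (v 0 j) * t + Im (p 0 j))); last exact: rder_affine.
by rewrite mulr0 add0r; exact: smooth1_rder.
Qed.

Lemma rdD g1 g2 p v z1 z2 : rd g1 p v z1 -> rd g2 p v z2 ->
  rd (fun p => g1 p + g2 p) p v (z1 + z2).
Proof.
move=> [a1 b1] [a2 b2]; split.
  have -> : line_Re (fun p => g1 p + g2 p) p v =
      fun t => line_Re g1 p v t + line_Re g2 p v t.
    by apply/funext => t; rewrite [LHS]cReD.
  by rewrite cReD; exact: rderD.
have -> : line_Im (fun p => g1 p + g2 p) p v =
    fun t => line_Im g1 p v t + line_Im g2 p v t.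
  by apply/funext => t; rewrite [LHS]cImD.
by rewrite cImD; exact: rderD.
Qed.

Lemma rdM g1 g2 p v z1 z2 : rd g1 p v z1 -> rd g2 p v z2 ->
  rd (fun p => g1 p * g2 p) p v (z1 * g2 p + g1 p * z2).
Proof.
move=> [a1 b1] [a2 b2]; split.
  have -> : line_Re (fun p => g1 p * g2 p) p v =
      fun t => line_Re g1 p v t * line_Re g2 p v t
        + (- 1) * (line_Im g1 p v t * line_Im g2 p v t).
    by apply/funext => t; rewrite [LHS]cReM /line_Re /line_Im; ring.
  apply: rder_eq (rderD (rderM a1 a2) (rderM (rder_cst _ (- 1)) (rderM b1 b2))) _.
  by rewrite !ReImE /line_Re /line_Im !line0; ring.
have -> : line_Im (fun p => g1 p * g2 p) p v =
    fun t => line_Re g1 p v t * line_Im g2 p v t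
      + line_Im g1 p v t * line_Re g2 p v t.
  by apply/funext => t; rewrite [LHS]cImM.
apply: rder_eq (rderD (rderM a1 b2) (rderM b1 a2)) _.
by rewrite !ReImE /line_Re /line_Im !line0; ring.
Qed.

Lemma rd_cexp g p v z : rd g p v z -> rd (fun p => cexp (g p)) p v (cexp (g p) * z).
Proof.
move=> [a b]; split.
  have -> : line_Re (fun p => cexp (g p)) p v =
      fun t => expR (line_Re g p v t) * cos (line_Im g p v t) by [].
  apply: rder_eq (rderM (rder_comp (is_derive_expR _) a) (rder_comp (is_derive_cos _) b)) _.
  by rewrite !ReImE /line_Re /line_Im !line0 /=; ring.
have -> : line_Im (fun p => cexp (g p)) p v =
    fun t => expR (line_Re g p v t) * sin (line_Im g p v t) by [].
apply: rder_eq (rderM (rder_comp (is_derive_expR _) a) (rder_comp (is_derive_sin _) b)) _.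
by rewrite !ReImE /line_Re /line_Im !line0 /=; ring.
Qed.

Lemma rd_sum I (r : seq I) (g : I -> 'rV[C]_n -> C) p v (z : I -> C) :
  (forall i, rd (g i) p v (z i)) ->
  rd (fun p => \sum_(i <- r) g i p) p v (\sum_(i <- r) z i).
Proof.
move=> gz; elim: r => [|i r ih].
  by under eq_fun do rewrite big_nil; rewrite big_nil; exact: rd_cst.
by under eq_fun do rewrite big_cons; rewrite big_cons; exact: rdD.
Qed.

(* A class of functions stable under all real directional derivatives. *)
Inductive smoothC : ('rV[C]_n -> C) -> Prop :=
| smoothC_cst c : smoothC (fun=> c)
| smoothC_coord j : smoothC (fun p => p 0 j)
| smoothC_Re f j : smooth1 f -> smoothC (fun p => rc (f (Re (p 0 j))))
| smoothC_Im f j : smooth1 f -> smoothC (fun p => rc (f (Im (p 0 j))))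
| smoothCD g1 g2 : smoothC g1 -> smoothC g2 -> smoothC (fun p => g1 p + g2 p)
| smoothCM g1 g2 : smoothC g1 -> smoothC g2 -> smoothC (fun p => g1 p * g2 p)
| smoothC_cexp g : smoothC g -> smoothC (fun p => cexp (g p)).

Lemma smoothC_sum I (r : seq I) (g : I -> 'rV[C]_n -> C) :
  (forall i, smoothC (g i)) -> smoothC (fun p => \sum_(i <- r) g i p).
Proof.
move=> sg; elim: r => [|i r ih].
  by under eq_fun do rewrite big_nil; exact: smoothC_cst.
by under eq_fun do rewrite big_cons; exact: smoothCD.
Qed.

Lemma smoothC_prod I (r : seq I) (g : I -> 'rV[C]_n -> C) :
  (forall i, smoothC (g i)) -> smoothC (fun p => \prod_(i <- r) g i p).
Proof.
move=> sg; elim: r => [|i r ih].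
  by under eq_fun do rewrite big_nil; exact: smoothC_cst.
by under eq_fun do rewrite big_cons; exact: smoothCM.
Qed.

Lemma smoothC_rd g v : smoothC g ->
  exists2 g', smoothC g' & forall p, rd g p v (g' p).
Proof.
elim=> {g}.
- by move=> c; exists (fun=> 0); [exact: smoothC_cst|move=> p; exact: rd_cst].
- move=> j; exists (fun=> v 0 j); [exact: smoothC_cst|move=> p; exact: rd_coord].
- move=> f j sf.
  exists (fun p => rc (derive1 f (Re (p 0 j))) * rc (Re (v 0 j))).
    by apply: smoothCM; [exact/smoothC_Re/smooth1_derive1|exact: smoothC_cst].
  by move=> p; rewrite -rcM; exact: rd_Re.
- move=> f j sf.
  exists (fun p => rc (derive1 f (Im (p 0 j))) * rc (Im (v 0 j))).
    by apply: smoothCM; [exact/smoothC_Im/smooth1_derive1|exact: smoothC_cst].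
  by move=> p; rewrite -rcM; exact: rd_Im.
- move=> g1 g2 _ [h1 s1 d1] _ [h2 s2 d2]; exists (fun p => h1 p + h2 p).
    exact: smoothCD.
  by move=> p; exact: rdD.
- move=> g1 g2 s1 [h1 sh1 d1] s2 [h2 sh2 d2].
  exists (fun p => h1 p * g2 p + g1 p * h2 p).
    by apply: smoothCD; exact: smoothCM.
  by move=> p; exact: rdM.
- move=> g s [h sh d]; exists (fun p => cexp (g p) * h p).
    by apply: smoothCM => //; exact: smoothC_cexp.
  by move=> p; exact: rd_cexp.
Qed.

Lemma smoothC_continuous g : smoothC g -> continuous g.
Proof.
elim=> {g}.
- by move=> c; exact: cst_continuous.
- by move=> j p; apply: (@coord_continuous R[i] 1 n 0 j p).
- move=> f j sf p; apply: (cvg_rc (F := nbhs p)).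
  have [h _] := cvg_Re (@coord_continuous R[i] 1 n 0 j p : _ --> (p 0 j : C)).
  exact: (cvg_comp (fun q : 'rV[C]_n => Re (q 0 j)) f h (@smooth1_continuous R f sf _)).
- move=> f j sf p; apply: (cvg_rc (F := nbhs p)).
  have [_ h] := cvg_Re (@coord_continuous R[i] 1 n 0 j p : _ --> (p 0 j : C)).
  exact: (cvg_comp (fun q : 'rV[C]_n => Im (q 0 j)) f h (@smooth1_continuous R f sf _)).
- by move=> g1 g2 _ c1 _ c2 p; exact: (cvgD (c1 p) (c2 p)).
- by move=> g1 g2 _ c1 _ c2 p; exact: (@cvgM _ _ (nbhs p) _ g1 g2 (g1 p) (g2 p) (c1 p) (c2 p)).
- by move=> g _ c p; exact: (cvg_cexp (F := nbhs p) (c p)).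
Qed.

Lemma smoothC_smooth_on g U : smoothC g -> smooth_on U g.
Proof.
move=> sg k; elim: k g sg => [|k ih] g sg; split=> //;
  try by apply: continuous_subspaceT; exact: smoothC_continuous.
move=> v; have [g' sg' dg] := smoothC_rd v sg; split.
  by move=> p _; exact: rd_rderivable (dg p).
have -> : rderive v g = g' by apply/funext => p; exact: rd_rderive.
exact: ih.
Qed.

End SmoothFunctions.

(** * Tangent vectors of the graph and the wedge products of the test form *)

Section GraphTangents.
Variables (R : realType) (d m : nat).
Local Notation C := (R[i]^o).
Local Notation Re := (@complex.Re R).
Local Notation Im := (@complex.Im R).
Local Notation par := 'rV[R]_(d + (m + m)).
Variable h : 'rV[R]_d -> 'rV[C]_m -> 'rV[R]_d.
Implicit Types (t : par).

Definition ix (j : 'I_d) : 'I_(d + (m + m)) := lshift (m + m) j.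
Definition iu (l : 'I_m) : 'I_(d + (m + m)) := rshift d (lshift m l).
Definition iv (l : 'I_m) : 'I_(d + (m + m)) := rshift d (rshift m l).

Lemma iuE (l l' : 'I_m) : (iu l == iu l') = (l == l').
Proof. by rewrite (inj_eq (@rshift_inj _ _)) (inj_eq (@lshift_inj _ _)). Qed.
Lemma ivE (l l' : 'I_m) : (iv l == iv l') = (l == l').
Proof. by rewrite !(inj_eq (@rshift_inj _ _)). Qed.
Lemma ixE (j j' : 'I_d) : (ix j == ix j') = (j == j').
Proof. by rewrite (inj_eq (@lshift_inj _ _)). Qed.
Lemma iuvE (l l' : 'I_m) : (iu l == iv l') = false.
Proof. by rewrite (inj_eq (@rshift_inj _ _)) eq_lrshift. Qed.
Lemma ivuE (l l' : 'I_m) : (iv l == iu l') = false.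
Proof. by rewrite eq_sym iuvE. Qed.
Lemma ixuE j l : (ix j == iu l) = false. Proof. exact: eq_lrshift. Qed.
Lemma ixvE j l : (ix j == iv l) = false. Proof. exact: eq_lrshift. Qed.

Lemma iuxE l j : (iu l == ix j) = false. Proof. exact: eq_rlshift. Qed.
Lemma ivxE l j : (iv l == ix j) = false. Proof. exact: eq_rlshift. Qed.

Lemma par_ind (P : 'I_(d + (m + m)) -> Prop) : (forall j, P (ix j)) ->
  (forall l, P (iu l)) -> (forall l, P (iv l)) -> forall i, P i.
Proof.
move=> Px Pu Pv i; case: (splitP i) => j ij.
  by have -> : i = ix j by exact: val_inj.
case: (splitP j) => l jl.
  by have -> : i = iu l by apply: val_inj; rewrite /= ij jl.
by have -> : i = iv l by apply: val_inj; rewrite /= ij jl.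
Qed.

Lemma graph_map_z t j : graph_map h t 0 (lshift m j) = (t 0 (ix j) +i* h_real h t 0 j)%C.
Proof. by rewrite /graph_map row_mxEl !mxE. Qed.

Lemma graph_map_w t l : graph_map h t 0 (rshift d l) = (t 0 (iu l) +i* t 0 (iv l))%C.
Proof. by rewrite /graph_map row_mxEr !mxE. Qed.

Hypothesis dh : forall t, differentiable (h_real h) t.

Definition dh_coef (t : par) (j : 'I_d) (a : 'I_(d + (m + m))) : R := 'J (h_real h) t a j.

Lemma derive_h_real t j a :
  'D_(delta_mx 0 a) (fun s => h_real h s 0 j) t = dh_coef t j a.
Proof.
have dv : derivable (h_real h) t (delta_mx 0 a) by exact: diff_derivable.
have /derivable_mxP/(_ 0 j) := dv => dj.
have -> : 'D_(delta_mx 0 a) (fun s => h_real h s 0 j) t = ('D_(delta_mx 0 a) (h_real h) t) 0 j.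
  by rewrite derive_mx// mxE.
by rewrite deriveEjacobian// -rowE mxE.
Qed.

Lemma derive_par_coord t i a :
  'D_(delta_mx 0 a) (fun s : par => s 0 i) t = (a == i)%:R.
Proof.
rewrite /derive; apply: cvg_lim => //; apply: cvg_near_cst.
near=> e; have e0 : e != 0 by near: e; exact: nbhs_dnbhs_neq.
rewrite /= !mxE addrK /GRing.scale/= mulrA mulVf// mul1r.
by rewrite eq_sym.
Unshelve. all: by end_near. Qed.

Lemma graph_tangent_z t a j : graph_tangent h t a 0 (lshift m j) =
  ((a == ix j)%:R +i* dh_coef t j a)%C.
Proof.
rewrite mxE; congr (_ +i* _)%C.
  rewrite -(derive_par_coord t); congr ('D_ _ _ t).
  by apply/funext => s; rewrite graph_map_z.
rewrite -derive_h_real; congr ('D_ _ _ t).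
by apply/funext => s; rewrite graph_map_z.
Qed.

Lemma graph_tangent_w t a l : graph_tangent h t a 0 (rshift d l) =
  ((a == iu l)%:R +i* (a == iv l)%:R)%C.
Proof.
by rewrite mxE; congr (_ +i* _)%C; rewrite -(derive_par_coord t);
  congr ('D_ _ _ t); apply/funext => s; rewrite graph_map_w.
Qed.

Hypothesis hBG : bloom_graham h.

Lemma h_real_dep t t' (j : 'I_d) :
  (forall k : 'I_d, (k < j)%N -> t 0 (ix k) = t' 0 (ix k)) ->
  (forall l, t 0 (iu l) = t' 0 (iu l)) -> (forall l, t 0 (iv l) = t' 0 (iv l)) ->
  h_real h t 0 j = h_real h t' 0 j.
Proof.
move=> tx tu tv; rewrite /h_real.
have -> : par_w t = par_w t'.
  apply/rowP => l; rewrite !mxE; congr (_ +i* _)%C; [exact: tu|exact: tv].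
by apply: hBG => k kj; rewrite !mxE; exact: tx.
Qed.

Lemma dh_coef_eq0 t (j k : 'I_d) : (j <= k)%N -> dh_coef t j (ix k) = 0.
Proof.
move=> jk; rewrite -derive_h_real /derive; apply: cvg_lim => //.
apply: cvg_near_cst; apply: nearW => e.
rewrite [X in X - _](_ : _ = h_real h t 0 j) ?subrr ?scaler0//.
apply: h_real_dep => [k' k'j|l|l]; rewrite /= !mxE /=.
- rewrite ixE; case: eqP k'j => [->|_]; first by rewrite ltnNge jk.
  by rewrite mulr0 add0r.
- by rewrite eq_sym ixuE mulr0 add0r.
- by rewrite eq_sym ixvE mulr0 add0r.
Qed.

Definition shear t : 'M[C]_(d + (m + m)) :=
  block_mx (\matrix_(j, k) ((j == k)%:R + 'i%C * rc (dh_coef t j (ix k))))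
    (\matrix_(j, l) ('i%C * rc (dh_coef t j (rshift d l)))) 0 1%:M.

(** The function h_j does not depend on x_k for k >= j, so the x block is lower triangular with unit
    diagonal. *)
Lemma det_shear t : \det (shear t) = 1.
Proof.
rewrite /shear det_ublock det1 mulr1 det_trig ?big1// => [j _|].
  by rewrite mxE eqxx dh_coef_eq0// mulr0 addr0.
apply/is_trig_mxP => j k jk; rewrite mxE dh_coef_eq0 ?(ltnW jk)// mulr0 addr0.
by rewrite -val_eqE (ltn_eqF jk).
Qed.

Definition flat_tangent (a : 'I_(d + (m + m))) : 'rV[C]_(d + m) :=
  row_mx (\row_j (a == ix j)%:R) (\row_l ((a == iu l)%:R +i* (a == iv l)%:R)%C).

Lemma shear_x t j b : shear t (ix j) b = (b == ix j)%:R + 'i%C * rc (dh_coef t j b).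
Proof.
elim/par_ind: b => [k|l|l]; rewrite /shear.
- by rewrite block_mxEul mxE ixE eq_sym.
- by rewrite block_mxEur mxE eq_sym ixuE add0r.
- by rewrite block_mxEur mxE eq_sym ixvE add0r.
Qed.

Lemma shear_uv t (e : 'I_(m + m)) b : shear t (rshift d e) b = (b == rshift d e)%:R.
Proof.
rewrite /shear; case: (splitP b) => [k bk|k bk].
  have -> : b = lshift (m + m) k by exact: val_inj.
  by rewrite block_mxEdl mxE eq_lrshift.
have -> : b = rshift d k by exact: val_inj.
by rewrite block_mxEdr mxE (inj_eq (@rshift_inj _ _)) eq_sym.
Qed.

Lemma shear_u t l b : shear t (iu l) b = (b == iu l)%:R.
Proof. exact: shear_uv. Qed.

Lemma shear_v t l b : shear t (iv l) b = (b == iv l)%:R.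
Proof. exact: shear_uv. Qed.

(* On wedge products of these covectors the tangents of the graph act like those
   of a flat graph, up to the unipotent matrix [shear]. *)
Definition good_covector (s : 'rV[C]_(d + m) -> C) :=
  (exists j, s = dzeta j) \/ (exists l, s = dzetabar (rshift d l)) \/ s = (fun=> 0).

Let C_nat (b : bool) : (b%:R : C) = (b%:R +i* 0)%C.
Proof. by case: b. Qed.

(** The value of dz_j on the b-th tangent is delta + i dh_j/dx_b, which is exactly the row [ix j] of
    [shear]. Its conjugate would carry - i instead, which is why the conjugates of dz_j are not
    among the good covectors. *)
Lemma good_covectorE s t b : good_covector s ->
  s (graph_tangent h t b) = \sum_c s (flat_tangent c) * shear t c b.
Proof.
case=> [[j ->]|[[l ->]|->]]; rewrite /dzeta /dzetabar; last first.
- by rewrite big1// => c _; rewrite mul0r.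
- rewrite graph_tangent_w (bigD1 (iu l))//= (bigD1 (iv l))/=; last first.
    by rewrite ivuE.
  rewrite big1 => [|c /andP[c1 c2]]; last first.
    by rewrite row_mxEr mxE (negbTE c1) (negbTE c2) /= oppr0 mul0r.
  rewrite shear_u shear_v !row_mxEr !mxE !eqxx iuvE ivuE !C_nat; apply: complex_ext; rewrite !ReImE /=; ring.
- case: (splitP j) => [j' jj|l jl].
    have -> : j = lshift m j' by exact: val_inj.
    rewrite graph_tangent_z (bigD1 (ix j'))//= big1 => [|c c1]; last first.
      by rewrite row_mxEl mxE (negbTE c1) mul0r.
    rewrite row_mxEl mxE eqxx shear_x !C_nat.
    by apply: complex_ext; rewrite !ReImE /=; ring.
  have -> : j = rshift d l by exact: val_inj.
  rewrite graph_tangent_w (bigD1 (iu l))//= (bigD1 (iv l))/=; last first.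
    by rewrite ivuE.
  rewrite big1 => [|c /andP[c1 c2]]; last first.
    by rewrite row_mxEr mxE (negbTE c1) (negbTE c2) /= mul0r.
  by rewrite shear_u shear_v !row_mxEr !mxE !eqxx iuvE ivuE !C_nat; apply: complex_ext; rewrite !ReImE /=; ring.
Qed.

Lemma wedge_good (s : seq ('rV[C]_(d + m) -> C)) t :
  (forall a, good_covector (nth (fun=> 0) s a)) ->
  wedge s (graph_tangent h t) = wedge s flat_tangent.
Proof.
move=> gs; rewrite /wedge.
have -> : (\matrix_(a, b) nth (fun=> 0) s a (graph_tangent h t b) :
      'M[C]_(d + (m + m))) =
    (\matrix_(a, b) nth (fun=> 0) s a (flat_tangent b)) *m shear t.
  apply/matrixP => a b; rewrite !mxE good_covectorE//.
  by apply: eq_bigr => c _; congr (_ * _); rewrite mxE.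
by rewrite det_mulmx det_shear mulr1.
Qed.

Variable k : 'I_m.

(* Only the forms with [J] omitting one [w_k] are needed: for such [J], the
   derivative of the coefficient along [wbar_k] has a constant weight. *)
Definition other_w : {set 'I_(d + m)} :=
  finset (fun j : 'I_(d + m) => [exists l : 'I_m, (l != k) && (j == rshift d l)]).

Lemma mem_other_w l : (rshift d l \in other_w) = (l != k).
Proof.
rewrite inE; apply/existsP/idP => [[l' /andP[l'k /eqP/rshift_inj ->]]//|lk].
by exists l; rewrite lk eqxx.
Qed.

Lemma other_wP j : j \in other_w -> exists2 l, l != k & j = rshift d l.
Proof. by rewrite inE => /existsP[l /andP[lk /eqP ->]]; exists l. Qed.

Lemma card_other_w : #|other_w| = m.-1.
Proof.
have -> : other_w = [set rshift d l | l in predC1 k]%SET.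
  apply/setP => j; apply/idP/imsetP => [/other_wP[l lk ->]|[l lk ->]].
    by exists l.
  by rewrite mem_other_w.
rewrite card_imset; last exact: rshift_inj.
by rewrite cardC1 card_ord.
Qed.

Definition test_covectors (j : 'I_(d + m)) := dzetabar (R := R) j :: nq_covectors R other_w.

Let size_testS j : size (test_covectors j) = (size (nq_covectors R other_w)).+1.
Proof. by []. Qed.

Let nth_testS j a : nth (fun=> 0) (test_covectors j) a.+1 =
  nth (fun=> 0) (nq_covectors R other_w) a.
Proof. by []. Qed.

Lemma size_test_covectors j : size (test_covectors j) = (d + (m + m))%N.
Proof.
rewrite size_testS /nq_covectors size_cat !size_map -enumT size_enum_ord -cardE card_other_w.
by rewrite -addnS prednK ?addnA// (leq_ltn_trans _ (ltn_ord k)).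
Qed.

Lemma nth_good_map (f : 'I_(d + m) -> 'rV[C]_(d + m) -> C) (e : seq 'I_(d + m)) a :
  (forall j, j \in e -> good_covector (f j)) ->
  good_covector (nth (fun=> 0) (map f e) a).
Proof.
move=> fg; have [ae|ae] := ltnP a (size e).
  by rewrite (nth_map (rshift d k))//; apply: fg; exact: mem_nth.
by rewrite nth_default ?size_map//; right; right.
Qed.

Lemma test_covectors_good a : good_covector (nth (fun=> 0) (test_covectors (rshift d k)) a).
Proof.
rewrite /test_covectors; case: a => [|a] /=; first by right; left; exists k.
rewrite /nq_covectors nth_cat; case: ifP => _; apply: nth_good_map => j.
  by left; exists j.
by rewrite mem_enum => /other_wP[l _ ->]; right; left; exists l.
Qed.

(** The bound [0 < a] separates a row from the head of the list; when the head is the same covector,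
    this exhibits two equal rows. *)
Lemma mem_test_covectors j : (exists a : 'I_(d + (m + m)),
    nth (fun=> 0) (test_covectors j) a = dzetabar j) /\
  (forall i, exists a : 'I_(d + (m + m)),
    nth (fun=> 0) (test_covectors j) a = dzeta i) /\
  (forall l, l != k -> exists2 a : 'I_(d + (m + m)), (0 < a)%N &
    nth (fun=> 0) (test_covectors j) a = dzetabar (rshift d l)).
Proof.
have sz := size_test_covectors j.
have bnd a : (a < size (test_covectors j))%N -> (a < d + (m + m))%N by rewrite sz.
have sz1 : size [seq @dzeta R (d + m) i | i <- enum 'I_(d + m)] = size (enum 'I_(d + m)).
  exact: size_map.
split; [|split].
- by exists (Ordinal (bnd 0%N isT)).
- move=> i; have ie : (index i (enum 'I_(d + m)) < size (enum 'I_(d + m)))%N.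
    by rewrite index_mem mem_enum.
  have ib : ((index i (enum 'I_(d + m))).+1 < size (test_covectors j))%N.
    by rewrite size_testS ltnS size_cat 2!size_map ltn_addr.
  exists (Ordinal (bnd _ ib)); rewrite [nat_of_ord _]/= nth_testS nth_cat ifT; last first.
    by rewrite size_map; exact: ie.
  by rewrite (nth_map i)// nth_index// mem_enum.
- move=> l lk; set i := rshift d l; have io : i \in enum other_w.
    by rewrite mem_enum mem_other_w.
  have ie : (index i (enum other_w) < size (enum other_w))%N by rewrite index_mem.
  have ib : ((size (enum 'I_(d + m)) + index i (enum other_w)).+1
      < size (test_covectors j))%N.
    by rewrite size_testS ltnS size_cat 2!size_map ltn_add2l.
  exists (Ordinal (bnd _ ib)); first by [].
  rewrite [nat_of_ord _]/= nth_testS nth_cat ifF; last first.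
    by rewrite sz1 ltnNge leq_addr.
  rewrite sz1 addKn.
  by rewrite (nth_map i)// nth_index.
Qed.

Lemma wedge_test_eq0 l t : l != k ->
  wedge (test_covectors (rshift d l)) (graph_tangent h t) = 0.
Proof.
move=> lk; have [_ [_ /(_ l lk)[a a0 al]]] := mem_test_covectors (rshift d l).
have z0 : (0 < d + (m + m))%N by rewrite (leq_ltn_trans _ (ltn_ord a)).
apply: (@determinant_alternate _ _ _ (Ordinal z0) a).
  by rewrite -val_eqE /= eq_sym -lt0n.
by move=> b; rewrite !mxE al.
Qed.

(** In the flat case the covectors are all the dz_j, dw_l and conjugates of dw_l. A vector y
    annihilated by them has y_x = 0 and y_u + i y_v = y_u - i y_v = 0, so it vanishes and the
    determinant is nonzero; its value is never computed. *)
Lemma wedge_test_const : exists2 c0 : C, c0 != 0 &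
  forall t, wedge (test_covectors (rshift d k)) (graph_tangent h t) = c0.
Proof.
exists (wedge (test_covectors (rshift d k)) flat_tangent); last first.
  by move=> t; rewrite wedge_good//; exact: test_covectors_good.
rewrite /wedge -det_tr; set W := \matrix_(a, b) _.
apply/negP => /(@det0P R[i] _ (W^T : 'M[R[i]]_(d + (m + m))))[y y0 /rowP yW].
have rowW (a : 'I_(d + (m + m))) : \sum_c y 0 c * nth (fun=> 0) (test_covectors (rshift d k)) a (flat_tangent c) = 0.
  have := yW a; rewrite !mxE => yWa; rewrite -[RHS]yWa.
  by apply: eq_bigr => c _; rewrite !mxE.
have [_ [hz hw]] := mem_test_covectors (rshift d k).
have hbar l : exists a : 'I_(d + (m + m)), nth (fun=> 0) (test_covectors (rshift d k)) a
    = dzetabar (rshift d l).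
  have [->|lk] := eqVneq l k; first by have [[a]] := mem_test_covectors (rshift d k); exists a.
  by have [a _ ?] := hw l lk; exists a.
have sum_z j : y 0 (ix j) = 0.
  have [a az] := hz (lshift m j); rewrite -[RHS](rowW a) az.
  rewrite (bigD1 (ix j))//= big1 => [|c c1].
    by rewrite /dzeta row_mxEl mxE eqxx mulr1 addr0.
  by rewrite /dzeta row_mxEl mxE (negbTE c1) mulr0.
have sum_w l : y 0 (iu l) + 'i%C * y 0 (iv l) = 0.
  have [a az] := hz (rshift d l); rewrite -[RHS](rowW a) az /dzeta.
  rewrite (bigD1 (iu l))//= (bigD1 (iv l))/=; last by rewrite ivuE.
  rewrite big1 => [|c /andP[c1 c2]]; last first.
    by rewrite row_mxEr mxE (negbTE c1) (negbTE c2) /= mulr0.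
  rewrite !row_mxEr !mxE !eqxx iuvE ivuE.
  by apply: complex_ext; rewrite !ReImE /=; ring.
have sum_wb l : y 0 (iu l) - 'i%C * y 0 (iv l) = 0.
  have [a az] := hbar l; rewrite -[RHS](rowW a) az /dzetabar.
  rewrite (bigD1 (iu l))//= (bigD1 (iv l))/=; last by rewrite ivuE.
  rewrite big1 => [|c /andP[c1 c2]]; last first.
    by rewrite row_mxEr mxE (negbTE c1) (negbTE c2) /= oppr0 mulr0.
  rewrite !row_mxEr !mxE !eqxx iuvE ivuE.
  by apply: complex_ext; rewrite !ReImE /=; ring.
move/eqP: y0; apply; apply/rowP => i; rewrite mxE; elim/par_ind: i => [j|l|l] //.
- have := sum_w l; have := sum_wb l.
  move=> /(congr1 (fun z : C => (Re z, Im z))) [+ +] /(congr1 (fun z : C => (Re z, Im z))) [].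
  rewrite !ReImE /= => a1 a2 a3 a4; apply: complex_ext; rewrite /=; lra.
- have := sum_w l; have := sum_wb l.
  move=> /(congr1 (fun z : C => (Re z, Im z))) [+ +] /(congr1 (fun z : C => (Re z, Im z))) [].
  rewrite !ReImE /= => a1 a2 a3 a4; apply: complex_ext; rewrite /=; lra.
Qed.

End GraphTangents.

(** * The weak Cauchy-Riemann equations tested on one explicit form *)

Section CRIdentity.
Variables (R : realType) (d m : nat).
Local Notation C := (R[i]^o).
Local Notation Re := (@complex.Re R).
Local Notation Im := (@complex.Im R).
Local Notation par := 'rV[R]_(d + (m + m)).
Local Notation ix := (@ix d m).
Local Notation iu := (@iu d m).
Local Notation iv := (@iv d m).
Variable h : 'rV[R]_d -> 'rV[C]_m -> 'rV[R]_d.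
Implicit Types (t : par) (p v : 'rV[C]_(d + m)).

(** A left inverse of the graph map, defined on the whole space by forgetting Im z; it extends
    functions of the parameters off the graph, as the coefficients of a test form require. *)
Definition par_of p : par :=
  row_mx (\row_j Re (p 0 (lshift m j)))
    (row_mx (\row_l Re (p 0 (rshift d l))) (\row_l Im (p 0 (rshift d l)))).

Lemma par_of_x p j : par_of p 0 (ix j) = Re (p 0 (lshift m j)).
Proof. by rewrite /par_of row_mxEl mxE. Qed.
Lemma par_of_u p l : par_of p 0 (iu l) = Re (p 0 (rshift d l)).
Proof. by rewrite /par_of row_mxEr row_mxEl mxE. Qed.
Lemma par_of_v p l : par_of p 0 (iv l) = Im (p 0 (rshift d l)).
Proof. by rewrite /par_of row_mxEr row_mxEr mxE. Qed.

Lemma par_of_graph t : par_of (graph_map h t) = t.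
Proof.
apply/rowP => i; elim/par_ind: i => [j|l|l].
- by rewrite par_of_x graph_map_z.
- by rewrite par_of_u graph_map_w.
- by rewrite par_of_v graph_map_w.
Qed.

Lemma par_ofD p v (s : R) : par_of (p + (s%:C)%C *: v) = par_of p + s *: par_of v.
Proof.
apply/rowP => i; rewrite [RHS]mxE [X in _ = _ + X]mxE.
by elim/par_ind: i => [j|l|l]; rewrite !(par_of_x, par_of_u, par_of_v) !mxE
  !ReImE /= !mul0r ?subr0 ?addr0.
Qed.

Definition bump_prod (al : 'I_(d + (m + m)) -> R -> R) t : R := \prod_i al i (t 0 i).

Definition dbump (al : 'I_(d + (m + m)) -> R -> R) i t : R :=
  derive1 (al i) (t 0 i) * \prod_(l | l != i) al l (t 0 l).

Section Bump.
Variable al : 'I_(d + (m + m)) -> R -> R.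
Hypothesis sal : forall i, smooth1 (al i).

Let B p : C := rc (bump_prod al (par_of p)).

Lemma smoothC_bump : smoothC B.
Proof.
have -> : B = (fun p => \prod_i rc (al i (par_of p 0 i))).
  by apply/funext => p; rewrite /B rc_prod.
apply: smoothC_prod => i; elim/par_ind: i => [j|l|l].
- by under eq_fun do rewrite par_of_x; exact: smoothC_Re.
- by under eq_fun do rewrite par_of_u; exact: smoothC_Re.
- by under eq_fun do rewrite par_of_v; exact: smoothC_Im.
Qed.

Lemma rd_bump p v i : par_of v = delta_mx 0 i ->
  rd B p v (rc (dbump al i (par_of p))).
Proof.
move=> vi; split; last exact: rder_cst.
have -> : line_Re B p v = fun s => al i (1 * s + par_of p 0 i) *
    \prod_(l | l != i) al l (par_of p 0 l).
  apply/funext => s; rewrite /line_Re /B Re_rc /bump_prod (bigD1 i)//=.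
  rewrite par_ofD vi !mxE !eqxx mulr1 mul1r addrC; congr (_ * _).
  by apply: eq_bigr => l li; rewrite !mxE (negbTE li) andbF mulr0 addr0.
have da := smooth1_rder (par_of p 0 i) (sal i).
have := @rder_comp R (al i) (fun s => 1 * s + par_of p 0 i) 0 _ 1.
rewrite mulr0 add0r => /(_ _ da (rder_affine _ _ _)) dal.
apply: rder_eq (rderM dal (rder_cst 0 _)) _.
by rewrite mulr0 addr0 mulr1.
Qed.

Lemma rd_bump0 p v : par_of v = 0 -> rd B p v 0.
Proof.
move=> v0; split; last exact: rder_cst.
have -> : line_Re B p v = fun=> bump_prod al (par_of p).
  by apply/funext => s; rewrite /line_Re /B Re_rc par_ofD v0 scaler0 addr0.
exact: rder_cst.
Qed.

Let par_of_dz j : par_of (delta_mx 0 (lshift m j)) = delta_mx 0 (ix j).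
Proof.
apply/rowP => i; rewrite [RHS]mxE; elim/par_ind: i => [j'|l|l];
  rewrite !(par_of_x, par_of_u, par_of_v) mxE /=.
- by rewrite ixE (inj_eq (@lshift_inj _ _)); case: eqP.
- by rewrite iuxE eq_rlshift.
- by rewrite ivxE eq_rlshift.
Qed.

Let par_of_idz j : par_of ('i%C *: delta_mx 0 (lshift m j)) = 0.
Proof.
apply/rowP => i; rewrite [RHS]mxE; elim/par_ind: i => [j'|l|l];
  rewrite !(par_of_x, par_of_u, par_of_v) !mxE /=.
- by case: eqP => _; rewrite !ReImE /= ?mulr0 ?mul0r ?subr0.
- by rewrite eq_rlshift mulr0.
- by rewrite eq_rlshift mulr0.
Qed.

Let par_of_dw l : par_of (delta_mx 0 (rshift d l)) = delta_mx 0 (iu l).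
Proof.
apply/rowP => i; rewrite [RHS]mxE; elim/par_ind: i => [j'|l'|l'];
  rewrite !(par_of_x, par_of_u, par_of_v) mxE /=.
- by rewrite ixuE eq_lrshift.
- by rewrite iuE (inj_eq (@rshift_inj _ _)); case: eqP.
- by rewrite ivuE; case: (_ == _).
Qed.

Let par_of_idw l : par_of ('i%C *: delta_mx 0 (rshift d l)) = delta_mx 0 (iv l).
Proof.
apply/rowP => i; rewrite [RHS]mxE; elim/par_ind: i => [j'|l'|l'];
  rewrite !(par_of_x, par_of_u, par_of_v) !mxE /=.
- by rewrite ixvE eq_lrshift mulr0.
- by rewrite iuvE; case: eqP => _; rewrite !ReImE /= ?mulr0 ?mul0r ?subr0.
- rewrite ivE (inj_eq (@rshift_inj _ _)); case: eqP => _; rewrite !ReImE /=; ring.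
Qed.

Variables (Q : 'rV[C]_(d + m) -> C) (L : 'rV[C]_(d + m) -> 'rV[C]_(d + m) -> C).
Hypothesis rdQ : forall p v, rd Q p v (L p v).
Hypothesis holQ : forall p v, L p ('i%C *: v) = 'i%C * L p v.

Let BE p := B p * cexp (Q p).

(** The bump does not depend on Im z_j, so only its x_j derivative survives; the two contributions
    of Q cancel because i (i L) = - L, that is, Q is holomorphic. *)
Lemma dbar_bump_z p j : dbar_coord (lshift m j) BE p =
  2^-1 * cexp (Q p) * rc (dbump al (ix j) (par_of p)).
Proof.
rewrite /dbar_coord.
rewrite (rd_rderive (rdM (rd_bump p (par_of_dz j)) (rd_cexp (rdQ p _)))).
rewrite (rd_rderive (rdM (rd_bump0 p (par_of_idz j)) (rd_cexp (rdQ p _)))).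
rewrite holQ; set e := cexp _; set b := B p; set l := L _ _; set a := rc _.
have i2 : 'i%C * 'i%C = -1 :> C by apply: complex_ext; rewrite !ReImE /=; ring.
rewrite -[RHS]mulrA; congr (_ * _).
have -> : 'i%C * (0 * e + b * (e * ('i%C * l))) = ('i%C * 'i%C) * (b * (e * l)) by ring.
rewrite i2; ring.
Qed.

Lemma dbar_bump_w p l : dbar_coord (rshift d l) BE p =
  2^-1 * cexp (Q p) *
    (rc (dbump al (iu l) (par_of p)) + 'i%C * rc (dbump al (iv l) (par_of p))).
Proof.
rewrite /dbar_coord.
rewrite (rd_rderive (rdM (rd_bump p (par_of_dw l)) (rd_cexp (rdQ p _)))).
rewrite (rd_rderive (rdM (rd_bump p (par_of_idw l)) (rd_cexp (rdQ p _)))).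
rewrite holQ; set e := cexp _; set b := B p; set ll := L _ _.
set a := rc _; set a' := rc _.
have i2 : 'i%C * 'i%C = -1 :> C by apply: complex_ext; rewrite !ReImE /=; ring.
rewrite -[RHS]mulrA; congr (_ * _).
have -> : 'i%C * (a' * e + b * (e * ('i%C * ll))) =
  'i%C * a' * e + ('i%C * 'i%C) * (b * (e * ll)) by ring.
rewrite i2; ring.
Qed.

Lemma dbar_coord0 (j : 'I_(d + m)) p : dbar_coord j (fun=> 0 : C) p = 0.
Proof.
by rewrite /dbar_coord !(rd_rderive (rd_cst _ _ _)) mulr0 addr0 mulr0.
Qed.

Hypothesis sQ : smoothC Q.
Hypothesis dh : forall t, differentiable (h_real h) t.
Hypothesis hBG : bloom_graham h.
Variables (k : 'I_m) (c0 : C).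
Hypothesis c0E : forall t,
  wedge (test_covectors R k (rshift d k)) (graph_tangent h t) = c0.

(** Unlike [c0], this coefficient varies with t, since the conjugate of dz_j is not a good covector.
    A bound on compact sets suffices: it only multiplies terms supported far away in x_j. *)
Definition zcoef (j : 'I_d) t : C :=
  wedge (test_covectors R k (lshift m j)) (graph_tangent h t).

Definition test_form : nq_form R (d + m) :=
  fun J => if J == other_w d k then BE else fun=> 0.

Lemma dbar_eval_test t :
  dbar_eval m.-1 test_form (graph_map h t) (graph_tangent h t) =
  2^-1 * cexp (Q (graph_map h t)) *
  ((rc (dbump al (iu k) t) + 'i%C * rc (dbump al (iv k) t)) * c0 +
   \sum_j rc (dbump al (ix j) t) * zcoef j t).
Proof.
rewrite /dbar_eval (bigD1 (other_w d k)) ?card_other_w//=.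
rewrite [X in _ + X]big1 => [|J /andP[_ Jk]]; last first.
  by rewrite big1// => j _; rewrite /test_form (negbTE Jk) dbar_coord0 mul0r.
rewrite addr0 /test_form eqxx big_split_ord /= addrC mulrDr; congr (_ + _).
  rewrite (bigD1 k)//= big1 => [|l lk].
    by rewrite addr0 dbar_bump_w par_of_graph -[LHS]mulrA -(c0E t).
  by rewrite -[X in _ * X]/(wedge (test_covectors R k (rshift d l)) _)
    wedge_test_eq0 ?mulr0.
rewrite mulr_sumr; apply: eq_bigr => j _.
by rewrite dbar_bump_z par_of_graph mulrA.
Qed.

(** The coefficient of the form is a bump in (x, u, v) times a holomorphic exponential. The bump is
    constant along Im z, so the form is not compactly supported in the ambient space; only its
    restriction to the graph is, which is what the definition asks. *)
Lemma CR_identity (omega S : set 'rV[C]_(d + m)) (f : 'rV[C]_(d + m) -> C) :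
  continuous_CR h omega f -> compact S -> S `<=` omega ->
  (forall t, ~ S (graph_map h t) -> bump_prod al t = 0) ->
  cplx_Rintegral (graph_map h @^-1` omega) (fun t => f (graph_map h t) *
    (2^-1 * cexp (Q (graph_map h t)) *
    ((rc (dbump al (iu k) t) + 'i%C * rc (dbump al (iv k) t)) * c0 +
     \sum_j rc (dbump al (ix j) t) * zcoef j t))) = 0.
Proof.
move=> [_ CRf] cS So alS.
have sB : smoothC BE by apply: smoothCM; [exact: smoothC_bump|exact: smoothC_cexp].
have := CRf setT test_form openT; rewrite setTI => CR.
rewrite -[RHS]CR.
- congr (cplx_Rintegral _ _); apply/funext => t.
  by rewrite /dbar_integrand dbar_eval_test.
- move=> J _; rewrite /test_form; case: ifP => _; apply: smoothC_smooth_on => //.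
  exact: smoothC_cst.
- exists S; split => //; first by rewrite setTI.
  move=> t _ tS b; rewrite /nq_eval big1// => J _.
  rewrite /test_form; case: ifP => _; last by rewrite mul0r.
  by rewrite /BE /B par_of_graph alS// mul0r mul0r.
Qed.

End Bump.
End CRIdentity.

(** * Compactness, boxes and uniform continuity *)

Section CompactnessTools.
Variable R : realType.
Local Notation C := (R[i]^o).

Lemma compact_locally_bounded (T : topologicalType) (A : set T) (F : T -> R) :
  compact A -> (forall x, A x -> exists M, \forall y \near x, F y <= M) ->
  exists2 M, 0 <= M & forall x, A x -> F x <= M.
Proof.
move=> /compact_near_coveringP cA lb.
have := cA _ (pinfty_nbhs R) (fun M x => F x <= M) _.
case=> [x /lb[M FM]|N [_ hN]].
  exists ([set y | F y <= M], [set M' | M < M']) => [|[y M'] /= [Fy MM']].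
    by split => //; apply: nbhs_pinfty_gt; exact: num_real.
  exact: le_trans Fy (ltW MM').
exists (`|N| + 1); first by rewrite addr_ge0.
by move=> x; apply: hN; rewrite (le_lt_trans (ler_norm _))// ltrDl.
Qed.

Lemma compact_continuous_bounded (T : topologicalType) (A : set T) (F : T -> R) :
  compact A -> (forall x, A x -> {for x, continuous F}) ->
  exists2 M, 0 <= M & forall x, A x -> `|F x| <= M.
Proof.
move=> cA cF; apply: compact_locally_bounded => // x Ax; exists (`|F x| + 1).
have /cvgrPdist_lt/(_ _ ltr01) := cF x Ax.
apply: filterS => y xy; have -> : F y = F x - (F x - F y) by ring.
by rewrite (le_trans (ler_normB _ _))// lerD2l ltW.
Qed.

(** Heine-Cantor at the points of A: the second point may lie outside A, and G need not be
    continuous there. *)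
Lemma compact_uniform_continuity n (A : set 'rV[R]_n) (G : 'rV[R]_n -> C) (e : R) :
  compact A -> (forall x, A x -> {for x, continuous G}) -> 0 < e ->
  exists2 dl : R, 0 < dl &
    forall x y, A x -> `|y - x| < dl -> nm (G y - G x) < e.
Proof.
move=> /compact_near_coveringP cA cG e0.
have := cA _ (at_right (0 : R))
  (fun dl x => forall y, `|y - x| < dl -> nm (G y - G x) < e) _.
case=> [x Ax|N /= N0 hN].
  have e20 : 0 < e / 2 by rewrite divr_gt0.
  have /cvg_nmP/(_ _ e20)/nbhs_ballP[r /= r0 rG] := cG x Ax.
  have r20 : 0 < r / 2 by rewrite divr_gt0.
  exists (ball x (r / 2), [set dl | dl < r / 2]) => [|[x' dl] /= [xx' dlr] y yx'].
    by split; [exact: nbhsx_ballx|exact: nbhs_right_lt].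
  have {}xx' : `|x - x'| < r / 2 by move: xx'; rewrite mx_norm_ball.
  have xy : ball x r y.
    rewrite mx_norm_ball /ball_ /= -(subrKA x') (le_lt_trans (ler_normD _ _))//.
    by rewrite [r]splitr ltrD// distrC (lt_trans yx').
  have xx : ball x r x'.
    by rewrite mx_norm_ball /ball_ /= (lt_trans xx')// ltr_pdivrMr// ltr_pMr// ltr1n.
  have -> : G y - G x' = (G x - G x') - (G x - G y) by ring.
  rewrite (le_lt_trans (nmD _ _))// nmN [e]splitr ltrD//.
    exact: (rG x' xx).
  exact: (rG y xy).
exists (N / 2); first by rewrite divr_gt0.
move=> x y Ax; apply: hN => //=; last by rewrite divr_gt0.
by rewrite sub0r normrN ger0_norm ?divr_ge0 ?ltW// ltr_pdivrMr// ltr_pMr// ltr1n.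
Qed.

Lemma row_norm_lt n (t : 'rV[R]_n) (e : R) : 0 < e -> (forall i, `|t 0 i| < e) ->
  `|t| < e.
Proof.
move=> e0 te; rewrite [X in X < _]mx_normrE; apply/bigmax_ltP; split => //.
by move=> [i0 i] _ /=; rewrite (ord1 i0).
Qed.

Definition box n (b : 'I_n -> R) : set 'rV[R]_n := [set t | forall i, `|t 0 i| <= b i].

Lemma closed_box n (b : 'I_n -> R) : closed (box b).
Proof.
have -> : box b = \bigcap_(i in setT) (fun t : 'rV[R]_n => t 0 i) @^-1` [set x | `|x| <= b i].
  by apply/seteqP; split => t h i => [_|]; exact: h.
apply: closed_bigI => i _; apply: closed_comp; first by move=> t _; exact: coord_continuous.
have -> : [set x : R | `|x| <= b i] = (fun x : R => `|x|) @^-1` [set x | x <= b i] by [].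
apply: closed_comp; first by move=> x _; exact: norm_continuous.
exact: closed_le.
Qed.

Lemma compact_box n (b : 'I_n -> R) : compact (box b).
Proof.
apply: bounded_closed_compact; last exact: closed_box.
exists (\sum_i `|b i|); split; first exact: num_real.
move=> x xb t tb /=; have x0 : 0 < x by rewrite (le_lt_trans _ xb)// sumr_ge0.
apply: ltW; apply: row_norm_lt => // i; rewrite (le_lt_trans (tb i))//.
rewrite (le_lt_trans _ xb)// (bigD1 i)//= (le_trans (ler_norm _))// lerDl.
by rewrite sumr_ge0.
Qed.

Lemma sqr_sum_le n (a : 'I_n -> R) : (\sum_i a i) ^+ 2 <= n%:R * \sum_i a i ^+ 2.
Proof.
rewrite expr2 big_distrlr /=.
apply: (@le_trans _ _ (\sum_(i < n) \sum_(j < n) (2^-1 * (a i ^+ 2) + 2^-1 * (a j ^+ 2)))).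
  apply: ler_sum => i _; apply: ler_sum => j _.
  have := sqr_ge0 (a i - a j); lra.
pose b i := 2^-1 * a i ^+ 2.
have -> : \sum_(i < n) \sum_(j < n) (b i + b j) = \sum_(i < n) (n%:R * b i + \sum_j b j).
  by apply: eq_bigr => i _; rewrite big_split /= sumr_const card_ord mulr_natl.
have Sb : \sum_j b j = 2^-1 * \sum_i a i ^+ 2 by rewrite mulr_sumr.
rewrite big_split /= -mulr_sumr sumr_const card_ord -[X in _ + X]mulr_natl Sb.
rewrite -mulrDr -mulrDl (_ : 2^-1 + 2^-1 = 1 :> R) ?mul1r//; lra.
Qed.

End CompactnessTools.

(** * Measurability, bounds and Lipschitz estimates for the graph *)

Section GraphRegularity.
Variables (R : realType) (d m : nat).
Local Notation C := (R[i]^o).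
Local Notation Re := (@complex.Re R).
Local Notation Im := (@complex.Im R).
Local Notation par := 'rV[R]_(d + (m + m)).
Local Notation N := (d + (m + m)).
Local Notation RM := (measurableTypeR R).
Local Notation ix := (@ix d m).
Local Notation iu := (@iu d m).
Local Notation iv := (@iv d m).
Variable h : 'rV[R]_d -> 'rV[C]_m -> 'rV[R]_d.
Hypothesis hC1 : C1_graphing h.
Hypothesis hBG : bloom_graham h.
Implicit Types (t : par).

Let dh t : differentiable (h_real h) t. Proof. by have [+ _] := hC1; exact. Qed.

Lemma continuous_h_real j : continuous (fun t => h_real h t 0 j).
Proof.
move=> t; have ct := differentiable_continuous (dh t).
exact: (cvg_comp (h_real h) (fun y : 'rV[R]_d => y 0 j) ct (@coord_continuous _ _ _ 0 j _)).
Qed.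

Lemma continuous_dh_coef j a : continuous (fun t => dh_coef h t j a).
Proof.
move=> t; have [_ cJ] := hC1.
exact: (cvg_comp _ (fun y : 'M[R]_(N, d) => y a j) (cJ t) (@coord_continuous _ _ _ a j _)).
Qed.

Lemma cmfun_tangent a i :
  cmfun (fun s : N.-tuple RM => graph_tangent h (row_tuple s) a 0 i).
Proof.
case: (splitP i) => [j ij|l il].
  have -> : i = lshift m j by exact: val_inj.
  under eq_fun do rewrite graph_tangent_z//; apply: cmfun_complex.
    exact: measurable_cst.
  exact: (@measurable_row_tuple R N (fun t => dh_coef h t j a) (@continuous_dh_coef j a)).
have -> : i = rshift d l by exact: val_inj.
by under eq_fun do rewrite graph_tangent_w//; exact: cmfun_cst.
Qed.

Lemma nm_tangent_le t a i (b : R) : 0 <= b -> (forall j a, `|dh_coef h t j a| <= b) ->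
  nm (graph_tangent h t a 0 i) <= 2 + b.
Proof.
move=> b0 tb; have ind01 (x : bool) : `|x%:R : R| <= 1.
  by case: x; rewrite ?normr1 ?normr0.
case: (splitP i) => [j ij|l il].
  have -> : i = lshift m j by exact: val_inj.
  rewrite graph_tangent_z// /nm /= lerD//.
  by rewrite (le_trans (ind01 _))// ler1n.
have -> : i = rshift d l by exact: val_inj.
rewrite graph_tangent_w// /nm /=.
apply: (le_trans (lerD (ind01 _) (ind01 _))); lra.
Qed.

Definition coord_covector (s : 'rV[C]_(d + m) -> C) :=
  (exists i, s = dzeta i) \/ (exists i, s = dzetabar i) \/ s = (fun=> 0).

Lemma nth_coord_covector k j a :
  coord_covector (nth (fun=> 0) (test_covectors R k (j : 'I_(d + m))) a).
Proof.
have main (f : 'I_(d + m) -> 'rV[C]_(d + m) -> C) e b :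
    (forall i, coord_covector (f i)) -> coord_covector (nth (fun=> 0) (map f e) b).
  move=> fg; have [be|be] := ltnP b (size e).
    by rewrite (nth_map j).
  by rewrite nth_default ?size_map//; right; right.
case: a => [|a] /=; first by right; left; exists j.
rewrite nth_cat; case: ifP => _; apply: main => i; first by left; exists i.
by right; left; exists i.
Qed.

Lemma cmfun_zcoef k j : cmfun (fun s : N.-tuple RM => zcoef h k j (row_tuple s)).
Proof.
rewrite /zcoef /wedge /determinant; apply: cmfun_sum => s.
apply: cmfunM; first exact: cmfun_cst.
apply: cmfun_prod => a; under eq_fun do rewrite mxE.
have := nth_coord_covector k (lshift m j) a.
case=> [[i ->]|[[i ->]|->]].
- exact: cmfun_tangent.
- have [f1 f2] := cmfun_tangent (s a) i.
  have -> : (fun s0 : N.-tuple RM => dzetabar i (graph_tangent h (row_tuple s0) (s a)))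
     = (fun s0 => (Re (graph_tangent h (row_tuple s0) (s a) 0 i) +i*
       (- Im (graph_tangent h (row_tuple s0) (s a) 0 i)))%C : C).
    by apply/funext => s0; rewrite /dzetabar; case: (graph_tangent _ _ _ _ _).
  by apply: cmfun_complex => //; exact: measurable_funN.
- exact: cmfun_cst.
Qed.

Lemma nm_zcoef_bounded k (A : set par) : compact A ->
  exists2 M, 0 <= M & forall t j, A t -> nm (zcoef h k j t) <= M.
Proof.
move=> cA.
have hb j a : exists2 M, 0 <= M & forall t, A t -> `|dh_coef h t j a| <= M.
  by apply: compact_continuous_bounded => // t _; exact: continuous_dh_coef.
pose b := \sum_j \sum_a sval (cid2 (hb j a)).
have b0' j a : 0 <= sval (cid2 (hb j a)) by case: cid2.
have b0 : 0 <= b by rewrite sumr_ge0// => j _; rewrite sumr_ge0.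
have bP t : A t -> forall j a, `|dh_coef h t j a| <= b.
  move=> At j a; apply: (@le_trans _ _ (sval (cid2 (hb j a)))).
    by case: cid2 => M M0 /=; exact.
  apply: (@le_trans _ _ (\sum_a' sval (cid2 (hb j a')))).
    by rewrite [leRHS](bigD1 a)// lerDl; apply: sumr_ge0 => a' _; exact: b0'.
  rewrite /b [leRHS](bigD1 j)// lerDl; apply: sumr_ge0 => j' _.
  by apply: sumr_ge0 => a' _; exact: b0'.
exists (\sum_(s : 'S_N) \prod_(a < N) (2 + b)).
  by rewrite sumr_ge0// => s _; rewrite prodr_ge0// => a _; rewrite addr_ge0.
move=> t j At; rewrite /zcoef /wedge /determinant.
apply: (le_trans (nm_sum _ _ _)); apply: ler_sum => s _.
have -> : (-1) ^+ s = rc ((-1) ^+ s) :> C by rewrite rcX rcN rc1.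
rewrite nm_scale normrX normrN1 expr1n mul1r.
apply: (le_trans (nm_prod _ _ _)); apply: ler_prod => a _; rewrite nm_ge0 /= mxE.
have := nth_coord_covector k (lshift m j) a.
case=> [[i ->]|[[i ->]|->]].
- exact: nm_tangent_le (bP t At).
- have -> : nm (dzetabar i (graph_tangent h t (s a))) = nm (graph_tangent h t (s a) 0 i).
    by rewrite /dzetabar /nm; case: (graph_tangent _ _ _ _ _) => x y /=; rewrite normrN.
  exact: nm_tangent_le (bP t At).
- by rewrite nm0 addr_ge0.
Qed.

(** Mean value theorem along a segment, followed by Cauchy-Schwarz; squares are used because the
    estimate feeds a quadratic phase. *)
Lemma h_real_lipschitz (rho : R) : exists2 L, 0 <= L &
  forall t t' j, (forall i, `|t 0 i| <= rho) -> (forall i, `|t' 0 i| <= rho) ->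
  (h_real h t 0 j - h_real h t' 0 j) ^+ 2 <= L * \sum_i (t 0 i - t' 0 i) ^+ 2.
Proof.
(* The parameter of [MVT_bound] ranges over [-1, 1], so the coordinates of t' + s (t - t') only stay
   below rho + 2 rho. *)
pose A : set par := box (fun=> 3 * rho).
have hb j a : exists2 M, 0 <= M & forall t, A t -> `|dh_coef h t j a| <= M.
  apply: compact_continuous_bounded => [|t _]; first exact: compact_box.
  exact: continuous_dh_coef.
pose b := \sum_j \sum_a sval (cid2 (hb j a)).
have b0' j a : 0 <= sval (cid2 (hb j a)) by case: cid2.
have b0 : 0 <= b by rewrite sumr_ge0// => j _; rewrite sumr_ge0.
have bP t : A t -> forall j a, `|dh_coef h t j a| <= b.
  move=> At j a; apply: (@le_trans _ _ (sval (cid2 (hb j a)))).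
    by case: cid2 => M M0 /=; exact.
  apply: (@le_trans _ _ (\sum_a' sval (cid2 (hb j a')))).
    by rewrite [leRHS](bigD1 a)// lerDl; apply: sumr_ge0 => a' _; exact: b0'.
  rewrite /b [leRHS](bigD1 j)// lerDl; apply: sumr_ge0 => j' _.
  by apply: sumr_ge0 => a' _; exact: b0'.
exists (b ^+ 2 * N%:R); first by rewrite mulr_ge0// sqr_ge0.
move=> t t' j tr t'r; pose v := t - t'; pose P (s : R) := t' + s *: v.
have dP s : is_derive s (1 : R) (fun s => h_real h (P s) 0 j)
    (\sum_a v 0 a * dh_coef h (P s) j a).
  have dv : derivable (h_real h) (P s) v by exact: diff_derivable.
  have Dv : 'D_v (fun p => h_real h p 0 j) (P s) = \sum_a v 0 a * dh_coef h (P s) j a.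
    have -> : 'D_v (fun p => h_real h p 0 j) (P s) = ('D_v (h_real h) (P s)) 0 j.
      by rewrite derive_mx// mxE.
    by rewrite deriveEjacobian// mxE.
  have /derivable_mxP/(_ 0 j) := dv => dj.
  have E : (fun e : R => e^-1 *: (h_real h (P (e *: 1 + s)) 0 j - h_real h (P s) 0 j)) =
     (fun e : R => e^-1 *: (h_real h (e *: v + P s) 0 j - h_real h (P s) 0 j)).
    apply/funext => e; congr (_ *: (h_real h _ 0 j - _)).
    have -> : e *: (1 : R) + s = e + s by rewrite /GRing.scale/= mulr1.
    by rewrite /P scalerDl addrCA.
  apply: DeriveDef; first by rewrite /derivable /= E.
  by rewrite -Dv /derive /= E.
have := @MVT_bound R (fun s => h_real h (P s) 0 j)
  (fun s => \sum_a v 0 a * dh_coef h (P s) j a) 1 (b * \sum_a `|v 0 a|) (fun s _ => dP s).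
have -> : P 1 = t by rewrite /P scale1r /v addrC subrK.
have -> : P 0 = t' by rewrite /P scale0r addr0.
rewrite normr1 mulr1 => MV.
have {}MV : `|h_real h t 0 j - h_real h t' 0 j| <= b * \sum_a `|v 0 a|.
  apply: MV => s s1; apply: (le_trans (ler_norm_sum _ _ _)); rewrite mulr_sumr.
  apply: ler_sum => a _; rewrite normrM mulrC ler_wpM2r//; apply: bP => i.
  rewrite /P /v !mxE; apply: (le_trans (ler_normD _ _)).
  have := tr i; have := t'r i => h1 h2.
  have : `|s * (t 0 i - t' 0 i)| <= 1 * (rho + rho).
    rewrite normrM ler_pM// (le_trans (ler_normB _ _))// lerD//.
  by lra.
rewrite -(real_normK (num_real _)).
apply: (@le_trans _ _ ((b * \sum_a `|v 0 a|) ^+ 2)).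
  by rewrite lerXn2r// nnegrE// mulr_ge0// sumr_ge0.
rewrite exprMn -[leRHS]mulrA ler_wpM2l ?sqr_ge0// (le_trans (sqr_sum_le _))//.
rewrite ler_wpM2l// ler_sum// => a _; rewrite real_normK ?num_real//.
by rewrite /v !mxE.
Qed.

End GraphRegularity.

(** * Clipped graphing functions and the choice of weights and radii *)

Section Weights.
Variables (R : realType) (d m : nat).
Local Notation C := (R[i]^o).
Local Notation par := 'rV[R]_(d + (m + m)).
Local Notation N := (d + (m + m)).
Local Notation ix := (@ix d m).
Local Notation iu := (@iu d m).
Local Notation iv := (@iv d m).
Implicit Types (t : par) (x y rho : R).

Definition clip rho x : R := Num.max (- rho) (Num.min rho x).

Lemma clip_id rho x : `|x| <= rho -> clip rho x = x.
Proof.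
rewrite ler_norml => /andP[x1 x2]; rewrite /clip.
by rewrite min_r// max_r.
Qed.

Lemma clip_norm rho x : 0 <= rho -> `|clip rho x| <= rho.
Proof.
move=> r0; rewrite /clip ler_norml le_max lexx /= ge_max ge_min lexx andbT.
by rewrite ge0_cp.
Qed.

Lemma clip_lipschitz rho x y : 0 <= rho -> (clip rho x - clip rho y) ^+ 2 <= (x - y) ^+ 2.
Proof.
move=> r0; rewrite -(real_normK (num_real (_ - _))) -(real_normK (num_real (x - y))).
rewrite lerXn2r ?nnegrE// /clip.
case: (leP rho x) => rx; case: (leP rho y) => ry;
  do ?[case: (leP (- rho) _) => ?]; rewrite ler_norml;
  have := ler_norm (x - y); have := ler_norm (- (x - y)); rewrite normrN;
  move=> *; apply/andP; split; lra.
Qed.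

Lemma big_par (F : 'I_N -> R) :
  \sum_i F i = \sum_j F (ix j) + (\sum_l F (iu l) + \sum_l F (iv l)).
Proof. by rewrite big_split_ord /= big_split_ord. Qed.

Variable h : 'rV[R]_d -> 'rV[C]_m -> 'rV[R]_d.
Hypothesis hC1 : C1_graphing h.
Hypothesis hBG : bloom_graham h.

(** Clipping every coordinate turns the locally Lipschitz h_j into a bounded, globally Lipschitz
    function, and preserves its dependence on w and the earlier x_k only. *)
Definition hclip rho (j : 'I_d) t : R := h_real h (\row_i clip rho (t 0 i)) 0 j.

Definition hlip rho : R := sval (cid2 (h_real_lipschitz hC1 rho)).

Lemma hlip_ge0 rho : 0 <= hlip rho.
Proof. by rewrite /hlip; case: cid2. Qed.

Lemma hclip_dep rho (j : 'I_d) t t' :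
  (forall k : 'I_d, (k < j)%N -> t 0 (ix k) = t' 0 (ix k)) ->
  (forall l, t 0 (iu l) = t' 0 (iu l)) -> (forall l, t 0 (iv l) = t' 0 (iv l)) ->
  hclip rho j t = hclip rho j t'.
Proof.
move=> tx tu tv; apply: h_real_dep => // [k kj|l|l]; rewrite !mxE.
- by rewrite tx.
- by rewrite tu.
- by rewrite tv.
Qed.

Lemma hclip_id rho (j : 'I_d) t : (forall k : 'I_d, (k < j)%N -> `|t 0 (ix k)| <= rho) ->
  (forall l, `|t 0 (iu l)| <= rho) -> (forall l, `|t 0 (iv l)| <= rho) ->
  hclip rho j t = h_real h t 0 j.
Proof.
move=> tx tu tv; apply: h_real_dep => // [k kj|l|l]; rewrite !mxE clip_id//.
exact: tx.
Qed.

Definition dist_before (j : 'I_d) t t' : R :=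
  \sum_(k < d | (k < j)%N) (t 0 (ix k) - t' 0 (ix k)) ^+ 2 +
  (\sum_l (t 0 (iu l) - t' 0 (iu l)) ^+ 2 + \sum_l (t 0 (iv l) - t' 0 (iv l)) ^+ 2).

Lemma hclip_lipschitz rho j t t' : 0 <= rho ->
  (hclip rho j t - hclip rho j t') ^+ 2 <= hlip rho * dist_before j t t'.
Proof.
move=> r0.
(* The intermediate point shares with t all that h_j sees and agrees with t' elsewhere, so the
   coordinates x_k with k >= j disappear from the distance. *)
have [t'' [t''x t''u t''v]] : exists t'' : par,
    [/\ forall k, t'' 0 (ix k) = if (k < j)%N then t 0 (ix k) else t' 0 (ix k),
      forall l, t'' 0 (iu l) = t 0 (iu l) & forall l, t'' 0 (iv l) = t 0 (iv l)].
  exists (row_mx (\row_k (if (k < j)%N then t 0 (ix k) else t' 0 (ix k))) (rsubmx t)).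
  by split=> [k|l|l]; rewrite ?row_mxEl ?row_mxEr mxE.
have -> : hclip rho j t = hclip rho j t''.
  by apply: hclip_dep => [k kj|l|l]; rewrite ?t''u ?t''v// t''x kj.
rewrite /hlip; case: cid2 => L L0 /= hL.
rewrite /hclip; apply: le_trans.
  by apply: hL => i; rewrite mxE; exact: clip_norm.
rewrite ler_wpM2l// big_par /dist_before; apply: lerD; last first.
  by apply: lerD; apply: ler_sum => l _; rewrite !mxE ?t''u ?t''v clip_lipschitz.
rewrite [leRHS]big_mkcond /=; apply: ler_sum => k _; rewrite !mxE.
apply: (le_trans (clip_lipschitz _ _ r0)); rewrite t''x; case: ifP => // _.
by rewrite subrr expr0n.
Qed.

(** A Gaussian shifted by i a is larger by exp(k a^2); a bound on a that is uniform in all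
    coordinates gives a majorant depending on x_j alone. *)
Lemma hclip_shift_bounded rho j t t' : 0 <= rho ->
  (hclip rho j t - hclip rho j t') ^+ 2 <= hlip rho * (N%:R * (2 * rho) ^+ 2).
Proof.
move=> r0; rewrite /hclip /hlip; case: cid2 => L L0 /= hL.
apply: le_trans; first by apply: hL => i; rewrite mxE; exact: clip_norm.
rewrite ler_wpM2l// mulr_natl -[in leRHS](card_ord N) -sumr_const.
apply: ler_sum => i _; rewrite !mxE -(real_normK (num_real (_ - _))).
rewrite lerXn2r ?nnegrE ?mulr_ge0// (le_trans (ler_normB _ _))//.
by rewrite mulr_natl mulr2n lerD// clip_norm.
Qed.

Lemma continuous_hclip rho j : 0 <= rho -> continuous (hclip rho j).
Proof.
move=> r0 t; apply/(@cvgrPdist_lt R R^o par (nbhs t) (nbhs_filter t)) => e e0.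
pose D (t' : par) := (1 + hlip rho) * \sum_i (t 0 i - t' 0 i) ^+ 2.
have cc i : (fun t' : par => t 0 i - t' 0 i) @ nbhs t --> t 0 i - t 0 i.
  exact: (@cvgB R R^o par (nbhs t) (nbhs_filter t) (fun=> t 0 i) (fun t' => t' 0 i)
    _ _ (cvg_cst _) (@coord_continuous R 1 N 0 i t)).
have cs (r : seq 'I_N) : (fun t' : par => \sum_(i <- r) (t 0 i - t' 0 i) ^+ 2) @ nbhs t
    --> \sum_(i <- r) (t 0 i - t 0 i) ^+ 2.
  elim: r => [|i r ih].
    under eq_fun do rewrite big_nil; rewrite big_nil; exact: cvg_cst.
  under eq_fun do rewrite big_cons expr2; rewrite big_cons expr2.
  exact: (@cvgD R R^o par (nbhs t) (nbhs_filter t) _ _ _ _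
    (@cvgM R par (nbhs t) (nbhs_filter t) _ _ _ _ (cc i) (cc i)) ih).
have cD : D @ nbhs t --> D t.
  exact: (@cvgM R par (nbhs t) (nbhs_filter t) (fun=> 1 + hlip rho) _ _ _ (cvg_cst _) (cs _)).
have D0 : D t = 0.
  by rewrite /D big1 ?mulr0// => i _; rewrite subrr expr0n.
have e20 : 0 < e ^+ 2 by rewrite exprn_gt0.
move: cD; rewrite D0 => /(@cvgrPdist_lt R R^o par (nbhs t) (nbhs_filter t))/(_ _ e20); apply: filterS => t'.
rewrite sub0r normrN ger0_norm; last first.
  by rewrite mulr_ge0 ?addr_ge0 ?hlip_ge0// sumr_ge0// => i _; exact: sqr_ge0.
move=> De; rewrite -(@ltr_pXn2r _ 2) ?nnegrE ?(ltW e0)//.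
rewrite real_normK ?num_real//; apply: le_lt_trans De.
apply: (le_trans (hclip_lipschitz _ _ _ r0)).
have s0 i : 0 <= (t 0 i - t' 0 i) ^+ 2 by exact: sqr_ge0.
apply: ler_pM => //; rewrite ?hlip_ge0 ?lerDr//.
  by rewrite addr_ge0 ?addr_ge0 ?sumr_ge0.
rewrite big_par lerD2r [leRHS](bigID (fun k : 'I_d => (k < j)%N)) /= lerDl.
by rewrite sumr_ge0.
Qed.

Section Recursion.
Variables (W r0 : R).
Hypothesis W0 : 0 <= W.
Hypothesis r00 : 0 <= r0.

(* The weight of [x_j] is chosen after the radius of [x_0, ..., x_(j-1)], which
   bounds the slope of [h_j], and the radius of [x_j] after its weight. *)
Fixpoint weight_radius (j : nat) : R * R :=
  if j is j'.+1 then
    let: (mu, r) := weight_radius j' in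
    let mu' := mu / (2 * d.+1%:R * (1 + hlip r)) in (mu', r + 2 * (W + 1) / mu')
  else (1, r0).

Let weightS j : (weight_radius j.+1).1 = (weight_radius j).1 / (2 * d.+1%:R * (1 + hlip (weight_radius j).2)).
Proof. by rewrite /=; case: (weight_radius j). Qed.

Let radiusS j : (weight_radius j.+1).2 = (weight_radius j).2 + 2 * (W + 1) / (weight_radius j.+1).1.
Proof. by rewrite /=; case: (weight_radius j). Qed.

Let den_gt0 j : 0 < 2 * d.+1%:R * (1 + hlip (weight_radius j).2).
Proof.
by rewrite mulr_gt0 ?mulr_gt0 ?ltr0n// ltr_pwDl// hlip_ge0.
Qed.

Lemma weight_gt0 j : 0 < (weight_radius j).1.
Proof.
by elim: j => [|j ih]; rewrite ?weightS /= ?ltr01// divr_gt0.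
Qed.

Lemma weight_le j : (weight_radius j.+1).1 <= (weight_radius j).1.
Proof.
rewrite weightS ler_pdivrMr// ler_peMr ?(ltW (weight_gt0 _))//.
have : 1 <= d.+1%:R :> R by rewrite ler1n.
have := hlip_ge0 (weight_radius j).2; nra.
Qed.

Lemma weight_anti i j : (i <= j)%N -> (weight_radius j).1 <= (weight_radius i).1.
Proof.
move=> /subnK <-; elim: (j - i)%N => [//|k ih]; rewrite addSn.
exact: le_trans (weight_le _) ih.
Qed.

Lemma radius_le j : (weight_radius j).2 <= (weight_radius j.+1).2.
Proof. by rewrite radiusS lerDl divr_ge0 ?(ltW (weight_gt0 _))// mulr_ge0// addr_ge0. Qed.

Lemma radius_mono i j : (i <= j)%N -> (weight_radius i).2 <= (weight_radius j).2.
Proof.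
move=> /subnK <-; elim: (j - i)%N => [//|k ih]; rewrite addSn.
exact: le_trans ih (radius_le _).
Qed.

Lemma weight_lip j : (weight_radius j.+1).1 * hlip (weight_radius j).2 <= (weight_radius j).1 / (2 * d.+1%:R).
Proof.
rewrite weightS; have p := weight_gt0 j; have l0 := hlip_ge0 (weight_radius j).2.
have -> : (weight_radius j).1 / (2 * d.+1%:R * (1 + hlip (weight_radius j).2)) * hlip (weight_radius j).2 =
  (weight_radius j).1 / (2 * d.+1%:R) * (hlip (weight_radius j).2 / (1 + hlip (weight_radius j).2)).
  by field; rewrite !gt_eqF// ?ltr_pwDl.
rewrite ler_piMr//; first by rewrite divr_ge0 ?(ltW p)// mulr_ge0.
by rewrite ler_pdivrMr ?ltr_pwDl// mul1r lerDr.
Qed.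

(** The indices are staggered: x_j gets the weight and the radius of stage j + 1, whereas h_j is
    clipped at the radius of stage j, which dominates those of all x_k with k < j. *)
Definition lam (j : 'I_d) : R := (weight_radius j.+1).1.
Definition xrad (j : 'I_d) : R := (weight_radius j.+1).2.
Definition crad (j : 'I_d) : R := (weight_radius j).2.

(** Each of the d terms is at most (LX + UV) / (2 (d + 1)): by [weight_lip], lam_j times the
    Lipschitz constant is at most the previous weight over 2 (d + 1), and that weight is below lam_k
    for k < j and below the weight 1 of w. *)
Lemma weighted_slope t t' :
  \sum_j lam j * (hclip (crad j) j t - hclip (crad j) j t') ^+ 2 <=
  2^-1 * \sum_j lam j * (t 0 (ix j) - t' 0 (ix j)) ^+ 2 +
  2^-1 * (\sum_l (t 0 (iu l) - t' 0 (iu l)) ^+ 2 +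
          \sum_l (t 0 (iv l) - t' 0 (iv l)) ^+ 2).
Proof.
pose UV := \sum_l (t 0 (iu l) - t' 0 (iu l)) ^+ 2 +
  \sum_l (t 0 (iv l) - t' 0 (iv l)) ^+ 2.
pose LX := \sum_j lam j * (t 0 (ix j) - t' 0 (ix j)) ^+ 2.
rewrite -/UV -/LX.
have d0 : 0 < 2 * d.+1%:R :> R by rewrite mulr_gt0// ltr0n.
have UV0 : 0 <= UV by rewrite addr_ge0// sumr_ge0// => l _; exact: sqr_ge0.
have LX0 : 0 <= LX.
  by rewrite sumr_ge0// => j _; rewrite mulr_ge0 ?sqr_ge0// ltW// weight_gt0.
have one j : lam j * (hclip (crad j) j t - hclip (crad j) j t') ^+ 2 <=
    (LX + UV) / (2 * d.+1%:R).
  have c0 : 0 <= crad j by rewrite (le_trans r00)// (@radius_mono 0).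
  apply: (@le_trans _ _ (lam j * (hlip (crad j) * dist_before j t t'))).
    by rewrite ler_wpM2l ?hclip_lipschitz// ltW// weight_gt0.
  have D0 : 0 <= dist_before j t t'.
    by rewrite addr_ge0// sumr_ge0// => k _; exact: sqr_ge0.
  apply: (@le_trans _ _ ((weight_radius j).1 / (2 * d.+1%:R) * dist_before j t t')).
    by rewrite mulrA ler_wpM2r// weight_lip.
  rewrite mulrAC ler_wpM2r ?invr_ge0 ?(ltW d0)//.
  rewrite /dist_before mulrDr lerD//; last first.
    by rewrite ler_piMl// (@weight_anti 0).
  rewrite mulr_sumr /LX [leRHS](bigID (fun k : 'I_d => (k < j)%N)) /=.
  rewrite ler_wpDr ?sumr_ge0//.
    by move=> k _; rewrite mulr_ge0 ?sqr_ge0// ltW// weight_gt0.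
  by apply: ler_sum => k kj; rewrite ler_wpM2r ?sqr_ge0// weight_anti.
apply: (@le_trans _ _ (\sum_(j < d) (LX + UV) / (2 * d.+1%:R))).
  by apply: ler_sum => j _; exact: one.
rewrite sumr_const card_ord -[leLHS]mulr_natl -mulrDr; set S := LX + UV.
have dn : d.+1%:R != 0 :> R by rewrite pnatr_eq0.
have -> : d%:R * (S / (2 * d.+1%:R)) = 2^-1 * S * (d%:R / d.+1%:R).
  by field.
have S0 : 0 <= 2^-1 * S by rewrite mulr_ge0// addr_ge0.
by rewrite ler_piMr// ler_pdivrMr ?ltr0n// mul1r ler_nat.
Qed.

(** The increment a = 2 (W + 1) / lam_j of the radius is made for this: the distance is at least 1 +
    a, and (1 + a)^2 >= a. *)
Lemma rad_large (r : R) j : 0 <= r -> r + 2 <= r0 ->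
  W + 1 <= 2^-1 * lam j * (xrad j - 1 - r) ^+ 2.
Proof.
move=> rr rr0; have p : 0 < lam j := weight_gt0 _.
rewrite /xrad radiusS -/(lam j); set a := 2 * (W + 1) / lam j.
have a0 : 0 <= a by rewrite divr_ge0 ?(ltW p)// mulr_ge0// addr_ge0.
have r1 : r + 2 <= (weight_radius j).2 by rewrite (le_trans rr0)// (@radius_mono 0).
have W1 : W + 1 = 2^-1 * lam j * a by rewrite /a; field; rewrite gt_eqF.
rewrite W1 ler_wpM2l ?mulr_ge0 ?(ltW p)//.
have : 1 + a <= (weight_radius j).2 + a - 1 - r by lra.
nra.
Qed.

End Recursion.

End Weights.

(** * Families indexed by the three kinds of parameters *)

Section ParCase.
Variables (d m : nat) (T : Type) (fx : 'I_d -> T) (fu fv : 'I_m -> T).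

Definition parcase (i : 'I_(d + (m + m))) : T :=
  match fintype.split i with
  | inl j => fx j
  | inr e => match fintype.split e with inl l => fu l | inr l => fv l end
  end.

Lemma parcase_x j : parcase (ix m j) = fx j.
Proof. by rewrite /parcase (unsplitK (inl j)). Qed.
Lemma parcase_u l : parcase (iu d l) = fu l.
Proof. by rewrite /parcase (unsplitK (inr (lshift m l))) (unsplitK (inl l)). Qed.
Lemma parcase_v l : parcase (iv d l) = fv l.
Proof. by rewrite /parcase (unsplitK (inr (rshift m l))) (unsplitK (inr l)). Qed.

End ParCase.

Lemma big_prod_par (S : comPzSemiRingType) d m (F : 'I_(d + (m + m)) -> S) :
  \prod_i F i = \prod_j F (ix m j) * (\prod_l F (iu d l) * \prod_l F (iv d l)).
Proof. by rewrite big_split_ord /= big_split_ord. Qed.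

(** * Cutoffs, steps and mollifiers *)

Section StepFunctions.
Variable R : realType.
Variable eta : R -> R.
Hypothesis seta : smooth1 eta.
Hypothesis eta0 : forall x, x <= 0 -> eta x = 0.
Hypothesis eta1 : forall x, 1 <= x -> eta x = 1.
Local Notation mu := (@lebesgue_measure R).
Implicit Types (rho tau c x : R).

Lemma eventually_const_bounded (f : R -> R) : continuous f ->
  (forall x, x < 0 -> f x = f (-1)) -> (forall x, 1 < x -> f x = f 2) ->
  exists2 M, 0 <= M & forall x, `|f x| <= M.
Proof.
move=> cf f0 f1.
have cI : compact (`[- 1, 2]%classic : set R) by exact: segment_compact.
have [M M0 fM] := compact_continuous_bounded cI (fun x _ => cf x).
exists M => // x; have [x0|x0] := ltP x 0.
  rewrite f0//; apply: fM; rewrite /= in_itv /=; apply/andP; split; lra.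
have [x1|x1] := ltP 1 x.
  rewrite f1//; apply: fM; rewrite /= in_itv /=; apply/andP; split; lra.
by apply: fM; rewrite /= in_itv /=; apply/andP; split; lra.
Qed.

Lemma derive1_locally_const (f : R -> R) (y c : R) (U : set R) : open U -> U y ->
  (forall x, U x -> f x = c) -> derive1 f y = 0.
Proof.
move=> oU Uy fc; apply: rder_derive1.
apply: near_eq_is_derive (rder_cst y c); near=> x; rewrite fc//.
by near: x; exact: open_nbhs_nbhs.
Unshelve. all: by end_near. Qed.

Lemma deta_out x : x < 0 \/ 1 < x -> derive1 eta x = 0.
Proof.
case=> hx.
  apply: (@derive1_locally_const _ _ 0 [set y | y < 0]) => //.
  by move=> y /= y0; rewrite eta0// ltW.
apply: (@derive1_locally_const _ _ 1 [set y | 1 < y]) => //.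
by move=> y /= y0; rewrite eta1// ltW.
Qed.

Lemma eta_bounded : exists2 M, 1 <= M & forall x, `|eta x| <= M /\ `|derive1 eta x| <= M.
Proof.
have [M1 M10 h1] := eventually_const_bounded (smooth1_continuous seta)
  (fun x (x0 : x < 0) => etrans (eta0 (ltW x0)) (esym (@eta0 (-1) (lerN10 R))))
  (fun x (x1 : 1 < x) => etrans (eta1 (ltW x1)) (esym (@eta1 2 (ler1n R 2)))).
have d0 x : x < 0 -> derive1 eta x = derive1 eta (-1).
  by move=> x0; rewrite !deta_out//; left => //; rewrite ltrN10.
have d1 x : 1 < x -> derive1 eta x = derive1 eta 2.
  by move=> x0; rewrite !deta_out//; right => //; rewrite ltr1n.
have [M2 M20 h2] := eventually_const_bounded
  (smooth1_continuous (smooth1_derive1 seta)) d0 d1.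
exists (M1 + M2 + 1); first by rewrite lerDr addr_ge0.
by move=> x; split; have := h1 x; have := h2 x; lra.
Qed.

Definition cutoff rho x : R := eta ((- 1) * x + rho) * eta (1 * x + rho).

Lemma smooth1_cutoff rho : smooth1 (cutoff rho).
Proof. by apply: smooth1M; exact: smooth1_affine. Qed.

Lemma cutoff1 rho x : `|x| <= rho - 1 -> cutoff rho x = 1.
Proof.
rewrite ler_norml => /andP[x1 x2].
by rewrite /cutoff !eta1 ?mulr1//; lra.
Qed.

Lemma cutoff0 rho x : rho <= `|x| -> cutoff rho x = 0.
Proof.
rewrite /cutoff ler_normr => /orP[hx|hx].
  by rewrite eta0 ?mul0r//; lra.
by rewrite [eta (1 * x + _)]eta0 ?mulr0//; lra.
Qed.

Lemma dcutoff0 rho x : `|x| < rho - 1 -> derive1 (cutoff rho) x = 0.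
Proof.
move=> hx; apply: (@derive1_locally_const _ _ 1 [set y | `|y| < rho - 1]) => //.
  have -> : [set y : R | `|y| < rho - 1] = (fun y : R => `|y|) @^-1` [set y | y < rho - 1] by [].
  apply: (@open_comp _ _ (fun y : R => `|y|) [set y | y < rho - 1]).
    by move=> y _; exact: norm_continuous.
  exact: open_lt.
by move=> y /= hy; rewrite cutoff1// ltW.
Qed.

Lemma cutoff_bounded M rho : (forall x, `|eta x| <= M /\ `|derive1 eta x| <= M) ->
  forall x, `|cutoff rho x| <= M ^+ 2 /\ `|derive1 (cutoff rho) x| <= 2 * M ^+ 2.
Proof.
move=> hM x; have [e1 d1] := hM ((- 1) * x + rho); have [e2 d2] := hM (1 * x + rho).
split; first by rewrite /cutoff normrM expr2 ler_pM.
have := rderM (rder_comp (smooth1_rder _ seta) (rder_affine x (- 1) rho))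
  (rder_comp (smooth1_rder _ seta) (rder_affine x 1 rho)).
move=> /rder_derive1 ->; rewrite mulr1 mulrN1 mulNr (le_trans (ler_normD _ _))//.
have -> : 2 * M ^+ 2 = M * M + M * M by ring.
by rewrite normrN !normrM; apply: lerD; apply: ler_pM.
Qed.

Definition step tau c x : R := eta (tau^-1 * x + (2^-1 - tau^-1 * c)).

Lemma smooth1_step tau c : smooth1 (step tau c).
Proof. exact: smooth1_affine. Qed.

(** Taken as the derivative of a step, so that the difference of two mollifiers has an explicit
    primitive, the difference of the steps, which vanishes outside a bounded interval. *)
Definition mollifier tau c : R -> R := derive1 (step tau c).

Lemma mollifierE tau c x :
  mollifier tau c x = derive1 eta (tau^-1 * x + (2^-1 - tau^-1 * c)) * tau^-1.
Proof.
apply: rder_derive1.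
exact: (@rder_comp R eta (fun t => tau^-1 * t + (2^-1 - tau^-1 * c)) _ _ _
  (smooth1_rder _ seta) (rder_affine x tau^-1 (2^-1 - tau^-1 * c))).
Qed.

Lemma step0 tau c x : 0 < tau -> x <= c - tau / 2 -> step tau c x = 0.
Proof.
move=> t0 hx; rewrite /step eta0//.
have -> : tau^-1 * x + (2^-1 - tau^-1 * c) = tau^-1 * (x - (c - tau / 2)).
  by field; rewrite gt_eqF.
by rewrite mulr_ge0_le0 ?invr_ge0 ?(ltW t0)// subr_le0.
Qed.

Lemma step1 tau c x : 0 < tau -> c + tau / 2 <= x -> step tau c x = 1.
Proof.
move=> t0 hx; rewrite /step eta1//.
have -> : tau^-1 * x + (2^-1 - tau^-1 * c) = 1 + tau^-1 * (x - (c + tau / 2)).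
  by field; rewrite gt_eqF.
by rewrite lerDl mulr_ge0 ?invr_ge0 ?(ltW t0)// subr_ge0.
Qed.

Lemma mollifier_integral tau c : 0 < tau ->
  \int[mu]_x mollifier tau c x = 1 /\
  forall x, tau / 2 < `|x - c| -> mollifier tau c x = 0.
Proof.
move=> t0; have [] := @integral_derivative_step R (mollifier tau c) (step tau c)
  (c - tau / 2) (c + tau / 2).
- by have t20 : 0 < tau / 2; [rewrite divr_gt0|lra].
- exact: (smooth1_continuous (smooth1_derive1 (smooth1_step tau c))).
- by move=> x; exact: smooth1_rder (smooth1_step tau c).
- by move=> x; exact: step0.
- by move=> x; exact: step1.
- move=> -> h; split => // x; rewrite ltr_normr => hx; apply: h.
  by case/orP: hx => hx; [right|left]; lra.
Qed.

Lemma mollifier_bound M tau c x : 0 < tau ->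
  (forall x, `|eta x| <= M /\ `|derive1 eta x| <= M) ->
  `|mollifier tau c x| <= M / tau.
Proof.
move=> t0 hM; rewrite mollifierE normrM (@ger0_norm _ tau^-1) ?invr_ge0 ?(ltW t0)//.
by rewrite ler_wpM2r ?invr_ge0 ?(ltW t0)//; have [_] := hM (tau^-1 * x + (2^-1 - tau^-1 * c)).
Qed.

Lemma normal_peakM tau s : 0 < tau -> normal_peak (tau * s) = tau^-1 * normal_peak s.
Proof.
move=> t0; rewrite /normal_peak exprMn -mulrA -mulrnAr sqrtrM ?sqr_ge0//.
by rewrite sqrtr_sqr gtr0_norm// invfM.
Qed.

Lemma normal_pdfME tau s c x : 0 < tau -> 0 < s -> normal_pdf c (tau * s) x =
  tau^-1 * normal_peak s * expR (- ((x - c) ^+ 2 / (2 * tau ^+ 2 * s ^+ 2))).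
Proof.
move=> t0 s0; rewrite normal_pdfE ?gt_eqF ?mulr_gt0// normal_peakM// /normal_fun.
by congr (_ * expR _); field; rewrite !gt_eqF.
Qed.

(** On the support (x - c)^2 / (2 tau^2) <= 1, so the factor exp 1 compensates the Gaussian; the
    mollifier thus gets a majorant of the same type as the Gaussian factors. *)
Lemma mollifier_le_pdf M tau c x : 0 < tau ->
  (forall x, `|eta x| <= M /\ `|derive1 eta x| <= M) ->
  `|mollifier tau c x| <= M * expR 1 / normal_peak 1 * normal_pdf c tau x.
Proof.
move=> t0 hM; have M0 : 0 <= M by have [h _] := hM 0; rewrite (le_trans _ h).
have p0 : 0 < normal_peak (1 : R) by rewrite normal_peak_gt0// oner_eq0.
have [_ m0] := mollifier_integral c t0.
have [hx|hx] := ltP (tau / 2) `|x - c|.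
  by rewrite m0// normr0 mulr_ge0 ?normal_pdf_ge0// divr_ge0 ?(ltW p0)// mulr_ge0 ?expR_ge0.
apply: (le_trans (mollifier_bound c x t0 hM)).
rewrite -{2}[tau]mulr1 normal_pdfME ?ltr01// expr1n mulr1.
have -> : M * expR 1 / normal_peak 1 * (tau^-1 * normal_peak 1 *
   expR (- ((x - c) ^+ 2 / (2 * tau ^+ 2)))) =
   M / tau * (expR 1 * expR (- ((x - c) ^+ 2 / (2 * tau ^+ 2)))).
  by field; rewrite !gt_eqF.
rewrite -[leLHS]mulr1 ler_wpM2l ?divr_ge0 ?(ltW t0)// -expRD -[leLHS]expR0 ler_expR.
rewrite subr_ge0 ler_pdivrMr ?mulr_gt0 ?exprn_gt0// mul1r.
rewrite -(real_normK (num_real _)).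
have : `|x - c| ^+ 2 <= tau ^+ 2.
  rewrite lerXn2r ?nnegrE ?(ltW t0)// (le_trans hx)// ler_pdivrMr// ler_peMr ?(ltW t0)//.
  by rewrite ler1n.
have : 0 <= tau ^+ 2 by exact: sqr_ge0.
lra.
Qed.

End StepFunctions.

(** * The weighted Gaussian kernel and its pointwise bound *)

Section Kernel.
Variables (R : realType) (d m : nat).
Local Notation C := (R[i]^o).
Local Notation Re := (@complex.Re R).
Local Notation Im := (@complex.Im R).
Local Notation par := 'rV[R]_(d + (m + m)).
Local Notation N := (d + (m + m)).
Local Notation RM := (measurableTypeR R).
Local Notation mu := (@lebesgue_measure R).
Local Notation ix := (@ix d m).
Local Notation iu := (@iu d m).
Local Notation iv := (@iv d m).
Variable h : 'rV[R]_d -> 'rV[C]_m -> 'rV[R]_d.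
Hypothesis hC1 : C1_graphing h.
Hypothesis hBG : bloom_graham h.
Variable eta : R -> R.
Hypothesis seta : smooth1 eta.
Hypothesis eta0 : forall x, x <= 0 -> eta x = 0.
Hypothesis eta1 : forall x, 1 <= x -> eta x = 1.
Variable M : R.
Hypothesis M1 : 1 <= M.
Hypothesis etaM : forall x, `|eta x| <= M /\ `|derive1 eta x| <= M.
Variables (W r0 : R).
Hypothesis W0 : 0 <= W.
Hypothesis r00 : 0 <= r0.
Implicit Types (t : par) (tau : R) (z : 'rV[C]_(d + m)).

Local Notation lam := (lam hC1 W r0).
Local Notation xrad := (xrad hC1 W r0).
Local Notation crad := (crad hC1 W r0).
Local Notation mollifier := (mollifier eta).

Definition wt (i : 'I_(d + m)) : R :=
  match fintype.split i with inl j => lam j | inr _ => 1 end.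

Lemma wt_z j : wt (lshift m j) = lam j.
Proof. by rewrite /wt (unsplitK (inl j)). Qed.
Lemma wt_w l : wt (rshift d l) = 1.
Proof. by rewrite /wt (unsplitK (inr l)). Qed.

Lemma lam_gt0 j : 0 < lam j. Proof. exact: weight_gt0. Qed.

Lemma wt_gt0 i : 0 < wt i.
Proof. by rewrite /wt; case: fintype.split => [j|_]; rewrite ?lam_gt0. Qed.

Definition sd tau i : R := tau * (Num.sqrt (wt i))^-1.

Lemma sd_gt0 tau i : 0 < tau -> 0 < sd tau i.
Proof. by move=> t0; rewrite mulr_gt0// invr_gt0 sqrtr_gt0 wt_gt0. Qed.

Lemma sd_sqr tau i : (sd tau i ^+ 2 *+ 2)^-1 = wt i / (2 * tau ^+ 2).
Proof.
rewrite /sd exprMn exprVn sqr_sqrtr ?(ltW (wt_gt0 i))// -mulr_natl mulrA.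
by rewrite invfM invrK mulrC.
Qed.

Definition kern tau z : C := \prod_i gkern (sd tau i) (z 0 i).

Definition kpeak tau : R := \prod_i normal_peak (sd tau i).

Definition kphase tau z : C := \sum_i rc (- (wt i / (2 * tau ^+ 2))) * z 0 i ^+ 2.

Lemma cexp_sum I (r : seq I) (F : I -> C) :
  cexp (\sum_(i <- r) F i) = \prod_(i <- r) cexp (F i).
Proof.
by elim: r => [|i r ih]; rewrite ?big_nil ?cexp0// !big_cons cexpD ih.
Qed.

Lemma kernE tau z : kern tau z = rc (kpeak tau) * cexp (kphase tau z).
Proof.
rewrite /kern /kpeak /kphase rc_prod cexp_sum -big_split /=.
by apply: eq_bigr => i _; rewrite /gkern sd_sqr.
Qed.

(** Half the smallest weight: a decay rate valid in all the x and u directions at once. *)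
Definition kappa : R := 2^-1 * (weight_radius hC1 W r0 d).1.

Lemma kappa_gt0 : 0 < kappa.
Proof. by rewrite mulr_gt0// weight_gt0. Qed.

Lemma kappa_le_lam j : kappa <= 2^-1 * lam j.
Proof. by rewrite ler_wpM2l// weight_anti. Qed.

Lemma kappa_le : kappa <= 2^-1.
Proof. by rewrite ler_piMr// (weight_anti hC1 W r0 (leq0n d)). Qed.

Definition sqdist t t' : R := \sum_i (t 0 i - t' 0 i) ^+ 2.

(* Clipping keeps the imaginary parts bounded, so that the kernel is integrable
   over the whole parameter space; on the box, and for [v] close to [v'], this
   is the true displacement [graph_map h t - graph_map h t']. *)
Definition cdisp t t' : 'rV[C]_(d + m) :=
  row_mx
    (\row_j ((t 0 (ix j) - t' 0 (ix j)) +i*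
       (hclip h (crad j) j t - hclip h (crad j) j t'))%C)
    (\row_l ((t 0 (iu l) - t' 0 (iu l)) +i* clip 1 (t 0 (iv l) - t' 0 (iv l)))%C).

Lemma cdisp_z t t' j : cdisp t t' 0 (lshift m j) = ((t 0 (ix j) - t' 0 (ix j)) +i*
       (hclip h (crad j) j t - hclip h (crad j) j t'))%C.
Proof. by rewrite /cdisp row_mxEl mxE. Qed.

Lemma cdisp_w t t' l : cdisp t t' 0 (rshift d l) =
  ((t 0 (iu l) - t' 0 (iu l)) +i* clip 1 (t 0 (iv l) - t' 0 (iv l)))%C.
Proof. by rewrite /cdisp row_mxEr mxE. Qed.

Let Re_phase_term (x a b c : R) :
  Re (rc (- (x / c)) * ((a +i* b)%C : C) ^+ 2) = - c^-1 * (x * (a ^+ 2 - b ^+ 2)).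
Proof. by rewrite expr2 !ReImE /=; ring. Qed.

Lemma Re_kphase tau t t' (z : 'rV[C]_(d + m)) (b : 'I_m -> R) :
  (forall j, z 0 (lshift m j) = cdisp t t' 0 (lshift m j)) ->
  (forall l, z 0 (rshift d l) = ((t 0 (iu l) - t' 0 (iu l)) +i* b l)%C) ->
  Re (kphase tau z) = - (2 * tau ^+ 2)^-1 *
    (\sum_j lam j * ((t 0 (ix j) - t' 0 (ix j)) ^+ 2 -
       (hclip h (crad j) j t - hclip h (crad j) j t') ^+ 2) +
     \sum_l ((t 0 (iu l) - t' 0 (iu l)) ^+ 2 - b l ^+ 2)).
Proof.
move=> zz zw; rewrite /kphase Re_sum big_split_ord /= mulrDr.
rewrite !mulr_sumr; congr (_ + _); apply: eq_bigr => i _.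
  by rewrite wt_z zz cdisp_z Re_phase_term.
by rewrite wt_w zw Re_phase_term mul1r.
Qed.

(* The slopes of the graphing functions are absorbed by the weights, so the
   phase only fails to be positive in the v directions. *)
Lemma phase_lower_bound t t' (b : 'I_m -> R) :
  (forall l, b l ^+ 2 <= (t 0 (iv l) - t' 0 (iv l)) ^+ 2) ->
  2^-1 * \sum_j lam j * (t 0 (ix j) - t' 0 (ix j)) ^+ 2 +
  2^-1 * \sum_l (t 0 (iu l) - t' 0 (iu l)) ^+ 2 -
  3 / 2 * \sum_l (t 0 (iv l) - t' 0 (iv l)) ^+ 2 <=
  \sum_j lam j * ((t 0 (ix j) - t' 0 (ix j)) ^+ 2 -
       (hclip h (crad j) j t - hclip h (crad j) j t') ^+ 2) +
     \sum_l ((t 0 (iu l) - t' 0 (iu l)) ^+ 2 - b l ^+ 2).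
Proof.
move=> bv; under [X in _ <= X + _]eq_bigr do rewrite mulrBr.
rewrite !sumrB; have := weighted_slope hC1 hBG W0 r00 t t'.
have : \sum_l b l ^+ 2 <= \sum_l (t 0 (iv l) - t' 0 (iv l)) ^+ 2.
  by apply: ler_sum => l _; exact: bv.
lra.
Qed.

Lemma kpeakE tau : 0 < tau -> kpeak tau = tau ^- (d + m) * kpeak 1.
Proof.
move=> t0; rewrite /kpeak -exprVn -[in X in X * _](card_ord (d + m)) -prodr_const.
rewrite -big_split /=; apply: eq_bigr => i _.
by rewrite /sd mul1r normal_peakM.
Qed.

Lemma kpeak_gt0 tau : 0 < tau -> 0 < kpeak tau.
Proof.
by move=> t0; apply: prodr_gt0 => i _; rewrite normal_peak_gt0// gt_eqF// sd_gt0.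
Qed.

Lemma nm_kern_le tau z : 0 < tau ->
  nm (kern tau z) <= 2 * kpeak tau * expR (Re (kphase tau z)).
Proof.
move=> t0; rewrite kernE nm_scale gtr0_norm ?kpeak_gt0// -mulrA mulrCA.
by rewrite ler_wpM2l ?(ltW (kpeak_gt0 t0))// nm_cexp_le.
Qed.

Definition moll tau (c t : par) : R := \prod_l mollifier tau (c 0 (iv l)) (t 0 (iv l)).

Definition Phi tau (t' t : par) : C := kern tau (cdisp t t') * rc (moll tau t' t).

Lemma moll_eq0 tau (c t : par) l : 0 < tau -> tau / 2 < `|t 0 (iv l) - c 0 (iv l)| ->
  moll tau c t = 0.
Proof.
move=> t0 hl; rewrite /moll (bigD1 l)//=.
have [_ ->//] := mollifier_integral seta eta0 eta1 (c 0 (iv l)) t0.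
by rewrite mul0r.
Qed.

Lemma moll_le tau (c t : par) : 0 < tau -> `|moll tau c t| <= (M / tau) ^+ m.
Proof.
move=> t0; rewrite /moll normr_prod -[m in leRHS]card_ord -prodr_const.
by apply: ler_prod => l _; rewrite normr_ge0 /=; exact: mollifier_bound.
Qed.

(** Chosen so that the normal densities of scale [tau * vs] decay at rate kappa / (4 tau^2), half of
    the decay of [Phi]. One half is spent on integrability and the other is kept as a gain far from
    t'. *)
Let vs : R := Num.sqrt (2 / kappa).

Let vs_gt0 : 0 < vs.
Proof. by rewrite sqrtr_gt0 divr_gt0// kappa_gt0. Qed.

Definition pdfs tau (t' t : par) : R :=
  \prod_i normal_pdf (t' 0 i) (tau * vs) (t 0 i).

Lemma pdfsE tau t' t : 0 < tau -> pdfs tau t' t =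
  tau ^- N * normal_peak vs ^+ N * expR (- (kappa / (4 * tau ^+ 2) * sqdist t t')).
Proof.
move=> t0; rewrite /pdfs.
under eq_bigr do rewrite normal_pdfME//.
rewrite big_split /= prodr_const card_ord exprMn exprVn -expR_sum; congr (_ * expR _).
rewrite /sqdist mulr_sumr -sumrN; apply: eq_bigr => i _; congr (- _).
rewrite /vs sqr_sqrtr ?divr_ge0 ?(ltW kappa_gt0)//.
have := kappa_gt0 => k0; field; rewrite !gt_eqF//.
Qed.

(** Independent of tau: the d + m powers from the Gaussian peak and the m from the mollifier match
    the N of the densities. The exponential pays for the v directions, where |v_l - v'_l| <= tau / 2
    on the support. *)
Definition Kphi : R := 2 * kpeak 1 * M ^+ m * expR ((kappa / 2 + 3 / 4) * m%:R) /
  normal_peak vs ^+ N.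

Lemma Kphi_ge0 : 0 <= Kphi.
Proof.
rewrite divr_ge0 ?exprn_ge0 ?normal_peak_ge0//.
rewrite !mulr_ge0 ?expR_ge0 ?exprn_ge0 ?(ltW (kpeak_gt0 ltr01))//.
by rewrite (le_trans _ M1).
Qed.

Lemma sqdist_par t t' : sqdist t t' = \sum_j (t 0 (ix j) - t' 0 (ix j)) ^+ 2 +
  (\sum_l (t 0 (iu l) - t' 0 (iu l)) ^+ 2 + \sum_l (t 0 (iv l) - t' 0 (iv l)) ^+ 2).
Proof. exact: big_par. Qed.

Let phase_arith (k X A su sv kx ku kv n t2 : R) :
  2^-1 * X + 2^-1 * su - 3 / 2 * sv <= A -> kx <= 2^-1 * X -> ku <= 2^-1 * su ->
  kv <= k * (n * (t2 / 4)) -> sv <= n * (t2 / 4) -> 0 <= n * t2 -> 0 <= k * (n * t2) ->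
  kx + ku + kv - (k + 3 / 2) * n * t2 <= A.
Proof.
have -> : k * (n * (t2 / 4)) = k * (n * t2) / 4 by field.
have -> : (k + 3 / 2) * n * t2 = k * (n * t2) + 3 / 2 * (n * t2) by field.
have -> : n * (t2 / 4) = n * t2 / 4 by field.
by move: (k * (n * t2)) (n * t2) => *; lra.
Qed.

Lemma nm_Phi_le tau t' t : 0 < tau -> nm (Phi tau t' t) <=
  Kphi * expR (- (kappa / (4 * tau ^+ 2) * sqdist t t')) * pdfs tau t' t.
Proof.
move=> t0; have RHS0 : 0 <= Kphi * expR (- (kappa / (4 * tau ^+ 2) * sqdist t t')) * pdfs tau t' t.
  apply: mulr_ge0; first by rewrite mulr_ge0 ?Kphi_ge0 ?expR_ge0.
  by apply: prodr_ge0 => i _; exact: normal_pdf_ge0.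
have [/existsP[l hl]|] := boolP [exists l, tau / 2 < `|t 0 (iv l) - t' 0 (iv l)|].
  by rewrite /Phi (moll_eq0 t0 hl) rc0 mulr0 nm0.
rewrite negb_exists => /forallP hv.
have {}hv l : (t 0 (iv l) - t' 0 (iv l)) ^+ 2 <= tau ^+ 2 / 4.
  have := hv l; rewrite -leNgt => hl; rewrite -(real_normK (num_real _)).
  have -> : tau ^+ 2 / 4 = (tau / 2) ^+ 2 by field.
  by rewrite lerXn2r// nnegrE// divr_ge0// ltW.
have {hv}V : \sum_l (t 0 (iv l) - t' 0 (iv l)) ^+ 2 <= m%:R * (tau ^+ 2 / 4).
  rewrite mulr_natl -[in leRHS](card_ord m) -sumr_const.
  by apply: ler_sum => l _; exact: hv.
have tau2 : 0 < tau ^+ 2 by rewrite exprn_gt0.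
have phase : Re (kphase tau (cdisp t t')) <=
    - (kappa / (2 * tau ^+ 2) * sqdist t t') + (kappa / 2 + 3 / 4) * m%:R.
  rewrite (@Re_kphase tau t t' _ (fun l => clip 1 (t 0 (iv l) - t' 0 (iv l))))//;
    last by move=> l; exact: cdisp_w.
  have cl l : clip 1 (t 0 (iv l) - t' 0 (iv l)) ^+ 2 <= (t 0 (iv l) - t' 0 (iv l)) ^+ 2.
    have := @clip_lipschitz R 1 (t 0 (iv l) - t' 0 (iv l)) 0 ler01.
    by rewrite [clip 1 0]clip_id ?normr0// !subr0.
  have := phase_lower_bound cl; set A := (X in _ <= X -> _) => hA.
  rewrite mulNr -[leRHS]opprK lerN2 opprD opprK.
  rewrite sqdist_par; set X := \sum_j _ in hA *.
  have hX : kappa * \sum_j (t 0 (ix j) - t' 0 (ix j)) ^+ 2 <=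
      2^-1 * \sum_j lam j * (t 0 (ix j) - t' 0 (ix j)) ^+ 2.
    rewrite !mulr_sumr; apply: ler_sum => j _; rewrite [leRHS]mulrA.
    by rewrite ler_wpM2r ?sqr_ge0// kappa_le_lam.
  have U0 : 0 <= \sum_l (t 0 (iu l) - t' 0 (iu l)) ^+ 2.
    by apply: sumr_ge0 => l _; exact: sqr_ge0.
  have hU : kappa * \sum_l (t 0 (iu l) - t' 0 (iu l)) ^+ 2 <=
      2^-1 * \sum_l (t 0 (iu l) - t' 0 (iu l)) ^+ 2.
    by rewrite ler_wpM2r// kappa_le.
  have kV : kappa * \sum_l (t 0 (iv l) - t' 0 (iv l)) ^+ 2 <= kappa * (m%:R * (tau ^+ 2 / 4)).
    by rewrite ler_wpM2l// ltW// kappa_gt0.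
  have -> : kappa / (2 * tau ^+ 2) * (\sum_j (t 0 (ix j) - t' 0 (ix j)) ^+ 2 +
      (\sum_l (t 0 (iu l) - t' 0 (iu l)) ^+ 2 +
       \sum_l (t 0 (iv l) - t' 0 (iv l)) ^+ 2)) - (kappa / 2 + 3 / 4) * m%:R =
    (2 * tau ^+ 2)^-1 * (kappa * \sum_j (t 0 (ix j) - t' 0 (ix j)) ^+ 2 +
      kappa * \sum_l (t 0 (iu l) - t' 0 (iu l)) ^+ 2 +
      kappa * \sum_l (t 0 (iv l) - t' 0 (iv l)) ^+ 2 -
      (kappa + 3 / 2) * m%:R * tau ^+ 2).
    by field; rewrite gt_eqF.
  rewrite ler_wpM2l ?invr_ge0 ?mulr_ge0 ?(ltW t0)//.
  have m0 : 0 <= m%:R * tau ^+ 2 by rewrite mulr_ge0// ltW.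
  have km0 : 0 <= kappa * (m%:R * tau ^+ 2) by rewrite mulr_ge0// ltW// kappa_gt0.
  exact: phase_arith hA hX hU kV V m0 km0.
rewrite /Phi [kern _ _ * _]mulrC nm_scale.
apply: (@le_trans _ _ ((M / tau) ^+ m * (2 * kpeak tau *
    expR (- (kappa / (2 * tau ^+ 2) * sqdist t t') + (kappa / 2 + 3 / 4) * m%:R)))).
  apply: ler_pM; rewrite ?normr_ge0 ?nm_ge0 ?moll_le//.
  apply: (le_trans (nm_kern_le _ t0)).
  by rewrite ler_wpM2l ?mulr_ge0 ?(ltW (kpeak_gt0 t0))// ler_expR.
rewrite pdfsE// kpeakE// expRD.
have p0 : normal_peak vs ^+ N != 0 by rewrite expf_neq0// gt_eqF// normal_peak_gt0// gt_eqF.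
have -> : expR (- (kappa / (2 * tau ^+ 2) * sqdist t t')) =
    expR (- (kappa / (4 * tau ^+ 2) * sqdist t t')) *
    expR (- (kappa / (4 * tau ^+ 2) * sqdist t t')).
  by rewrite -expRD; congr expR; field; rewrite gt_eqF.
have tN : tau ^- N = tau ^- m * tau ^- (d + m).
  by rewrite -invfM -exprD; congr (tau ^- _); rewrite -[LHS]/(d + (m + m))%N addnCA.
rewrite /Kphi tN exprMn exprVn le_eqVlt; apply/orP; left; apply/eqP.
by set e := expR _; field; rewrite p0 /= !expf_neq0// gt_eqF.
Qed.

End Kernel.

(** * The kernel is an approximate identity *)

Section ApproximateIdentity.
Variables (R : realType) (d m : nat).
Local Notation C := (R[i]^o).
Local Notation Re := (@complex.Re R).
Local Notation Im := (@complex.Im R).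
Local Notation par := 'rV[R]_(d + (m + m)).
Local Notation N := (d + (m + m))%N.
Local Notation RM := (measurableTypeR R).
Local Notation mu := (@lebesgue_measure R).
Local Notation ltup := (lebesgue_tuple R N).
Local Notation ix := (@ix d m).
Local Notation iu := (@iu d m).
Local Notation iv := (@iv d m).
Variable h : 'rV[R]_d -> 'rV[C]_m -> 'rV[R]_d.
Hypothesis hC1 : C1_graphing h.
Hypothesis hBG : bloom_graham h.
Variable eta : R -> R.
Hypothesis seta : smooth1 eta.
Hypothesis eta0 : forall x, x <= 0 -> eta x = 0.
Hypothesis eta1 : forall x, 1 <= x -> eta x = 1.
Variable M : R.
Hypothesis M1 : 1 <= M.
Hypothesis etaM : forall x, `|eta x| <= M /\ `|derive1 eta x| <= M.
Variables (W r0 : R).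
Hypothesis W0 : 0 <= W.
Hypothesis r00 : 0 <= r0.
Implicit Types (t : par) (tau : R) (z : 'rV[C]_(d + m)).

Local Notation crad := (crad hC1 W r0).
Local Notation sd := (sd hC1 W r0).
Local Notation Phi := (Phi hC1 eta W r0).

Lemma cmfun_gkern d' (T : measurableType d') s (F : T -> C) : cmfun F ->
  cmfun (fun x => gkern s (F x)).
Proof.
move=> mF; apply: cmfunM; first exact: cmfun_cst.
by apply: cmfun_cexp; apply: cmfunM; [exact: cmfun_cst|exact: cmfunX].
Qed.

Lemma integrable_weights_pdf n (K c s : 'I_n -> R) : (forall i, 0 <= K i) ->
  integrable_weights (fun i x => K i * normal_pdf (c i) (s i) x).
Proof.
move=> K0 i; split.
- by apply: measurable_funM; [exact: measurable_cst|exact: measurable_normal_pdf].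
- by move=> x; rewrite mulr_ge0 ?normal_pdf_ge0.
- exact: (integrableZl measurableT (K i) (integrable_normal_pdf (c i) (s i))).
Qed.

Lemma crad_ge0 j : 0 <= crad j.
Proof. by rewrite (le_trans r00)// (@radius_mono _ _ _ _ hC1 W r0 W0 0). Qed.

Lemma cmfun_hclip j : measurable_fun setT (fun s : N.-tuple RM => hclip h (crad j) j (row_tuple s)).
Proof. by apply: measurable_row_tuple; apply: continuous_hclip => //; exact: crad_ge0. Qed.

Section Normalization.
Variables (tau : R) (t' : par).
Hypothesis tau0 : 0 < tau.

Let kap := parcase
  (fun j (x a : R) => gkern (sd tau (lshift m j)) ((x - t' 0 (ix j)) +i* a)%C)
  (fun l (x a : R) => gkern (sd tau (rshift d l)) ((x - t' 0 (iu l)) +i* a)%C)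
  (fun l (x a : R) => rc (mollifier eta tau (t' 0 (iv l)) x)).

Let arg := parcase
  (fun j (s : N.-tuple RM) => hclip h (crad j) j (row_tuple s) - hclip h (crad j) j t')
  (fun l s => clip 1 (tnth s (iv l) - t' 0 (iv l)))
  (fun l s => 0).

(** Ordered by dependence: the shift in the x_j factor involves w and the x_k with k < j, the one in
    the u_l factor involves v_l only, and the mollifiers have none. *)
Let rank := @parcase d m nat (fun j => 2 + j)%N (fun=> 1%N) (fun=> 0%N).

Let Kx j := 2 * expR ((sd tau (lshift m j) ^+ 2 *+ 2)^-1 *
  (hlip hC1 (crad j) * (N%:R * (2 * crad j) ^+ 2))).
Let Ku l := 2 * expR ((sd tau (rshift d l) ^+ 2 *+ 2)^-1 * 1).

Let w (i : 'I_N) (x : R) := parcase Kx Ku (fun=> M * expR 1 / normal_peak 1) i *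
  normal_pdf (t' 0 i) (parcase (fun j => sd tau (lshift m j))
    (fun l => sd tau (rshift d l)) (fun=> tau) i) x.

Let hw : integrable_weights w.
Proof.
apply: integrable_weights_pdf => i; elim/par_ind: i => [j|l|l].
- by rewrite parcase_x mulr_ge0 ?expR_ge0.
- by rewrite parcase_u mulr_ge0 ?expR_ge0.
- rewrite parcase_v mulr_ge0 ?invr_ge0 ?normal_peak_ge0// mulr_ge0 ?expR_ge0//.
  exact: le_trans M1.
Qed.

Let sdn i : sd tau i != 0.
Proof. by rewrite gt_eqF// sd_gt0. Qed.

Let kapw i s x : nm (kap i x (arg i s)) <= w i x.
Proof.
rewrite /kap /arg /w; elim/par_ind: i => [j|l|l].
- rewrite !parcase_x; apply: (le_trans (nm_gkern_le _ (sdn _) _ _)).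
  rewrite ler_wpM2r ?normal_pdf_ge0// ler_wpM2l// ler_expR ler_wpM2l//.
    by rewrite invr_ge0 mulrn_wge0// sqr_ge0.
  exact: hclip_shift_bounded (crad_ge0 j).
- rewrite !parcase_u; apply: (le_trans (nm_gkern_le _ (sdn _) _ _)).
  rewrite ler_wpM2r ?normal_pdf_ge0// ler_wpM2l// ler_expR ler_wpM2l//.
    by rewrite invr_ge0 mulrn_wge0// sqr_ge0.
  rewrite -(real_normK (num_real _)) exprn_ile1//.
  exact: clip_norm.
- rewrite !parcase_v nm_rc; exact: mollifier_le_pdf.
Qed.

Let mcoord i : measurable_fun setT (fun s : N.-tuple RM => tnth s i : R).
Proof. exact: measurable_tnth. Qed.

Let mkap i : cmfun (fun s : N.-tuple RM => kap i (tnth s i) (arg i s)).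
Proof.
rewrite /kap /arg; elim/par_ind: i => [j|l|l].
- rewrite !parcase_x; apply: cmfun_gkern; apply: cmfun_complex.
    by apply: measurable_funB; [exact: mcoord|exact: measurable_cst].
  by apply: measurable_funB; [exact: cmfun_hclip|exact: measurable_cst].
- rewrite !parcase_u; apply: cmfun_gkern; apply: cmfun_complex.
    by apply: measurable_funB; [exact: mcoord|exact: measurable_cst].
  apply: measurable_maxr; first exact: measurable_cst.
  apply: measurable_minr; first exact: measurable_cst.
  by apply: measurable_funB; [exact: mcoord|exact: measurable_cst].
- rewrite !parcase_v; apply: cmfun_rc.
  apply: (@measurableT_comp _ _ _ _ _ _ (mollifier eta tau (t' 0 (iv l)) : RM -> RM) _
    (fun s : N.-tuple RM => tnth s (iv l))); last exact: mcoord.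
  apply: continuous_measurable_fun.
  exact: (smooth1_continuous (smooth1_derive1 (smooth1_step seta tau _))).
Qed.

Let mkap1 i a : cmfun (fun x : RM => kap i x a).
Proof.
have mx (c : R) : measurable_fun setT (fun x : RM => x - c : R).
  by apply: measurable_funB; [exact: measurable_id|exact: measurable_cst].
rewrite /kap; elim/par_ind: i => [j|l|l].
- rewrite !parcase_x; apply: cmfun_gkern; apply: cmfun_complex => //.
- rewrite !parcase_u; apply: cmfun_gkern; apply: cmfun_complex => //.
- rewrite !parcase_v; apply: cmfun_rc; apply: continuous_measurable_fun.
  exact: (smooth1_continuous (smooth1_derive1 (smooth1_step seta tau _))).
Qed.

Let kap1 i s : cint mu (fun x => kap i x (arg i s)) = 1.
Proof.
rewrite /kap /arg; elim/par_ind: i => [j|l|l].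
- by rewrite !parcase_x; exact: cint_gkern.
- by rewrite !parcase_u; exact: cint_gkern.
- rewrite !parcase_v /cint /= Rintegral_cst// mul0r.
  by have [-> _] := mollifier_integral seta eta0 eta1 (t' 0 (iv l)) tau0.
Qed.

Let arank i l s x : (rank i <= rank l)%N -> arg i (tupd s l x) = arg i s.
Proof.
have rows k : k != l -> row_tuple (tupd s l x) 0 k = row_tuple s 0 k.
  by move=> kl; rewrite !mxE tnth_tupd (negbTE kl).
have rankx j : rank (ix j) = (2 + j)%N by rewrite /rank parcase_x.
have ranku k : rank (iu k) = 1%N by rewrite /rank parcase_u.
have rankv k : rank (iv k) = 0%N by rewrite /rank parcase_v.
rewrite /arg; elim/par_ind: i => [j|k|k] il.
- rewrite !parcase_x; congr (_ - _); apply: hclip_dep => // [k kj|k|k]; apply: rows;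
    apply: contraTneq il => <-; rewrite ?rankx ?ranku ?rankv//.
  by rewrite -ltnNge ltn_add2l.
- rewrite !parcase_u tnth_tupd ifN//.
  by apply: contraTneq il => <-; rewrite ranku rankv.
- by rewrite !parcase_v.
Qed.

Let prod_kapE s : \prod_i kap i (tnth s i) (arg i s) = Phi tau t' (row_tuple s).
Proof.
rewrite big_prod_par /Phi /kern /moll big_split_ord /= rc_prod -mulrA; congr (_ * (_ * _)).
- by apply: eq_bigr => j _; rewrite /kap /arg !parcase_x cdisp_z mxE.
- by apply: eq_bigr => l _; rewrite /kap /arg !parcase_u cdisp_w !mxE.
- by apply: eq_bigr => l _; rewrite /kap /arg !parcase_v mxE.
Qed.

Lemma cint_Phi : cint ltup (fun s => Phi tau t' (row_tuple s)) = 1.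
Proof.
under [X in cint _ X]eq_fun do rewrite -prod_kapE.
apply: (cint_prod_triangular mkap _ kap1 hw kapw arank) => i s.
apply: (@cintegrable_bounded_by _ (measurableTypeR R) R mu (w i)); first exact: mkap1.
  by move=> x; exact: kapw.
by case: (hw i).
Qed.

Lemma cmfun_Phi : cmfun (fun s : N.-tuple RM => Phi tau t' (row_tuple s)).
Proof.
by under eq_fun do rewrite -prod_kapE; apply: cmfun_prod => i; exact: mkap.
Qed.

End Normalization.

Local Notation kappa := (kappa hC1 W r0).
Local Notation Kphi := (Kphi hC1 M W r0).
Local Notation pdfs := (pdfs hC1 W r0).

Lemma integral_pdfs tau t' : 0 < tau ->
  ltup.-integrable setT (EFin \o (fun s => pdfs tau t' (row_tuple s))) /\
  \int[ltup]_s pdfs tau t' (row_tuple s) = 1.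
Proof.
move=> tau0; have s0 : tau * Num.sqrt (2 / kappa) != 0.
  by rewrite gt_eqF// mulr_gt0// sqrtr_gt0 divr_gt0// kappa_gt0.
have E s : pdfs tau t' (row_tuple s) = \prod_i
    (1 * normal_pdf (t' 0 i) (tau * Num.sqrt (2 / kappa)) (tnth s i)).
  by apply: eq_bigr => i _; rewrite mul1r mxE.
have hw : integrable_weights (fun (i : 'I_N) x =>
    1 * normal_pdf (t' 0 i) (tau * Num.sqrt (2 / kappa)) x).
  exact: (@integrable_weights_pdf _ (fun=> 1)).
split.
  under [X in EFin \o X]eq_fun do rewrite E.
  exact: (integrable_prod_tuple hw).
under eq_Rintegral do rewrite E.
have [mw w0] : (forall i : 'I_N, measurable_fun setT (fun x =>
      1 * normal_pdf (t' 0 i) (tau * Num.sqrt (2 / kappa)) x)) /\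
    (forall (i : 'I_N) x,
      0 <= 1 * normal_pdf (t' 0 i) (tau * Num.sqrt (2 / kappa)) x).
  by split=> i; have [] := hw i.
have w1 (i : 'I_N) : (\int[mu]_x
    (1 * normal_pdf (t' 0 i) (tau * Num.sqrt (2 / kappa)) x)%:E = 1%:E)%E.
  by under eq_integral do rewrite mul1r; exact: integral_normal_pdf.
by rewrite /Rintegral (integral_prod_tuple mw w0 w1) big1.
Qed.

(** Since the kernel has integral 1, z goes under the integral. Within distance delta the integrand
    is controlled by e; beyond it, by the exponential kept in [nm_Phi_le]. In both cases the
    remaining factor [pdfs] has integral 1. *)
Lemma approximate_identity tau t' (F : par -> C) (z : C) (e B delta : R) :
  0 < tau -> cmfun (fun s : N.-tuple RM => F (row_tuple s)) ->
  (forall t, nm (F t) <= B) -> 0 <= e ->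
  (forall t, sqdist t t' < delta ^+ 2 -> nm (F t - z) <= e) ->
  nm (cint ltup (fun s => F (row_tuple s) * Phi tau t' (row_tuple s)) - z) <=
  2 * (Kphi * (e + (B + nm z) * expR (- (kappa / (4 * tau ^+ 2) * delta ^+ 2)))).
Proof.
move=> tau0 mF FB e0 Fe.
have [ipdf pdf1] := integral_pdfs t' tau0.
have K0 : 0 <= Kphi by exact: Kphi_ge0.
have k0 := @kappa_gt0 R d m h hC1 W r0.
have B0 : 0 <= B + nm z by rewrite addr_ge0 ?nm_ge0// (le_trans (nm_ge0 (F 0))).
have mPhi := cmfun_Phi tau t'.
have pdf0 s : 0 <= pdfs tau t' (row_tuple s).
  by apply: prodr_ge0 => i _; exact: normal_pdf_ge0.
have nPhi s : nm (Phi tau t' (row_tuple s)) <=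
    Kphi * expR (- (kappa / (4 * tau ^+ 2) * sqdist (row_tuple s) t')) *
    pdfs tau t' (row_tuple s) by exact: nm_Phi_le.
have kk : 0 <= kappa / (4 * tau ^+ 2).
  by rewrite divr_ge0 ?(ltW k0)// mulr_ge0// sqr_ge0.
have e1 s : expR (- (kappa / (4 * tau ^+ 2) * sqdist (row_tuple s) t')) <= 1.
  rewrite -[leRHS]expR0 ler_expR oppr_le0; apply: mulr_ge0; first exact: kk.
  by apply: sumr_ge0 => i _; exact: sqr_ge0.
pose K := Kphi * (e + (B + nm z) * expR (- (kappa / (4 * tau ^+ 2) * delta ^+ 2))).
have ipdfK (c : R) : ltup.-integrable setT
    (EFin \o (fun s => c * pdfs tau t' (row_tuple s))).
  exact: (integrableZl measurableT c ipdf).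
have iPhi : cintegrable ltup (fun s => Phi tau t' (row_tuple s)).
  apply: (@cintegrable_bounded_by _ _ _ _ (fun s => Kphi * pdfs tau t' (row_tuple s))) => //.
  move=> s; apply: (le_trans (nPhi s)); rewrite ler_wpM2r// ler_piMr//.
have iFPhi : cintegrable ltup (fun s => F (row_tuple s) * Phi tau t' (row_tuple s)).
  apply: (@cintegrable_bounded_by _ _ _ _ (fun s => (2 * (B * Kphi)) * pdfs tau t' (row_tuple s))) => //.
    exact: cmfunM.
  move=> s; apply: (le_trans (nmM _ _)).
  have [n1 n2] := (nm_ge0 (F (row_tuple s)), nm_ge0 (Phi tau t' (row_tuple s))).
  have B1 : 0 <= B by exact: le_trans n1 (FB _).
  have : nm (F (row_tuple s)) * nm (Phi tau t' (row_tuple s)) <=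
      B * (Kphi * pdfs tau t' (row_tuple s)).
    by apply: ler_pM => //; apply: (le_trans (nPhi s)); rewrite ler_wpM2r// ler_piMr.
  move=> hB; apply: (le_trans hB); rewrite mulrA -[leRHS]mulrA.
  by apply: ler_peMl; [apply: mulr_ge0 => //; exact: mulr_ge0|exact: ler1n].
rewrite -[z in X in nm X]mulr1 -(cint_Phi t' tau0) -cintZ// -cintB//; last exact: cintegrableZ.
apply: (le_trans (@nm_cint_le _ _ _ _ (fun s => K * pdfs tau t' (row_tuple s)) _ _ _ _)) => //.
- by apply: cmfunB; apply: cmfunM => //; exact: cmfun_cst.
- move=> s /=; rewrite -mulrBl; apply: (le_trans (nmM _ _)).
  set X := nm _; set Y := nm _.
  have X0 : 0 <= X by exact: nm_ge0.
  have XB : X <= B + nm z.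
    by apply: (le_trans (nmD _ _)); rewrite nmN lerD.
  rewrite /K; set E := expR _; have E0 : 0 <= E by exact: expR_ge0.
  suff : X * expR (- (kappa / (4 * tau ^+ 2) * sqdist (row_tuple s) t')) <= e + (B + nm z) * E.
    move=> XE; apply: (le_trans (ler_wpM2l X0 (nPhi s))).
    by rewrite mulrA [X * (_ * _)]mulrCA ler_wpM2r// ler_wpM2l.
  have [sd|sd] := ltP (sqdist (row_tuple s) t') (delta ^+ 2).
    have Xe : X <= e by exact: Fe.
    apply: (@le_trans _ _ e); last by rewrite lerDl mulr_ge0.
    by apply: le_trans Xe; rewrite ler_piMr.
  apply: (@le_trans _ _ ((B + nm z) * E)); last by rewrite lerDr.
  by apply: ler_pM => //; rewrite ?expR_ge0// ler_expR lerN2 ler_wpM2l.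
- by rewrite RintegralZl// pdf1 mulr1.
Qed.

End ApproximateIdentity.

(** * Integrals of functions vanishing outside a box *)

Section BoxIntegrals.
Variables (R : realType) (n : nat) (bnd : 'I_n -> R).
Local Notation C := (R[i]^o).
Local Notation Re := (@complex.Re R).
Local Notation Im := (@complex.Im R).
Local Notation RM := (measurableTypeR R).
Local Notation ltup := (lebesgue_tuple R n).
Implicit Types (a b : 'rV[R]_n -> C) (t : 'rV[R]_n) (s : n.-tuple RM).

(** Boundedness is asked on the box only: every integrand built from these functions carries a
    factor that vanishes outside. *)
Definition box_adm a := cmfun (fun s => a (row_tuple s)) /\
  exists2 K, 0 <= K & forall t, box bnd t -> nm (a t) <= K.

Lemma box_adm_cst z : box_adm (fun=> z).
Proof. by split; [exact: cmfun_cst|exists (nm z) => //; exact: nm_ge0]. Qed.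

Lemma box_admD a b : box_adm a -> box_adm b -> box_adm (fun t => a t + b t).
Proof.
move=> [ma [K K0 aK]] [mb [L L0 bL]]; split; first exact: cmfunD.
exists (K + L) => [|t Bt]; first by rewrite addr_ge0.
by apply: (le_trans (nmD _ _)); rewrite lerD ?aK ?bL.
Qed.

Lemma box_admM a b : box_adm a -> box_adm b -> box_adm (fun t => a t * b t).
Proof.
move=> [ma [K K0 aK]] [mb [L L0 bL]]; split; first exact: cmfunM.
exists (K * L) => [|t Bt]; first by rewrite mulr_ge0.
by apply: (le_trans (nmM _ _)); rewrite ler_pM ?nm_ge0 ?aK ?bL.
Qed.

Lemma box_adm_sum I (r : seq I) (a : I -> 'rV[R]_n -> C) :
  (forall i, box_adm (a i)) -> box_adm (fun t => \sum_(i <- r) a i t).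
Proof.
move=> aa; elim: r => [|i r ih].
  by under eq_fun do rewrite big_nil; exact: box_adm_cst.
by under eq_fun do rewrite big_cons; exact: box_admD.
Qed.

Lemma box_adm_prod I (r : seq I) (P : pred I) (a : I -> 'rV[R]_n -> C) :
  (forall i, box_adm (a i)) -> box_adm (fun t => \prod_(i <- r | P i) a i t).
Proof.
move=> aa; elim: r => [|i r ih].
  by under eq_fun do rewrite big_nil; exact: box_adm_cst.
under eq_fun do rewrite big_cons; case: (P i) => //; exact: box_admM.
Qed.

Lemma box_adm_cexp a : box_adm a -> box_adm (fun t => cexp (a t)).
Proof.
move=> [ma [K K0 aK]]; split; first exact: cmfun_cexp.
exists (2 * expR K) => [|t Bt]; first by rewrite mulr_ge0// expR_ge0.
apply: (le_trans (nm_cexp_le _)); rewrite ler_wpM2l// ler_expR.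
exact: le_trans (ler_norm _) (le_trans (Re_le_nm _) (aK _ Bt)).
Qed.

Lemma box_adm_continuous (f : 'rV[R]_n -> R) : continuous f -> box_adm (fun t => rc (f t)).
Proof.
move=> cf; split; first by apply: cmfun_rc; exact: measurable_row_tuple.
have [K K0 fK] := compact_continuous_bounded (@compact_box R n bnd) (fun t _ => cf t).
by exists K => // t Bt; rewrite nm_rc; exact: fK.
Qed.

Lemma box_adm_coord (f : R -> R) i : continuous f -> box_adm (fun t => rc (f (t 0 i))).
Proof.
move=> cf; apply: box_adm_continuous => t.
exact: (cvg_comp (fun t : 'rV[R]_n => t 0 i) f (@coord_continuous _ _ _ 0 i t) (cf _)).
Qed.

(** This is exp((b_i^2 - x^2) / 2), at least 1 for |x| <= b_i. Majorising the indicator of the box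
    by a product of Gaussians reuses the integrability of product weights. *)
Let w i (x : R) := expR (bnd i ^+ 2 / 2) / normal_peak 1 * normal_pdf 0 1 x.

Let hw : integrable_weights w.
Proof.
by apply: (@integrable_weights_pdf _ _ _ (fun=> 0) (fun=> 1)) => i;
  rewrite divr_ge0 ?expR_ge0 ?normal_peak_ge0.
Qed.

Let prod_w_ge1 s : box bnd (row_tuple s) -> 1 <= \prod_i w i (tnth s i).
Proof.
move=> Bs; apply: (@le_trans _ _ (\prod_(i < n) 1)); first by rewrite big1.
apply: ler_prod => i _.
rewrite ler01 /=.
rewrite /w normal_pdfE ?oner_eq0// /normal_fun subr0 expr1n.
have p0 : normal_peak 1 != 0 :> R by rewrite gt_eqF// normal_peak_gt0// oner_eq0.
set e1 := expR _; set e2 := expR _.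
have -> : e1 / normal_peak 1 * (normal_peak 1 * e2) = e1 * e2 by field.
rewrite /e1 /e2 -expRD -[leLHS]expR0 ler_expR mulNr subr_ge0 ler_pM2r//.
have := Bs i; rewrite mxE => b1; rewrite -(real_normK (num_real (tnth s i))).
by rewrite lerXn2r ?nnegrE// (le_trans _ b1).
Qed.

Let prod_w_ge0 s : 0 <= \prod_i w i (tnth s i).
Proof. by apply: prodr_ge0 => i _; have [_ ->] := hw i. Qed.

(** Not the measure of the box: twice the integral of the Gaussian majorant of its indicator, the 2
    coming from [nm_cint_le]. *)
Definition box_volume : R := 2 * \int[ltup]_s \prod_i w i (tnth s i).

Lemma box_volume_ge0 : 0 <= box_volume.
Proof. by rewrite mulr_ge0// Rintegral_ge0// => s _; exact: prod_w_ge0. Qed.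

Lemma nm_cint_box a K : box_adm a -> 0 <= K ->
  (forall t, box bnd t -> nm (a t) <= K) -> (forall t, ~ box bnd t -> a t = 0) ->
  nm (cint ltup (fun s => a (row_tuple s))) <= K * box_volume.
Proof.
move=> [ma _] K0 aK a0.
apply: (le_trans (@nm_cint_le _ _ _ _ (fun s => K * \prod_i w i (tnth s i)) _ ma _ _)).
- move=> s; have [Bs|Bs] := pselect (box bnd (row_tuple s)).
    by apply: (le_trans (aK _ Bs)); rewrite ler_peMr// prod_w_ge1.
  by rewrite a0// nm0 mulr_ge0.
- exact: integrable_real_weights.
- have -> : \int[ltup]_s (K * \prod_i w i (tnth s i)) =
      K * \int[ltup]_s \prod_i w i (tnth s i).
    by rewrite (RintegralZl _ _ (integrable_prod_tuple hw)).
  by rewrite /box_volume mulrCA.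
Qed.

Lemma cintegrable_box a : box_adm a -> (forall t, ~ box bnd t -> a t = 0) ->
  cintegrable ltup (fun s => a (row_tuple s)).
Proof.
move=> [ma [K K0 aK]] a0.
apply: (@cintegrable_bounded_by _ _ _ _ (fun s => K * \prod_i w i (tnth s i)) _ ma).
- move=> s; have [Bs|Bs] := pselect (box bnd (row_tuple s)).
    by apply: (le_trans (aK _ Bs)); rewrite ler_peMr// prod_w_ge1.
  by rewrite a0// nm0 mulr_ge0.
- exact: integrable_real_weights.
Qed.

End BoxIntegrals.

(** * Moving the mollifier by the Cauchy-Riemann equations *)

Section CutoffIntegral.
Variables (R : realType) (d m : nat).
Local Notation C := (R[i]^o).
Local Notation Re := (@complex.Re R).
Local Notation Im := (@complex.Im R).
Local Notation par := 'rV[R]_(d + (m + m)).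
Local Notation N := (d + (m + m))%N.
Local Notation RM := (measurableTypeR R).
Local Notation ltup := (lebesgue_tuple R N).
Local Notation ix := (@ix d m).
Local Notation iu := (@iu d m).
Local Notation iv := (@iv d m).
Variable h : 'rV[R]_d -> 'rV[C]_m -> 'rV[R]_d.
Hypothesis hC1 : C1_graphing h.
Hypothesis hBG : bloom_graham h.
Let dh : forall t, differentiable (h_real h) t := hC1.1.
Variable eta : R -> R.
Hypothesis seta : smooth1 eta.
Hypothesis eta0 : forall x, x <= 0 -> eta x = 0.
Hypothesis eta1 : forall x, 1 <= x -> eta x = 1.
Variable M : R.
Hypothesis M1 : 1 <= M.
Hypothesis etaM : forall x, `|eta x| <= M /\ `|derive1 eta x| <= M.
Variables (W r0 r : R).
Hypothesis rr : 0 <= r.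
Hypothesis rW : 3 / 2 * (m%:R * (2 * r + 1) ^+ 2) <= W.
Hypothesis r0r : r + 2 <= r0.
Hypothesis r0W : 2 * (W + 1) <= (r0 - 1 - r) ^+ 2.
Implicit Types (t c : par) (tau : R) (z : 'rV[C]_(d + m)).

Local Notation lam := (lam hC1 W r0).
Local Notation xrad := (xrad hC1 W r0).
Local Notation crad := (crad hC1 W r0).
Local Notation kern := (kern hC1 W r0).
Local Notation kpeak := (kpeak hC1 W r0).
Local Notation kphase := (kphase hC1 W r0).
Local Notation cdisp := (cdisp hC1 W r0).
Local Notation Phi := (Phi hC1 eta W r0).
Local Notation moll := (moll eta).
Local Notation gm := (graph_map h).

Let W0 : 0 <= W.
Proof.
apply: le_trans rW; apply: mulr_ge0; first by rewrite divr_ge0.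
by rewrite mulr_ge0// sqr_ge0.
Qed.

Let r00 : 0 <= r0.
Proof. by apply: le_trans r0r; rewrite addr_ge0. Qed.

Definition bnd : 'I_N -> R := parcase xrad (fun=> r0) (fun=> r + 1).

Lemma r0_le_rad j : r0 <= xrad j.
Proof. exact: (@radius_mono _ _ _ _ hC1 W r0 W0 0). Qed.

Lemma r0_le_crad j : r0 <= crad j.
Proof. exact: (@radius_mono _ _ _ _ hC1 W r0 W0 0). Qed.

Lemma bnd_ge i : r + 1 <= bnd i.
Proof.
have r10 : r + 1 <= r0 by have := r0r; lra.
rewrite /bnd; elim/par_ind: i => [j|l|l]; rewrite (parcase_x, parcase_u, parcase_v)//.
exact: le_trans r10 (r0_le_rad j).
Qed.

Lemma box_bnd t : (forall i, `|t 0 i| <= r + 1) -> box bnd t.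
Proof. by move=> tr i; exact: le_trans (tr i) (bnd_ge i). Qed.

Lemma box_x t j : box bnd t -> `|t 0 (ix j)| <= xrad j.
Proof. by move=> /(_ (ix j)); rewrite /bnd parcase_x. Qed.
Lemma box_u t l : box bnd t -> `|t 0 (iu l)| <= r0.
Proof. by move=> /(_ (iu l)); rewrite /bnd parcase_u. Qed.
Lemma box_v t l : box bnd t -> `|t 0 (iv l)| <= r + 1.
Proof. by move=> /(_ (iv l)); rewrite /bnd parcase_v. Qed.

Lemma hclip_box j t : box bnd t -> hclip h (crad j) j t = h_real h t 0 j.
Proof.
move=> Bt; apply: hclip_id => // [k kj|l|l].
- apply: (le_trans (box_x k Bt)); exact: radius_mono.
- exact: le_trans (box_u l Bt) (r0_le_crad j).
- apply: (le_trans (box_v l Bt)); apply: le_trans (r0_le_crad j).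
  by have := r0r; lra.
Qed.

Lemma graph_disp_z t t' j : box bnd t -> box bnd t' ->
  (gm t - gm t') 0 (lshift m j) = cdisp t t' 0 (lshift m j).
Proof.
move=> Bt Bt'; rewrite cdisp_z !hclip_box// [LHS]mxE [X in _ + X]mxE !graph_map_z.
by apply: complex_ext; rewrite !ReImE.
Qed.

Lemma graph_disp_w t t' l : (gm t - gm t') 0 (rshift d l) =
  ((t 0 (iu l) - t' 0 (iu l)) +i* (t 0 (iv l) - t' 0 (iv l)))%C.
Proof.
rewrite [LHS]mxE [X in _ + X]mxE !graph_map_w.
by apply: complex_ext; rewrite !ReImE.
Qed.

(** No cutoff in v: a mollifier of width tau <= 1 centred within r already vanishes before r + 1. *)
Definition gcut t : R :=
  \prod_j cutoff eta (xrad j) (t 0 (ix j)) * \prod_l cutoff eta r0 (t 0 (iu l)).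

Lemma gcut1 t : (forall i, `|t 0 i| <= r + 1) -> gcut t = 1.
Proof.
have r2 : r + 1 <= r0 - 1 by have := r0r; lra.
move=> tr; rewrite /gcut !big1 ?mulr1// => j _; apply: cutoff1 => //.
  exact: le_trans (tr _) r2.
by apply: (le_trans (tr _)); apply: (le_trans r2); rewrite lerD2r r0_le_rad.
Qed.

Variables (fb : par -> C) (A : R).
Hypothesis mfb : cmfun (fun s : N.-tuple RM => fb (row_tuple s)).
Hypothesis fbA : forall t, nm (fb t) <= A.
Hypothesis fb0 : forall t, ~ box bnd t -> fb t = 0.

Let A0 : 0 <= A.
Proof. exact: le_trans (nm_ge0 _) (fbA 0). Qed.

(** The centre z of the Gaussian and the centre c of the mollifier are decoupled, so that c can move
    while z stays. *)
Definition Iker tau z c t : C :=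
  fb t * rc (gcut t) * kern tau (gm t - z) * rc (moll tau c t).

Definition Iint tau z c : C := cint ltup (fun s => Iker tau z c (row_tuple s)).

(** On the box [hclip] is the true h_j, and on the support of the mollifier |v - v0| <= 1, so
    clipping changes nothing; elsewhere both sides vanish. *)
Lemma Iker_Phi tau (t0 t : par) : 0 < tau <= 1 -> (forall i, `|t0 0 i| <= r) ->
  Iker tau (gm t0) t0 t = fb t * rc (gcut t) * Phi tau t0 t.
Proof.
move=> /andP[tau0 tau1] t0r; have Bt0 : box bnd t0.
  by apply: box_bnd => i; apply: (le_trans (t0r i)); rewrite lerDl.
have [Bt|Bt] := pselect (box bnd t); last by rewrite /Iker fb0// !mul0r.
rewrite /Iker /Phi [RHS]mulrA.
have [/existsP[l hl]|] := boolP [exists l, tau / 2 < `|t 0 (iv l) - t0 0 (iv l)|].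
  by rewrite (moll_eq0 seta eta0 eta1 tau0 hl) rc0 !mulr0.
rewrite negb_exists => /forallP hv; congr (_ * kern _ _ * _).
apply/rowP => i; case: (splitP i) => k ik.
  have -> : i = lshift m k by exact: val_inj.
  exact: graph_disp_z.
have -> : i = rshift d k by exact: val_inj.
rewrite graph_disp_w cdisp_w clip_id//.
by have := hv k; rewrite -leNgt => hk; apply: (le_trans hk); lra.
Qed.

Local Notation adm := (box_adm bnd).

Lemma adm_fb : adm fb.
Proof. by split => //; exists A. Qed.

Lemma adm_graph i : adm (fun t => gm t 0 i).
Proof.
case: (splitP i) => k ik.
  have -> : i = lshift m k by exact: val_inj.
  have -> : (fun t => gm t 0 (lshift m k)) =
      (fun t => rc (t 0 (ix k)) + ('i%C : C) * rc (h_real h t 0 k)).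
    apply/funext => t; rewrite graph_map_z; apply: complex_ext; rewrite !ReImE /=; ring.
  apply: box_admD; first exact: (@box_adm_coord R N bnd (fun x => x) _ (fun x => cvg_id)).
  apply: box_admM; first exact: box_adm_cst.
  apply: box_adm_continuous; exact: continuous_h_real.
have -> : i = rshift d k by exact: val_inj.
have -> : (fun t => gm t 0 (rshift d k)) =
    (fun t => rc (t 0 (iu k)) + ('i%C : C) * rc (t 0 (iv k))).
  apply/funext => t; rewrite graph_map_w; apply: complex_ext; rewrite !ReImE /=; ring.
apply: box_admD; first exact: (@box_adm_coord R N bnd (fun x => x) _ (fun x => cvg_id)).
apply: box_admM; first exact: box_adm_cst.
exact: (@box_adm_coord R N bnd (fun x => x) _ (fun x => cvg_id)).
Qed.

Lemma adm_kphase tau z : adm (fun t => kphase tau (gm t - z)).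
Proof.
apply: box_adm_sum => i; apply: box_admM; first exact: box_adm_cst.
have ai : adm (fun t => (gm t - z) 0 i).
  under eq_fun do rewrite mxE [X in _ + X]mxE.
  by apply: box_admD; [exact: adm_graph|exact: box_adm_cst].
exact: box_admM.
Qed.

Lemma adm_gcut : adm (fun t => rc (gcut t)).
Proof.
under eq_fun do rewrite /gcut rcM !rc_prod.
by apply: box_admM; apply: box_adm_prod => j; apply: box_adm_coord;
  exact: smooth1_continuous (smooth1_cutoff seta _).
Qed.

Lemma adm_moll tau c : adm (fun t => rc (moll tau c t)).
Proof.
under eq_fun do rewrite /moll rc_prod.
apply: box_adm_prod => l; apply: box_adm_coord.
exact: (smooth1_continuous (smooth1_derive1 (smooth1_step seta tau _))).
Qed.

Lemma cintegrable_Iker tau z c : cintegrable ltup (fun s => Iker tau z c (row_tuple s)).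
Proof.
apply: (@cintegrable_box _ _ bnd) => [|t Bt]; last by rewrite /Iker fb0// !mul0r.
apply: box_admM (adm_moll _ _); apply: box_admM.
  by apply: box_admM adm_gcut; exact: adm_fb.
under eq_fun do rewrite kernE.
apply: box_admM; first exact: box_adm_cst.
by apply: box_adm_cexp; exact: adm_kphase.
Qed.

Definition Lkphase tau z (p v : 'rV[C]_(d + m)) : C :=
  \sum_i rc (- (wt hC1 W r0 i / (2 * tau ^+ 2))) * (2 * (p 0 i - z 0 i) * v 0 i).

Let kphaseE tau z : (fun p => kphase tau (p - z)) = (fun p =>
  \sum_i rc (- (wt hC1 W r0 i / (2 * tau ^+ 2))) * ((p 0 i + - z 0 i) * (p 0 i + - z 0 i))).
Proof. by apply/funext => p; apply: eq_bigr => i _; rewrite mxE [X in _ + X]mxE expr2. Qed.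

Lemma rd_kphase tau z p v : rd (fun p => kphase tau (p - z)) p v (Lkphase tau z p v).
Proof.
rewrite kphaseE /Lkphase; apply: rd_sum => i.
have dc := rdD (rd_coord p v i) (rd_cst (- z 0 i) p v).
by apply: rd_eq (rdM (rd_cst _ p v) (rdM dc dc)) _; ring.
Qed.

Lemma L_kphase tau z p v : Lkphase tau z p ('i%C *: v) = 'i%C * Lkphase tau z p v.
Proof.
by rewrite /Lkphase mulr_sumr; apply: eq_bigr => i _; rewrite mxE; ring.
Qed.

Lemma smoothC_kphase tau z : smoothC (fun p => kphase tau (p - z)).
Proof.
rewrite kphaseE; apply: smoothC_sum => i; apply: smoothCM; first exact: smoothC_cst.
by apply: smoothCM; apply: smoothCD; [exact: smoothC_coord|exact: smoothC_cst|
  exact: smoothC_coord|exact: smoothC_cst].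
Qed.

(** The form in which the CR equations enter the estimates: on the parameter space, for the function
    [fb] extended by zero, with the supports of the bumps confined to the box. *)
Definition CR_tested (k : 'I_m) (c0 : C) := forall (al : 'I_N -> R -> R) (Q : 'rV[C]_(d + m) -> C)
    (L : 'rV[C]_(d + m) -> 'rV[C]_(d + m) -> C),
  (forall i, smooth1 (al i)) -> (forall t, ~ box bnd t -> bump_prod al t = 0) ->
  (forall p v, rd Q p v (L p v)) -> (forall p v, L p ('i%C *: v) = 'i%C * L p v) ->
  smoothC Q ->
  cint ltup (fun s => fb (row_tuple s) * (2^-1 * cexp (Q (gm (row_tuple s))) *
    ((rc (dbump al (iu k) (row_tuple s)) + 'i%C * rc (dbump al (iv k) (row_tuple s))) * c0 +
     \sum_j rc (dbump al (ix j) (row_tuple s)) * zcoef h k j (row_tuple s)))) = 0.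

Section Move.
Variables (k : 'I_m) (c0 : C).
Hypothesis c00 : c0 != 0.
Hypothesis fbCR : CR_tested k c0.

Definition stepdiff tau (a b : R) x : R := step eta tau b x + (- 1) * step eta tau a x.

Definition move_profile tau c c' : 'I_N -> R -> R := parcase
  (fun j => cutoff eta (xrad j)) (fun=> cutoff eta r0)
  (fun l => if l == k then stepdiff tau (c 0 (iv l)) (c' 0 (iv l))
            else mollifier eta tau (c 0 (iv l))).

Lemma derive1_stepdiff tau a b x :
  derive1 (stepdiff tau a b) x = mollifier eta tau b x - mollifier eta tau a x.
Proof.
have sd y : is_derive x (1 : R) (step eta tau y) (mollifier eta tau y x).
  exact: smooth1_rder (smooth1_step seta tau y).
rewrite (rder_derive1 (rderD (sd b) (rderM (rder_cst x (- 1)) (sd a)))).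
by rewrite mul0r add0r mulN1r.
Qed.

Lemma smooth1_move_profile tau c c' i : smooth1 (move_profile tau c c' i).
Proof.
rewrite /move_profile; elim/par_ind: i => [j|l|l]; rewrite (parcase_x, parcase_u, parcase_v).
- exact: smooth1_cutoff.
- exact: smooth1_cutoff.
- case: ifP => _; last exact: smooth1_derive1 (smooth1_step seta tau _).
  by apply: smooth1D; [|apply: smooth1M; [exact: smooth1_cst|]]; exact: smooth1_step.
Qed.

Lemma dbump_move_profile tau c c' t : (forall l, l != k -> c 0 (iv l) = c' 0 (iv l)) ->
  dbump (move_profile tau c c') (iv k) t = gcut t * (moll tau c' t - moll tau c t).
Proof.
move=> cc'; rewrite /dbump {1}/move_profile parcase_v eqxx derive1_stepdiff.
rewrite (@big_mkcond _ _ _ _ _ (fun l => l != iv k)) big_prod_par /=.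
under eq_bigr do rewrite ixvE /= /move_profile parcase_x.
under [X in _ * (_ * (X * _))]eq_bigr do rewrite iuvE /= /move_profile parcase_u.
under [X in _ * (_ * (_ * X))]eq_bigr do rewrite ivE /= /move_profile parcase_v.
rewrite -big_mkcond /=.
have mE (cc : par) : (forall l, l != k -> c 0 (iv l) = cc 0 (iv l)) -> moll tau cc t =
    mollifier eta tau (cc 0 (iv k)) (t 0 (iv k)) *
    \prod_(l | l != k) mollifier eta tau (c 0 (iv l)) (t 0 (iv l)).
  move=> ccc; rewrite /moll (bigD1 k)//=; congr (_ * _).
  by apply: eq_bigr => l lk; rewrite ccc.
rewrite (mE c')// (mE c)// /gcut.
set P := \prod_(i < d) _; set U := \prod_(i < m) _.
set V := \prod_(i < m | i != k) _.
have -> : \prod_(l | l != k) mollifier eta tau (c 0 (iv l)) (t 0 (iv l)) = V.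
  by apply: eq_bigr => l /negbTE ->.
ring.
Qed.

Lemma move_profile_out tau c c' t : 0 < tau <= 1 ->
  (forall l, `|c 0 (iv l)| <= r) -> (forall l, `|c' 0 (iv l)| <= r) ->
  ~ box bnd t -> bump_prod (move_profile tau c c') t = 0.
Proof.
move=> /andP[tau0 tau1] cr c'r Bt.
have [i bi] : exists i, ~ (`|t 0 i| <= bnd i) by apply/existsNP.
move/negP: bi; rewrite -ltNge /bump_prod (bigD1 i)//=.
suff H : (bnd i < `|t 0 i| -> move_profile tau c c' i (t 0 i) = 0).
  by move/H => ->; rewrite mul0r.
rewrite /bnd /move_profile; elim/par_ind: {Bt} i => [j|l|l]; rewrite !(parcase_x, parcase_u, parcase_v).
- by move=> tb; apply: (cutoff0 eta0); exact: ltW.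
- by move=> tb; apply: (cutoff0 eta0); exact: ltW.
move: (t 0 (iv l)) (cr l) (c'r l) => x; move: (c 0 _) (c' 0 _) => a b.
rewrite !ler_norml => /andP[a1 a2] /andP[b1 b2]; rewrite ltr_normr => xr.
case: ifP => _; last first.
  have [_ ->//] := mollifier_integral seta eta0 eta1 a tau0.
  by rewrite ltr_normr; case/orP: xr => xr; apply/orP; [left|right]; lra.
(* To the right of both centres the two steps are 1, to the left both are 0, so they cancel. *)
rewrite /stepdiff; case/orP: xr => xr.
  by rewrite !(step1 eta1 tau0) ?mulr1 ?subrr//; lra.
by rewrite !(step0 eta0 tau0) ?mulr0 ?addr0//; lra.
Qed.

(** In the box |v - v0| <= 2r + 1, so the v directions cost at most W by [rW]; a point where a
    cutoff in x or u is not 1 gains at least W + 1, through [rad_large] or [r0W]. *)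
Lemma phase_far tau t (t0 : par) : 0 < tau -> (forall i, `|t0 0 i| <= r) -> box bnd t ->
  (exists j, xrad j - 1 <= `|t 0 (ix j)|) \/ (exists l, r0 - 1 <= `|t 0 (iu l)|) ->
  Re (kphase tau (gm t - gm t0)) <= - (2 * tau ^+ 2)^-1.
Proof.
move=> tau0 t0r Bt far; have Bt0 : box bnd t0.
  by apply: box_bnd => i; apply: (le_trans (t0r i)); rewrite lerDl.
rewrite (@Re_kphase _ _ _ _ hC1 W r0 tau t t0 _ (fun l => t 0 (iv l) - t0 0 (iv l))); first last.
- by move=> l; exact: graph_disp_w.
- by move=> j; exact: graph_disp_z.
have := @phase_lower_bound _ _ _ _ hC1 hBG W r0 W0 r00 t t0
  (fun l => t 0 (iv l) - t0 0 (iv l)) (fun l => lexx _).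
set A' := (X in _ <= X -> _) => hA.
suff A1 : 1 <= A'.
  by rewrite mulNr lerN2 ler_peMr// invr_ge0 mulr_ge0// sqr_ge0.
apply: le_trans hA; set X := \sum_j _; set U := \sum_l _; set V := \sum_l _.
have X0 : 0 <= X.
  by apply: sumr_ge0 => j _; rewrite mulr_ge0 ?sqr_ge0// ltW// lam_gt0.
have U0 : 0 <= U by apply: sumr_ge0 => l _; exact: sqr_ge0.
have hV : V <= m%:R * (2 * r + 1) ^+ 2.
  rewrite mulr_natl -[in leRHS](card_ord m) -sumr_const; apply: ler_sum => l _.
  rewrite -(real_normK (num_real _)) lerXn2r ?nnegrE ?addr_ge0 ?mulr_ge0//.
  apply: (le_trans (ler_normB _ _)).
  have := box_v l Bt; have := t0r (iv l); lra.
have sqd (x y rho : R) : `|y| <= r -> rho - 1 <= `|x| -> 0 <= rho - 1 - r ->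
    (rho - 1 - r) ^+ 2 <= (x - y) ^+ 2.
  move=> yr xrho rho0; rewrite -(real_normK (num_real (x - y))) lerXn2r ?nnegrE//.
  by have := ler_normD (x - y) y; rewrite subrK; lra.
have far_le : W + 1 <= 2^-1 * X + 2^-1 * U.
  case: far => [[j hj]|[l hl]].
    have rj : 0 <= xrad j - 1 - r by have := r0_le_rad j; have := r0r; lra.
    apply: (le_trans (rad_large hC1 W0 j rr r0r)).
    have lj : lam j * (xrad j - 1 - r) ^+ 2 <= X.
      rewrite /X (bigD1 j)//= -[leLHS]addr0 lerD//.
        by rewrite ler_wpM2l ?(ltW (lam_gt0 _ _ _ _))//; exact: sqd.
      by apply: sumr_ge0 => i _; rewrite mulr_ge0 ?sqr_ge0// ltW// lam_gt0.
    by rewrite -mulrA; lra.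
  have rl : 0 <= r0 - 1 - r by have := r0r; lra.
  have lU : (r0 - 1 - r) ^+ 2 <= U.
    rewrite /U (bigD1 l)//= -[leLHS]addr0 lerD//; first exact: sqd.
    by apply: sumr_ge0 => i _; exact: sqr_ge0.
  by have := r0W; lra.
have := rW; lra.
Qed.

Lemma move_profile_bound tau c c' i x : 0 < tau <= 1 -> `|move_profile tau c c' i x| <= 2 * M ^+ 2 / tau.
Proof.
move=> /andP[tau0 tau1]; have ti : 1 <= tau^-1 by rewrite invf_ge1.
have M2 : M <= M ^+ 2 by rewrite expr2 ler_peMr// (le_trans _ M1).
have M20 : 0 <= M ^+ 2 by exact: sqr_ge0.
have le1 y : y <= 2 * M ^+ 2 -> y <= 2 * M ^+ 2 / tau.
  by move=> yM; apply: (le_trans yM); rewrite ler_peMr// mulr_ge0.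
rewrite /move_profile; elim/par_ind: i => [j|l|l]; rewrite (parcase_x, parcase_u, parcase_v).
- by apply: le1; have [cM _] := cutoff_bounded seta (xrad j) etaM x; lra.
- by apply: le1; have [cM _] := cutoff_bounded seta r0 etaM x; lra.
case: ifP => _; last first.
  apply: (le_trans (mollifier_bound seta _ _ tau0 etaM)).
  by rewrite ler_wpM2r ?invr_ge0 ?(ltW tau0)//; lra.
apply: le1; rewrite /stepdiff mulN1r; apply: (le_trans (ler_normB _ _)).
have [s1 _] := etaM (tau^-1 * x + (2^-1 - tau^-1 * c' 0 (iv l))).
have [s2 _] := etaM (tau^-1 * x + (2^-1 - tau^-1 * c 0 (iv l))).
by move: s1 s2; rewrite -!/(step _ _ _ _); lra.
Qed.

Lemma dbump_bound tau c c' i t (rho : R) : 0 < tau <= 1 ->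
  move_profile tau c c' i = cutoff eta rho ->
  `|dbump (move_profile tau c c') i t| <= (2 * M ^+ 2 / tau) ^+ N.
Proof.
move=> tau01 ai; have /andP[tau0 tau1] := tau01.
have ti : 1 <= tau^-1 by rewrite invf_ge1.
rewrite /dbump (@big_mkcond _ _ _ _ _ (fun l => l != i)) /=.
rewrite normrM normr_prod.
rewrite -[N in leRHS]card_ord -prodr_const [leRHS](bigD1 i)//=.
rewrite [X in _ * X](bigD1 i)//= eqxx /= normr1 mul1r.
apply: ler_pM => //; first by apply: prodr_ge0.
  rewrite ai; have [_ cM] := cutoff_bounded seta rho etaM (t 0 i).
  by apply: (le_trans cM); rewrite ler_peMr// mulr_ge0// sqr_ge0.
apply: ler_prod => l li; rewrite normr_ge0 li /=; exact: move_profile_bound.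
Qed.

Lemma nm_dbump_le tau c c' i t (t0 : par) (rho : R) : 0 < tau <= 1 ->
  (forall i, `|t0 0 i| <= r) -> box bnd t -> move_profile tau c c' i = cutoff eta rho ->
  (rho - 1 <= `|t 0 i| -> (exists j, xrad j - 1 <= `|t 0 (ix j)|) \/
     (exists l, r0 - 1 <= `|t 0 (iu l)|)) ->
  nm (cexp (kphase tau (gm t - gm t0)) * rc (dbump (move_profile tau c c') i t)) <=
  2 * expR (- (2 * tau ^+ 2)^-1) * (2 * M ^+ 2 / tau) ^+ N.
Proof.
move=> tau01 t0r Bt ai far; have /andP[tau0 tau1] := tau01.
have R0 : 0 <= (2 * M ^+ 2 / tau) ^+ N.
  by rewrite exprn_ge0// divr_ge0 ?(ltW tau0)// mulr_ge0// sqr_ge0.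
have [ti|ti] := ltP `|t 0 i| (rho - 1).
  rewrite /dbump ai (dcutoff0 eta1 ti) mul0r rc0 mulr0 nm0.
  by rewrite mulr_ge0// mulr_ge0// expR_ge0.
apply: (le_trans (nmM _ _)); rewrite nm_rc.
apply: ler_pM; rewrite ?nm_ge0//; last exact: dbump_bound ai.
apply: (le_trans (nm_cexp_le _)); rewrite ler_wpM2l// ler_expR.
by apply: phase_far => //; exact: far.
Qed.

(* The [v_k] derivative of the profile is the difference of the two mollifiers;
   every other derivative of it is supported far away in [x] or [u], where the
   Gaussian is exponentially small. *)
Lemma CR_move : exists2 K, 0 <= K & forall tau (t0 c c' : par), 0 < tau <= 1 ->
  (forall i, `|t0 0 i| <= r) ->
  (forall l, `|c 0 (iv l)| <= r) -> (forall l, `|c' 0 (iv l)| <= r) ->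
  (forall l, l != k -> c 0 (iv l) = c' 0 (iv l)) ->
  nm (Iint tau (gm t0) c' - Iint tau (gm t0) c) <=
  K * (tau ^- (N + (d + m)) * expR (- (2 * tau ^+ 2)^-1)).
Proof.
have [Z Z0 zZ] := nm_zcoef_bounded hC1 k (@compact_box R N bnd).
have kp1 := @kpeak_gt0 _ _ _ _ hC1 W r0 1 ltr01.
have M20 : 0 <= M ^+ 2 by exact: sqr_ge0.
pose Vol := box_volume bnd; have Vol0 : 0 <= Vol := box_volume_ge0 bnd.
pose K := kpeak 1 * (nm ('i%C : C) * nm c0^-1 *
  (A * (2 * (2 * M ^+ 2) ^+ N * (nm c0 + d%:R * Z)) * Vol)).
have K0 : 0 <= K.
  apply: mulr_ge0; first exact: ltW.
  apply: mulr_ge0; first by rewrite mulr_ge0 ?nm_ge0.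
  apply: mulr_ge0 => //; apply: mulr_ge0 => //; apply: mulr_ge0.
    by rewrite mulr_ge0// exprn_ge0// mulr_ge0.
  by rewrite addr_ge0 ?nm_ge0// mulr_ge0.
exists K => // tau t0 c c' tau01 t0r cr c'r cc'; have /andP[tau0 tau1] := tau01.
pose al := move_profile tau c c'; pose Q p := kphase tau (p - gm t0).
pose E := 2 * expR (- (2 * tau ^+ 2)^-1) * (2 * M ^+ 2 / tau) ^+ N.
have E0 : 0 <= E.
  apply: mulr_ge0; first by rewrite mulr_ge0// expR_ge0.
  by rewrite exprn_ge0// divr_ge0 ?(ltW tau0)// mulr_ge0.
pose Ut t := fb t * (cexp (Q (gm t)) * (rc (dbump al (iu k) t) * c0 +
  \sum_j rc (dbump al (ix j) t) * zcoef h k j t)).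
pose Vt t := fb t * (cexp (Q (gm t)) * rc (dbump al (iv k) t)).
have adm_Q : adm (fun t => cexp (Q (gm t))) by apply: box_adm_cexp; exact: adm_kphase.
have adm_dbump i : adm (fun t => rc (dbump al i t)).
  under eq_fun do rewrite /dbump rcM rc_prod; apply: box_admM.
    apply: box_adm_coord; apply: smooth1_continuous; apply: smooth1_derive1.
    exact: smooth1_move_profile.
  apply: box_adm_prod => l; apply: box_adm_coord; apply: smooth1_continuous.
  exact: smooth1_move_profile.
have adm_z j : adm (fun t => zcoef h k j t).
  split; first exact: cmfun_zcoef.
  by exists Z => // t; exact: zZ.
have adm_U : adm Ut.
  apply: box_admM; first exact: adm_fb.
  apply: box_admM => //; apply: box_admD.
    by apply: box_admM => //; exact: box_adm_cst.
  by apply: box_adm_sum => j; exact: box_admM.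
have adm_V : adm Vt.
  by apply: box_admM; [exact: adm_fb|exact: box_admM].
have iU : cintegrable ltup (fun s => Ut (row_tuple s)).
  by apply: (cintegrable_box adm_U) => t Bt; rewrite /Ut fb0// mul0r.
have iV : cintegrable ltup (fun s => Vt (row_tuple s)).
  by apply: (cintegrable_box adm_V) => t Bt; rewrite /Vt fb0// mul0r.
have := @fbCR al Q _ (smooth1_move_profile tau c c') (fun t => @move_profile_out tau c c' t tau01 cr c'r)
  (rd_kphase _ _) (L_kphase _ _) (smoothC_kphase _ _).
have -> : (fun s : N.-tuple RM => fb (row_tuple s) * (2^-1 * cexp (Q (gm (row_tuple s))) *
    ((rc (dbump al (iu k) (row_tuple s)) + 'i%C * rc (dbump al (iv k) (row_tuple s))) * c0 +
     \sum_j rc (dbump al (ix j) (row_tuple s)) * zcoef h k j (row_tuple s)))) =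
   (fun s => 2^-1 * Ut (row_tuple s) + 2^-1 * ('i%C * c0) * Vt (row_tuple s)).
  apply/funext => s; rewrite /Ut /Vt; ring.
rewrite cintD ?cintZ//; try exact: cintegrableZ.
move=> UV.
(* The identity reads U + i c0 V = 0 for the two integrals, and - 1/i = i. *)
have VU : cint ltup (fun s => Vt (row_tuple s)) =
    'i%C * c0^-1 * cint ltup (fun s => Ut (row_tuple s)).
  have i2 : ('i%C : C) * 'i%C = -1 by rewrite -expr2 sqr_i.
  have : 'i%C * c0 * cint ltup (fun s => Vt (row_tuple s)) =
      - cint ltup (fun s => Ut (row_tuple s)).
    apply/eqP; rewrite -subr_eq0 opprK addrC; apply/eqP.
    apply: (@mulfI _ (2^-1 : C)); first by rewrite invr_eq0 pnatr_eq0.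
    by rewrite mulr0 mulrDr mulrA.
  move=> iV'; apply: (@mulfI _ ('i%C * c0)).
    rewrite mulf_neq0//; apply/eqP => i0.
    by move: i2; rewrite i0 mul0r => /esym/eqP; rewrite oppr_eq0 oner_eq0.
  rewrite iV' -mulN1r -i2 !mulrA; congr (_ * _); rewrite -!mulrA; congr (_ * _).
  by rewrite mulrCA divff// mulr1.
have -> : Iint tau (gm t0) c' - Iint tau (gm t0) c =
    rc (kpeak tau) * cint ltup (fun s => Vt (row_tuple s)).
  rewrite -cintB; try exact: cintegrable_Iker.
  rewrite -cintZ//; congr (cint _ _); apply/funext => s.
  by rewrite /Iker /Vt dbump_move_profile// !kernE rcM rcD rcN /Q; ring.
have nU : nm (cint ltup (fun s => Ut (row_tuple s))) <=
    A * (E * (nm c0 + d%:R * Z)) * Vol.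
  apply: nm_cint_box => //; last by move=> t Bt; rewrite /Ut fb0// mul0r.
    apply: mulr_ge0 => //; apply: mulr_ge0 => //.
    by rewrite addr_ge0 ?nm_ge0// mulr_ge0.
  move=> t Bt; apply: (le_trans (nmM _ _)); apply: ler_pM; rewrite ?nm_ge0//.
  have dbE i rho : al i = cutoff eta rho ->
      (rho - 1 <= `|t 0 i| -> (exists j, xrad j - 1 <= `|t 0 (ix j)|) \/
       (exists l, r0 - 1 <= `|t 0 (iu l)|)) ->
      nm (cexp (Q (gm t)) * rc (dbump al i t)) <= E.
    by move=> ai far; exact: nm_dbump_le ai far.
  rewrite mulrDr mulrA mulr_sumr; apply: (le_trans (nmD _ _)).
  rewrite [leRHS]mulrDr; apply: lerD.
    apply: (le_trans (nmM _ _)); rewrite ler_wpM2r ?nm_ge0//.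
    apply: (dbE _ r0); first by rewrite /al /move_profile parcase_u.
    by move=> tu; right; exists k.
  apply: (le_trans (nm_sum _ _ _)).
  have -> : E * (d%:R * Z) = \sum_(j < d) E * Z.
    by rewrite sumr_const card_ord -[RHS]mulr_natl mulrCA.
  apply: ler_sum => j _; rewrite mulrA; apply: (le_trans (nmM _ _)).
  apply: ler_pM; rewrite ?nm_ge0 ?zZ//.
  apply: (dbE _ (xrad j)); first by rewrite /al /move_profile parcase_x.
  by move=> tx; left; exists j.
rewrite VU nm_scale gtr0_norm ?kpeak_gt0// kpeakE//.
apply: (@le_trans _ _ (tau ^- (d + m) * kpeak 1 * (nm ('i%C : C) * nm c0^-1 *
    (A * (E * (nm c0 + d%:R * Z)) * Vol)))).
  rewrite ler_wpM2l ?mulr_ge0 ?(ltW kp1) ?invr_ge0 ?exprn_ge0 ?(ltW tau0)//.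
  apply: (le_trans (nmM _ _)); apply: ler_pM; rewrite ?nm_ge0//; exact: nmM.
(* The N powers come from the factors of [dbump], the other d + m from the Gaussian peak. *)
have -> : tau ^- (N + (d + m)) = tau ^- N * tau ^- (d + m) by rewrite exprD invfM.
rewrite /K /E expr_div_n le_eqVlt; apply/orP; left; apply/eqP.
move: (_ ^+ N) (tau ^- N) (tau ^- (d + m)) (expR _) (nm _) (nm _) => *; ring.
Qed.

End Move.

Lemma Iint_v tau z c c' : (forall l, c 0 (iv l) = c' 0 (iv l)) ->
  Iint tau z c = Iint tau z c'.
Proof.
move=> cc'; congr (cint _ _); apply/funext => s; congr (_ * rc _).
by apply: eq_bigr => l _; rewrite cc'.
Qed.

Lemma CR_chain : (forall k, exists2 c0 : C, c0 != 0 & CR_tested k c0) ->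
  exists2 K, 0 <= K & forall tau (t0 : par), 0 < tau <= 1 ->
  (forall i, `|t0 0 i| <= r) ->
  nm (Iint tau (gm t0) t0 - Iint tau (gm t0) 0) <=
  K * (tau ^- (N + (d + m)) * expR (- (2 * tau ^+ 2)^-1)).
Proof.
move=> tested.
have moves k : exists2 K, 0 <= K & forall tau (t0 c c' : par), 0 < tau <= 1 ->
    (forall i, `|t0 0 i| <= r) ->
    (forall l, `|c 0 (iv l)| <= r) -> (forall l, `|c' 0 (iv l)| <= r) ->
    (forall l, l != k -> c 0 (iv l) = c' 0 (iv l)) ->
    nm (Iint tau (gm t0) c' - Iint tau (gm t0) c) <=
    K * (tau ^- (N + (d + m)) * expR (- (2 * tau ^+ 2)^-1)).
  by have [c0 c00 ct] := tested k; exact: CR_move ct.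
pose Kf k := sval (cid2 (moves k)).
have Kf0 k : 0 <= Kf k by rewrite /Kf; case: cid2.
pose S := \sum_k Kf k; have S0 : 0 <= S by exact: sumr_ge0.
exists (m%:R * S) => [|tau t0 tau01 t0r]; first by rewrite mulr_ge0.
have /andP[tau0 _] := tau01; set E := _ * expR _.
have E0 : 0 <= E by rewrite mulr_ge0 ?expR_ge0// invr_ge0 exprn_ge0// ltW.
(* Only the v coordinates of a mollifier centre matter, so the others are set to 0. *)
pose cc q : par := \row_i @parcase d m R (fun=> 0) (fun=> 0)
  (fun l => if (l < q)%N then t0 0 (iv l) else 0) i.
have ccv q l : cc q 0 (iv l) = if (l < q)%N then t0 0 (iv l) else 0.
  by rewrite mxE parcase_v.
have ccr q l : `|cc q 0 (iv l)| <= r by rewrite ccv; case: ifP; rewrite ?normr0.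
have step q : (q <= m)%N ->
    nm (Iint tau (gm t0) (cc q) - Iint tau (gm t0) (cc 0)) <= q%:R * (S * E).
  elim: q => [_|q ih qm]; first by rewrite subrr nm0 mul0r.
  have := ih (ltnW qm); have [_] := svalP (cid2 (moves (Ordinal qm))).
  move=> /(_ tau t0 (cc q) (cc q.+1) tau01 t0r (ccr q) (ccr q.+1)).
  rewrite -/(Kf _) => mv ihq.
  have {}mv : nm (Iint tau (gm t0) (cc q.+1) - Iint tau (gm t0) (cc q)) <= S * E.
    apply: le_trans (_ : Kf (Ordinal qm) * E <= _).
      apply: mv => l lq; rewrite !ccv ltnS [(l <= q)%N]leq_eqVlt.
      by have -> : (l == q :> nat) = false; [exact: negbTE lq|].
    by rewrite ler_wpM2r// /S (bigD1 (Ordinal qm))//= lerDl sumr_ge0.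
  have -> : Iint tau (gm t0) (cc q.+1) - Iint tau (gm t0) (cc 0) =
      (Iint tau (gm t0) (cc q.+1) - Iint tau (gm t0) (cc q)) +
      (Iint tau (gm t0) (cc q) - Iint tau (gm t0) (cc 0)) by rewrite subrKA.
  by apply: (le_trans (nmD _ _)); rewrite -natr1 mulrDl mul1r addrC lerD.
have := step m (leqnn m).
rewrite (@Iint_v tau _ (cc m) t0); last by move=> l; rewrite ccv ltn_ord.
rewrite (@Iint_v tau _ (cc 0) 0); last by move=> l; rewrite ccv mxE.
by rewrite mulrA.
Qed.

End CutoffIntegral.

(** * Integrals of kernels polynomial in z are entire *)

Section EntireKernels.
Variables (R : realType) (n q : nat) (bnd : 'I_n -> R).
Local Notation C := (R[i]^o).
Local Notation RM := (measurableTypeR R).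
Local Notation ltup := (lebesgue_tuple R n).
Local Notation adm := (box_adm bnd).
Implicit Types (t : 'rV[R]_n) (z : 'rV[C]_q) (a b : 'rV[R]_n -> C)
  (Q : 'rV[R]_n -> 'rV[C]_q -> C).

Lemma entire_cst (c : C) : entire (fun _ : 'rV[C]_q => c).
Proof. by move=> p; exact: differentiable_cst. Qed.

Lemma entire_coord i : entire (fun z : 'rV[C]_q => z 0 i).
Proof. by move=> p; exact: differentiable_coord. Qed.

Lemma entireD (f g : 'rV[C]_q -> C) : entire f -> entire g -> entire (fun z => f z + g z).
Proof. by move=> ef eg p; apply: differentiableD; [exact: ef|exact: eg]. Qed.

Lemma entireM (f g : 'rV[C]_q -> C) : entire f -> entire g -> entire (fun z => f z * g z).
Proof. by move=> ef eg p; apply: differentiableM; [exact: ef|exact: eg]. Qed.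

(** Polynomials in z whose coefficients are admissible functions of t. Integrating them in t only
    involves linearity, so no differentiation under the integral is needed. *)
Inductive poly_kernel : ('rV[R]_n -> 'rV[C]_q -> C) -> Prop :=
| poly_kernel_adm b : adm b -> poly_kernel (fun t _ => b t)
| poly_kernel_coord i : poly_kernel (fun _ z => z 0 i)
| poly_kernelD Q1 Q2 : poly_kernel Q1 -> poly_kernel Q2 ->
    poly_kernel (fun t z => Q1 t z + Q2 t z)
| poly_kernelM Q1 Q2 : poly_kernel Q1 -> poly_kernel Q2 ->
    poly_kernel (fun t z => Q1 t z * Q2 t z).

Lemma poly_kernel_sum I (s : seq I) (Q : I -> 'rV[R]_n -> 'rV[C]_q -> C) :
  (forall i, poly_kernel (Q i)) -> poly_kernel (fun t z => \sum_(i <- s) Q i t z).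
Proof.
move=> pQ; elim: s => [|i s ih].
  have -> : (fun t z => \sum_(i <- [::]) Q i t z) = (fun (_ : 'rV[R]_n) (_ : 'rV[C]_q) => (0 : C)).
    by apply/funext => t; apply/funext => z; rewrite big_nil.
  by apply: poly_kernel_adm; exact: box_adm_cst.
have -> : (fun t z => \sum_(i <- i :: s) Q i t z) = (fun t z => Q i t z + \sum_(i <- s) Q i t z).
  by apply/funext => t; apply/funext => z; rewrite big_cons.
exact: poly_kernelD.
Qed.

Lemma poly_kernelX Q k : poly_kernel Q -> poly_kernel (fun t z => Q t z ^+ k).
Proof.
move=> pQ; elim: k => [|k ih].
  by apply: (@poly_kernel_adm (fun=> 1)); exact: box_adm_cst.
have -> : (fun t z => Q t z ^+ k.+1) = (fun t z => Q t z * Q t z ^+ k).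
  by apply/funext => t; apply/funext => z; rewrite exprS.
exact: poly_kernelM.
Qed.

Lemma poly_kernel_box_adm Q z : poly_kernel Q -> adm (fun t => Q t z).
Proof.
elim=> {Q} [b //|i|Q1 Q2 _ h1 _ h2|Q1 Q2 _ h1 _ h2].
- exact: box_adm_cst.
- exact: box_admD.
- exact: box_admM.
Qed.

Let entire_kernel Q := (forall z, adm (fun t => Q t z)) /\
  forall a, adm a -> (forall t, ~ box bnd t -> a t = 0) ->
    entire (fun z => cint ltup (fun s => a (row_tuple s) * Q (row_tuple s) z)).

(** The integral of a product is not a product of integrals, hence the accumulator Q2: for a product
    Q1 Q1', the factor Q1' is moved into it. Factors depending on t alone go into the amplitude,
    over which [entire_kernel] quantifies. *)
Let entire_kernelM Q1 : poly_kernel Q1 -> forall Q2, entire_kernel Q2 ->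
  entire_kernel (fun t z => Q1 t z * Q2 t z).
Proof.
move=> pQ1 Q2 eQ2; split.
  by move=> z; apply: box_admM; [exact: poly_kernel_box_adm|case: eQ2].
elim: pQ1 Q2 eQ2 => {Q1} [b ab|i|Q1 Q1' p1 h1 p2 h2|Q1 Q1' p1 h1 p2 h2] Q2 eQ2 a aa a0.
- under eq_fun do under [X in cint _ X]eq_fun do rewrite mulrA.
  case: eQ2 => _ /(_ (fun t => a t * b t)); apply; first exact: box_admM.
  by move=> t Bt; rewrite a0// mul0r.
- have -> : (fun z : 'rV[C]_q => cint ltup (fun s => a (row_tuple s) *
      (z 0 i * Q2 (row_tuple s) z))) =
      (fun z => z 0 i * cint ltup (fun s => a (row_tuple s) * Q2 (row_tuple s) z)).
    apply/funext => z; rewrite -cintZ//.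
      by congr (cint _ _); apply/funext => s; rewrite mulrCA.
    apply: (@cintegrable_box _ _ bnd (fun t => a t * Q2 t z)).
      by apply: box_admM => //; case: eQ2.
    by move=> t Bt; rewrite a0// mul0r.
  by apply: entireM; [exact: entire_coord|case: eQ2 => _; apply].
- have -> : (fun z : 'rV[C]_q => cint ltup (fun s => a (row_tuple s) *
      ((Q1 (row_tuple s) z + Q1' (row_tuple s) z) * Q2 (row_tuple s) z))) =
      (fun z => cint ltup (fun s => a (row_tuple s) * (Q1 (row_tuple s) z * Q2 (row_tuple s) z)) +
        cint ltup (fun s => a (row_tuple s) * (Q1' (row_tuple s) z * Q2 (row_tuple s) z))).
    apply/funext => z; rewrite -cintD.
    + by congr (cint _ _); apply/funext => s; rewrite mulrDl mulrDr.
    + apply: (@cintegrable_box _ _ bnd (fun t => a t * (Q1 t z * Q2 t z))).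
        apply: box_admM => //; apply: box_admM; first exact: poly_kernel_box_adm.
        by case: eQ2.
      by move=> t Bt; rewrite a0// mul0r.
    + apply: (@cintegrable_box _ _ bnd (fun t => a t * (Q1' t z * Q2 t z))).
        apply: box_admM => //; apply: box_admM; first exact: poly_kernel_box_adm.
        by case: eQ2.
      by move=> t Bt; rewrite a0// mul0r.
  by apply: entireD; [exact: h1|exact: h2].
- under eq_fun do under [X in cint _ X]eq_fun do rewrite -[_ * _ * Q2 _ _]mulrA.
  apply: (h1 (fun t z => Q1' t z * Q2 t z)) => //; split; last exact: h2.
  by move=> z; apply: box_admM; [exact: poly_kernel_box_adm|case: eQ2].
Qed.

Lemma poly_kernel_entire Q a : poly_kernel Q -> adm a ->
  (forall t, ~ box bnd t -> a t = 0) ->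
  entire (fun z => cint ltup (fun s => a (row_tuple s) * Q (row_tuple s) z)).
Proof.
move=> pQ aa a0; have e1 : entire_kernel (fun _ _ => 1).
  split=> [z|b _ _]; first exact: box_adm_cst.
  by under eq_fun do under [X in cint _ X]eq_fun do rewrite mulr1; exact: entire_cst.
have [_ /(_ a aa a0)] := entire_kernelM pQ e1.
by under eq_fun do under [X in cint _ X]eq_fun do rewrite mulr1.
Qed.

End EntireKernels.

(** * Approximation by entire functions on the parameter space *)

Section EntireApproximation.
Variables (R : realType) (d m : nat).
Local Notation C := (R[i]^o).
Local Notation Re := (@complex.Re R).
Local Notation Im := (@complex.Im R).
Local Notation par := 'rV[R]_(d + (m + m)).
Local Notation N := (d + (m + m))%N.
Local Notation RM := (measurableTypeR R).
Local Notation ltup := (lebesgue_tuple R N).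
Local Notation ix := (@ix d m).
Local Notation iu := (@iu d m).
Local Notation iv := (@iv d m).
Variable h : 'rV[R]_d -> 'rV[C]_m -> 'rV[R]_d.
Hypothesis hC1 : C1_graphing h.
Hypothesis hBG : bloom_graham h.
Let dh : forall t, differentiable (h_real h) t := hC1.1.
Variable eta : R -> R.
Hypothesis seta : smooth1 eta.
Hypothesis eta0 : forall x, x <= 0 -> eta x = 0.
Hypothesis eta1 : forall x, 1 <= x -> eta x = 1.
Variable M : R.
Hypothesis M1 : 1 <= M.
Hypothesis etaM : forall x, `|eta x| <= M /\ `|derive1 eta x| <= M.
Variables (W r0 r : R).
Hypothesis rr : 0 <= r.
Hypothesis rW : 3 / 2 * (m%:R * (2 * r + 1) ^+ 2) <= W.
Hypothesis r0r : r + 2 <= r0.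
Hypothesis r0W : 2 * (W + 1) <= (r0 - 1 - r) ^+ 2.
Implicit Types (t c : par) (tau : R) (z : 'rV[C]_(d + m)).

Local Notation lam := (lam hC1 W r0).
Local Notation xrad := (xrad hC1 W r0).
Local Notation crad := (crad hC1 W r0).
Local Notation kern := (kern hC1 W r0).
Local Notation kpeak := (kpeak hC1 W r0).
Local Notation kphase := (kphase hC1 W r0).
Local Notation cdisp := (cdisp hC1 W r0).
Local Notation Phi := (Phi hC1 eta W r0).
Local Notation moll := (moll eta).
Local Notation gm := (graph_map h).

Let W0 : 0 <= W.
Proof.
apply: le_trans rW; apply: mulr_ge0; first by rewrite divr_ge0.
by rewrite mulr_ge0// sqr_ge0.
Qed.

Let r00 : 0 <= r0.
Proof. by apply: le_trans r0r; rewrite addr_ge0. Qed.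

Local Notation bnd := (bnd hC1 W r0 r).
Local Notation adm := (box_adm bnd).
Local Notation gcut := (gcut hC1 eta W r0).
Variables (fb : par -> C) (A : R).
Hypothesis mfb : cmfun (fun s : N.-tuple RM => fb (row_tuple s)).
Hypothesis fbA : forall t, nm (fb t) <= A.
Hypothesis fb0 : forall t, ~ box bnd t -> fb t = 0.
Local Notation Iint := (Iint hC1 eta W r0 fb).
Local Notation Iker := (Iker hC1 eta W r0 fb).
Local Notation CR_tested := (CR_tested hC1 W r0 r fb).

Let A0 : 0 <= A.
Proof. exact: le_trans (nm_ge0 _) (fbA 0). Qed.

Let box_r (t0 : par) : (forall i, `|t0 0 i| <= r) -> box bnd t0.
Proof.
move=> t0r; apply: (box_bnd hC1 rW r0r) => i.
by apply: (le_trans (t0r i)); rewrite lerDl.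
Qed.

Lemma nm_kphase_bounded tau : exists2 B, 0 <= B & forall t (t0 : par),
  box bnd t -> box bnd t0 -> nm (kphase tau (gm t - gm t0)) <= B.
Proof.
have gB i : exists2 G, 0 <= G & forall t, box bnd t -> nm (gm t 0 i) <= G.
  by have [] := adm_graph hC1 W r0 r i.
pose G i := sval (cid2 (gB i)).
have G0 i : 0 <= G i by rewrite /G; case: cid2.
have GE i t : box bnd t -> nm (gm t 0 i) <= G i by rewrite /G; case: cid2 => g g0 /= gE; exact: gE.
exists (\sum_i `|- (wt hC1 W r0 i / (2 * tau ^+ 2))| * (2 * G i) ^+ 2).
  by apply: sumr_ge0 => i _; rewrite mulr_ge0// sqr_ge0.
move=> t t0 Bt Bt0; apply: (le_trans (nm_sum _ _ _)); apply: ler_sum => i _.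
rewrite nm_scale ler_wpM2l// expr2 [leRHS]expr2; apply: (le_trans (nmM _ _)).
have dG : nm ((gm t - gm t0) 0 i) <= 2 * G i.
  rewrite mxE [X in _ + X]mxE; apply: (le_trans (nmD _ _)); rewrite nmN.
  by rewrite mulr_natl mulr2n lerD// GE.
by apply: ler_pM; rewrite ?nm_ge0.
Qed.

Lemma Iint_entire tau e : 0 < tau -> 0 < e ->
  exists2 F : 'rV[C]_(d + m) -> C, entire F & forall t0 : par,
    (forall i, `|t0 0 i| <= r) -> nm (F (gm t0) - Iint tau (gm t0) 0) <= e.
Proof.
move=> tau0 e0.
pose a t := fb t * rc (gcut t) * rc (kpeak tau) * rc (moll tau 0 t).
have aa : adm a.
  apply: box_admM (adm_moll hC1 seta W r0 r tau 0).
  apply: box_admM; last exact: box_adm_cst.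
  by apply: box_admM; [exact: (adm_fb hC1 W r0 r mfb fbA)|exact: adm_gcut].
have a0 t : ~ box bnd t -> a t = 0 by move=> Bt; rewrite /a fb0// !mul0r.
have [_ [Ka Ka0 aK]] := aa.
have [B B0 kB] := nm_kphase_bounded tau.
pose Vol := box_volume bnd; have Vol0 : 0 <= Vol := box_volume_ge0 bnd.
(* Ensures [Ka * e' * Vol <= e]; the two [+ 1] keep the denominator positive. *)
pose e' := e / ((Ka + 1) * (Vol + 1)).
have den0 : 0 < (Ka + 1) * (Vol + 1) by rewrite mulr_gt0 ?ltr_wpDl.
have e'0 : 0 < e' by rewrite divr_gt0.
(* One n serves all base points, since B bounds the phase for every pair of points of the box. *)
have [n hn] := cexp_approx B e'0.
pose Q t z := (1 + rc n.+1%:R^-1 * kphase tau (gm t - z)) ^+ n.+1.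
have pQ : poly_kernel bnd Q.
  apply: poly_kernelX; apply: poly_kernelD.
    by apply: (@poly_kernel_adm _ _ _ _ (fun=> 1)); exact: box_adm_cst.
  apply: poly_kernelM; first by apply: (@poly_kernel_adm _ _ _ _ (fun=> _)); exact: box_adm_cst.
  have -> : (fun t z => kphase tau (gm t - z)) = (fun t z =>
      \sum_i rc (- (wt hC1 W r0 i / (2 * tau ^+ 2))) *
        (gm t 0 i + (- 1) * z 0 i) ^+ 2).
    apply/funext => t; apply/funext => z; apply: eq_bigr => i _.
    by rewrite mxE [X in _ + X]mxE mulN1r.
  apply: poly_kernel_sum => i; apply: poly_kernelM.
    by apply: (@poly_kernel_adm _ _ _ _ (fun=> _)); exact: box_adm_cst.
  apply: poly_kernelX; apply: poly_kernelD.
    by apply: poly_kernel_adm; exact: adm_graph.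
  apply: poly_kernelM; last exact: poly_kernel_coord.
  by apply: (@poly_kernel_adm _ _ _ _ (fun=> _)); exact: box_adm_cst.
exists (fun z => cint ltup (fun s => a (row_tuple s) * Q (row_tuple s) z)).
  exact: (poly_kernel_entire pQ aa a0).
move=> t0 t0r; have Bt0 := box_r t0r.
have admQ z : adm (fun t => Q t z) by exact: poly_kernel_box_adm.
have admE z : adm (fun t => cexp (kphase tau (gm t - z))).
  by apply: box_adm_cexp; exact: adm_kphase.
have off (b : par -> C) t : ~ box bnd t -> a t * b t = 0.
  by move=> Bt; rewrite a0// mul0r.
have -> : Iint tau (gm t0) 0 = cint ltup (fun s => a (row_tuple s) *
    cexp (kphase tau (gm (row_tuple s) - gm t0))).
  by congr (cint _ _); apply/funext => s; rewrite /Iker /a kernE; ring.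
rewrite -cintB; first last.
- by apply: (@cintegrable_box _ _ bnd (fun t => a t * cexp (kphase tau (gm t - gm t0))));
    [exact: box_admM|exact: off].
- by apply: (@cintegrable_box _ _ bnd (fun t => a t * Q t (gm t0)));
    [exact: box_admM|exact: off].
have Kle : Ka * e' * Vol <= e.
  rewrite /e' -[leRHS](@divfK _ ((Ka + 1) * (Vol + 1))) ?gt_eqF//.
  rewrite mulrAC [leLHS]mulrC -!mulrA ler_wpM2l ?(ltW e0)//.
  rewrite ler_wpM2l ?invr_ge0 ?(ltW den0)//; apply: ler_pM => //; rewrite lerDl//.
apply: le_trans Kle; pose b t := a t * (Q t (gm t0) - cexp (kphase tau (gm t - gm t0))).
have -> : (fun s : N.-tuple RM => a (row_tuple s) * Q (row_tuple s) (gm t0) -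
    a (row_tuple s) * cexp (kphase tau (gm (row_tuple s) - gm t0))) =
    (fun s => b (row_tuple s)).
  by apply/funext => s; rewrite /b mulrBr.
apply: nm_cint_box; last exact: off.
- apply: box_admM => //; apply: box_admD => //.
  have -> : (fun t => - cexp (kphase tau (gm t - gm t0))) =
      (fun t => (- 1) * cexp (kphase tau (gm t - gm t0))).
    by apply/funext => t; rewrite mulN1r.
  by apply: box_admM => //; exact: box_adm_cst.
- by rewrite mulr_ge0// ltW.
move=> t Bt; apply: (le_trans (nmM _ _)); apply: ler_pM; rewrite ?nm_ge0 ?aK//.
by apply: hn; exact: kB.
Qed.

(** With x = c / tau^2, exp(-x) <= (P+1)! / x^(P+1) leaves tau^(P+2) times a constant, which is at
    most a constant times tau. *)
Lemma tau_small (P : nat) (c e : R) : 0 < c -> 0 < e ->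
  exists2 T : R, 0 < T <= 1 & forall tau, 0 < tau <= T ->
    tau ^- P * expR (- (c / tau ^+ 2)) <= e.
Proof.
move=> c0 e0; pose k := c ^+ P.+1 / (P.+1)`!%:R.
have k0 : 0 < k by rewrite divr_gt0 ?exprn_gt0// ltr0n fact_gt0.
exists (Num.min 1 (e * k)).
  by rewrite lt_min ltr01 mulr_gt0//= ge_min lexx.
move=> tau /andP[tau0]; rewrite le_min => /andP[tau1 tauk].
have x0 : 0 <= c / tau ^+ 2 by rewrite divr_ge0 ?(ltW c0)// sqr_ge0.
have := expR_powD_le P.+1 x0 => h1.
have f0 : 0 < (P.+1)`!%:R :> R by rewrite ltr0n fact_gt0.
have p0 : 0 < (c / tau ^+ 2) ^+ P.+1 by rewrite exprn_gt0// divr_gt0// exprn_gt0.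
have h2 : expR (- (c / tau ^+ 2)) <= (P.+1)`!%:R / (c / tau ^+ 2) ^+ P.+1.
  by rewrite expRN ler_pdivlMr// mulrC ler_pdivrMr ?expR_gt0.
apply: (@le_trans _ _ (tau ^- P * ((P.+1)`!%:R / (c / tau ^+ 2) ^+ P.+1))).
  by rewrite ler_wpM2l// invr_ge0 exprn_ge0// ltW.
have -> : tau ^- P * ((P.+1)`!%:R / (c / tau ^+ 2) ^+ P.+1) =
    tau ^+ P.+1 * tau / k.
  rewrite expr_div_n exprAC /k [tau ^+ P.+1]exprSr.
  have y0 : tau ^+ P != 0 by rewrite expf_neq0// gt_eqF.
  have cP0 : c ^+ P.+1 != 0 by rewrite expf_neq0// gt_eqF.
  move: (tau ^+ P) (c ^+ P.+1) y0 cP0 => y cP y0 cP0; field.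
  by rewrite y0 cP0 !gt_eqF.
rewrite ler_pdivrMr//; apply: le_trans tauk.
by rewrite ler_piMl ?(ltW tau0)// exprn_ile1// ltW.
Qed.

Hypothesis tested : forall k, exists2 c0 : C, c0 != 0 & CR_tested k c0.
Hypothesis fb_modulus : forall e, 0 < e -> exists2 dl, 0 < dl &
  forall t (t0 : par), (forall i, `|t0 0 i| <= r) -> sqdist t t0 < dl ^+ 2 ->
  nm (fb t * rc (gcut t) - fb t0) <= e.

Lemma entire_approximation e : 0 < e ->
  exists2 F : 'rV[C]_(d + m) -> C, entire F & forall t0 : par,
    (forall i, `|t0 0 i| <= r) -> nm (F (gm t0) - fb t0) <= e.
Proof.
move=> e0.
have [Kc Kc0 chain] := CR_chain hBG seta eta0 eta1 M1 etaM rr rW r0r r0W mfb fbA fb0 tested.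
have Kp0 := Kphi_ge0 hC1 M1 W r0.
set Kp := Kphi hC1 M W r0 in Kp0.
have [ma [G G0 fgG]] := box_admM (adm_fb hC1 W r0 r mfb fbA) (adm_gcut hC1 seta W r0 r).
have FG t : nm (fb t * rc (gcut t)) <= G.
  have [Bt|Bt] := pselect (box bnd t); first exact: fgG.
  by rewrite fb0// mul0r nm0.
(* [approximate_identity] will give 2 Kp (e1 + e1) = 4 Kp e1, which is then at most e / 3, one third
   of the budget. *)
pose e1 := e / 6 / (2 * Kp + 1).
have kp : 0 < 2 * Kp + 1 by rewrite ltr_wpDl// mulr_ge0.
have e10 : 0 < e1 by rewrite divr_gt0// divr_gt0.
have [dl dl0 mod1] := fb_modulus e10.
have k0 := @kappa_gt0 _ _ _ _ hC1 W r0; set kap := kappa hC1 W r0 in k0.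
have c1 : 0 < kap / 4 * dl ^+ 2 by rewrite mulr_gt0 ?exprn_gt0// divr_gt0.
pose e2 := e1 / (G + A + 1).
have GA : 0 < G + A + 1 by rewrite ltr_wpDl// addr_ge0.
have e20 : 0 < e2 by rewrite divr_gt0.
pose e3 := e / 3 / (Kc + 1).
have Kc1 : 0 < Kc + 1 by rewrite ltr_wpDl.
have e30 : 0 < e3 by rewrite divr_gt0// divr_gt0.
(* Two smallness conditions on tau: the Gaussian mass beyond distance dl, and the cost of moving the
   mollifier. *)
have [T1 /andP[T10 T11] small1] := tau_small 0 c1 e20.
have h20 : 0 < 2^-1 :> R by rewrite invr_gt0.
have [T2 /andP[T20 T21] small2] := tau_small (N + (d + m)) h20 e30.
pose tau := Num.min T1 T2.
have tau0 : 0 < tau by rewrite lt_min T10.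
have tau1 : tau <= 1 by rewrite ge_min T11.
have tau01 : 0 < tau <= 1 by rewrite tau0.
have {}small1 : expR (- (kap / (4 * tau ^+ 2) * dl ^+ 2)) <= e2.
  have := small1 tau; rewrite tau0 ge_min lexx => /(_ isT).
  rewrite expr0 invr1 mul1r; apply: le_trans; rewrite ler_expR lerN2 le_eqVlt.
  by apply/orP; left; apply/eqP; field; rewrite gt_eqF.
have {}small2 : tau ^- (N + (d + m)) * expR (- (2 * tau ^+ 2)^-1) <= e3.
  have := small2 tau; rewrite tau0 ge_min lexx orbT => /(_ isT).
  by rewrite [(2 * _)^-1]invfM.
have e31 : 0 < e / 3 by rewrite divr_gt0.
have [F eF FI] := Iint_entire tau0 e31.
exists F => // t0 t0r; have Bt0 := box_r t0r.
have gm0 : nm (Iint tau (gm t0) t0 - fb t0) <= e / 3.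
  have -> : Iint tau (gm t0) t0 = cint ltup (fun s =>
      (fb (row_tuple s) * rc (gcut (row_tuple s))) * Phi tau t0 (row_tuple s)).
    congr (cint _ _); apply/funext => s.
    exact: (Iker_Phi hBG seta eta0 eta1 rW r0r fb0).
  have := approximate_identity hC1 hBG seta eta0 eta1 M1 etaM W0 r00 tau0 ma FG
    (ltW e10) (fun t => @mod1 t t0 t0r).
  rewrite -/Kp -/kap => ai; apply: (le_trans ai).
  have E2 : (G + nm (fb t0)) * expR (- (kap / (4 * tau ^+ 2) * dl ^+ 2)) <= e1.
    apply: (@le_trans _ _ ((G + A + 1) * e2)); last by rewrite mulrC divfK// gt_eqF.
    apply: ler_pM => //; rewrite ?addr_ge0 ?nm_ge0 ?expR_ge0//.
    by rewrite -addrA lerD2l (le_trans (fbA t0))// lerDl.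
  have h1 : Kp * (e1 + (G + nm (fb t0)) * expR (- (kap / (4 * tau ^+ 2) * dl ^+ 2))) <=
      Kp * (e1 + e1) by rewrite ler_wpM2l// lerD2l.
  apply: (@le_trans _ _ (2 * (Kp * (e1 + e1)))); first by rewrite ler_wpM2l.
  have : (2 * Kp + 1) * e1 = e / 6 by rewrite /e1 mulrC divfK// gt_eqF.
  by move: e10 => /ltW; move: (Kp * e1) => *; nra.
have mv : nm (Iint tau (gm t0) t0 - Iint tau (gm t0) 0) <= e / 3.
  apply: (le_trans (chain tau t0 tau01 t0r)).
  apply: (@le_trans _ _ ((Kc + 1) * e3)); last by rewrite mulrC divfK// gt_eqF.
  apply: ler_pM => //; last by rewrite lerDl.
  by rewrite mulr_ge0 ?expR_ge0// invr_ge0 exprn_ge0// ltW.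
have split3 (x y z w : C) : x - w = (x - z) + (- (y - z) + (y - w)) by ring.
rewrite (split3 _ (Iint tau (gm t0) t0) (Iint tau (gm t0) 0)).
apply: (le_trans (nmD _ _)); have := FI t0 t0r.
have := nmD (- (Iint tau (gm t0) t0 - Iint tau (gm t0) 0)) (Iint tau (gm t0) t0 - fb t0).
by rewrite nmN; lra.
Qed.

End EntireApproximation.

(** * The graph as a parametrised space and the truncation of f *)

Section GraphTopology.
Variables (R : realType) (d m : nat).
Local Notation C := (R[i]^o).
Local Notation Re := (@complex.Re R).
Local Notation Im := (@complex.Im R).
Local Notation par := 'rV[R]_(d + (m + m)).
Local Notation N := (d + (m + m))%N.
Local Notation RM := (measurableTypeR R).
Local Notation ltup := (lebesgue_tuple R N).
Local Notation ix := (@ix d m).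
Local Notation iu := (@iu d m).
Local Notation iv := (@iv d m).
Variable h : 'rV[R]_d -> 'rV[C]_m -> 'rV[R]_d.
Hypothesis hC1 : C1_graphing h.
Let dh : forall t, differentiable (h_real h) t := hC1.1.
Implicit Types (t : par) (p : 'rV[C]_(d + m)).
Local Notation gm := (graph_map h).

Lemma graph_map_in t : model_graph h (gm t).
Proof.
move=> j; rewrite graph_map_z /= /h_real; congr (h _ _ 0 j).
  by apply/rowP => k; rewrite [RHS]mxE graph_map_z /= mxE.
by rewrite /graph_map row_mxKr.
Qed.

Lemma graph_map_par_of p : model_graph h p -> gm (par_of p) = p.
Proof.
move=> Mp; have px : par_x (par_of p) = \row_k Re (p 0 (lshift m k)).
  by apply/rowP => k; rewrite [LHS]mxE [RHS]mxE -[LHS]/(par_of p 0 (ix k)) par_of_x.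
have pw : par_w (par_of p) = rsubmx p.
  apply/rowP => l; rewrite [RHS]mxE.
  transitivity (gm (par_of p) 0 (rshift d l)); first by rewrite /graph_map row_mxEr.
  by rewrite graph_map_w par_of_u par_of_v; apply: complex_ext.
apply/rowP => i; case: (splitP i) => k ik.
  have -> : i = lshift m k by exact: val_inj.
  rewrite graph_map_z par_of_x; apply: complex_ext => //=.
  by rewrite Mp /h_real px pw.
have -> : i = rshift d k by exact: val_inj.
by rewrite graph_map_w par_of_u par_of_v; apply: complex_ext.
Qed.

Lemma continuous_graph_map : continuous gm.
Proof.
move=> t B [P nP PB].
have : \forall t' \near t, forall i : 'I_(d + m), P 0 i (gm t' 0 i).
  apply: (@filter_forall par 'I_(d + m) (fun i t' => P 0 i (gm t' 0 i)) (nbhs t)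
    (nbhs_filter t)) => i; suff : (fun t' => gm t' 0 i) @ nbhs t --> gm t 0 i.
    by apply; exact: nP.
  case: (splitP i) => k ik.
    have -> : i = lshift m k by exact: val_inj.
    apply: cvg_complex.
      under eq_fun do rewrite graph_map_z /=; rewrite graph_map_z /=.
      exact: (@coord_continuous _ _ _ 0 (ix k) t).
    under eq_fun do rewrite graph_map_z /=; rewrite graph_map_z /=.
    exact: continuous_h_real.
  have -> : i = rshift d k by exact: val_inj.
  apply: cvg_complex; under eq_fun do rewrite graph_map_w /=; rewrite graph_map_w /=.
    exact: (@coord_continuous _ _ _ 0 (iu k) t).
  exact: (@coord_continuous _ _ _ 0 (iv k) t).
by apply: filterS => t' Pt'; apply: PB => i j; rewrite (ord1 i).
Qed.

Lemma par_of_bounded (K : set 'rV[C]_(d + m)) : compact K ->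
  exists2 r, 0 <= r & forall p i, K p -> `|par_of p 0 i| <= r.
Proof.
move=> cK.
have bounded i : exists2 B, 0 <= B & forall p, K p -> `|par_of p 0 i| <= B.
  apply: compact_continuous_bounded => // p _.
  have cp k : (fun q : 'rV[C]_(d + m) => q 0 k : C) @ nbhs p --> p 0 k.
    exact: (@coord_continuous _ _ _ 0 k p).
  suff : (fun q => par_of q 0 i) @ nbhs p --> par_of p 0 i by [].
  elim/par_ind: i => [j|l|l].
  - rewrite par_of_x; have -> : (fun q => par_of q 0 (ix j)) = (fun q => Re (q 0 (lshift m j))).
      by apply/funext => q; rewrite par_of_x.
    by have [] := cvg_Re (cp (lshift m j)).
  - rewrite par_of_u; have -> : (fun q => par_of q 0 (iu l)) = (fun q => Re (q 0 (rshift d l))).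
      by apply/funext => q; rewrite par_of_u.
    by have [] := cvg_Re (cp (rshift d l)).
  - rewrite par_of_v; have -> : (fun q => par_of q 0 (iv l)) = (fun q => Im (q 0 (rshift d l))).
      by apply/funext => q; rewrite par_of_v.
    by have [] := cvg_Re (cp (rshift d l)).
pose B i := sval (cid2 (bounded i)).
have B0 i : 0 <= B i by rewrite /B; case: cid2.
have BE i p : K p -> `|par_of p 0 i| <= B i.
  by rewrite /B; case: cid2 => b b0 /= bE; exact: bE.
exists (\sum_i B i) => [|p i Kp]; first exact: sumr_ge0.
by apply: (le_trans (BE i p Kp)); rewrite (bigD1 i)//= lerDl sumr_ge0.
Qed.

Section OpenSubset.
Variables (V : set 'rV[C]_(d + m)) (f : 'rV[C]_(d + m) -> C).
Hypothesis oV : open V.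
Local Notation omega := (model_graph h `&` V).
Hypothesis fCR : continuous_CR h omega f.

(** Continuity of f is relative to omega, but the parametrisation takes its values in the graph, so
    the composite is continuous in the ordinary sense wherever it lands in V. *)
Lemma continuous_on_graph t : V (gm t) -> {for t, continuous (f \o gm)}.
Proof.
move=> Vt; have [/subspace_continuousP cf _] := fCR.
have {}cf := cf (gm t) (conj (graph_map_in t) Vt).
move=> B /cf fB; have ct := @continuous_graph_map t.
have nV : nbhs (gm t) V by apply: open_nbhs_nbhs; split.
have nB : nbhs t (fun t' => omega (gm t') -> B (f (gm t'))) := ct _ fB.
have nVg : nbhs t (fun t' => V (gm t')) := ct _ nV.
apply: (@filterS par (nbhs t) (nbhs_filter t) _ _ _ (filterI nB nVg)) => t' [h1 h2].
by apply: h1; split => //; exact: graph_map_in.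
Qed.

Variable b : 'I_N -> R.
Hypothesis bV : forall t, box b t -> V (gm t).

(** Nothing is known of f off omega, not even measurability, while the integrals run over the whole
    parameter space; hence the extension by zero. *)
Definition on_box : par -> C := patch (fun=> 0) (box b) (f \o gm).

Lemma on_box_in t : box b t -> on_box t = f (gm t).
Proof. by move=> bt; rewrite /on_box patchT// inE. Qed.

Lemma on_box_out t : ~ box b t -> on_box t = 0.
Proof. by move=> bt; rewrite /on_box patchC// inE. Qed.

Lemma measurable_box : measurable (@row_tuple R N @^-1` box b).
Proof.
rewrite -[X in measurable X]setCK; apply: measurableC.
rewrite preimage_setC; apply: measurable_open_row_tuple.
by rewrite openC; exact: closed_box.
Qed.

Lemma cmfun_on_box : cmfun (fun s : N.-tuple RM => on_box (row_tuple s)).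
Proof.
have oD : open (gm @^-1` V).
  by apply: open_comp => // t _; exact: continuous_graph_map.
have mf (g : C -> R) : g 0 = 0 ->
    (forall t, V (gm t) -> {for t, continuous (g \o (f \o gm))}) ->
    measurable_fun setT (fun s : N.-tuple RM => g (on_box (row_tuple s))).
  move=> g0 cg.
  have -> : (fun s : N.-tuple RM => g (on_box (row_tuple s))) =
      (fun s => g (f (gm (row_tuple s)))) \_ (@row_tuple R N @^-1` box b).
    apply/funext => s; have [Bs|Bs] := pselect (box b (row_tuple s)).
      by rewrite on_box_in// patchT// inE.
    by rewrite on_box_out// patchC ?inE.
  apply/(measurable_restrictT _ measurable_box).
  apply: (@measurable_funS _ _ _ _ (@row_tuple R N @^-1` (gm @^-1` V))).
  - exact: measurable_open_row_tuple.
  - by move=> s /bV.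
  - exact: (@measurable_row_tuple_in R N (gm @^-1` V) (g \o (f \o gm))).
split; apply: mf => // t Vt; have [] := cvg_Re (continuous_on_graph Vt) => //.
Qed.

Lemma on_box_bounded : exists A, forall t, nm (on_box t) <= A.
Proof.
have [A A0 fA] : exists2 A, 0 <= A & forall t, box b t -> `|nm (f (gm t))| <= A.
  apply: compact_continuous_bounded; first exact: compact_box.
  move=> t Bt; have [cR cI] := cvg_Re (continuous_on_graph (bV Bt)).
  exact: (@cvgD R R^o par (nbhs t) (nbhs_filter t) _ _ _ _
    (@cvg_norm R R^o par (nbhs t) (nbhs_filter t) _ _ cR)
    (@cvg_norm R R^o par (nbhs t) (nbhs_filter t) _ _ cI)).
exists A => t; have [Bt|Bt] := pselect (box b t).
  by rewrite on_box_in//; exact: le_trans (ler_norm _) (fA _ Bt).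
by rewrite on_box_out// nm0.
Qed.

(** Only the product is known to vanish outside the box, not a given factor. If the other factors at
    t have a nonzero product, then [al i] vanishes on the open set of values that keep the point
    outside the box, and so does its derivative. *)
Lemma dbump_out (al : 'I_N -> R -> R) i t : (forall t', ~ box b t' -> bump_prod al t' = 0) ->
  ~ box b t -> dbump al i t = 0.
Proof.
move=> al0 Bt; rewrite /dbump; set P := \prod_(l | _) _.
have [->|P0] := eqVneq P 0; first by rewrite mulr0.
have [l bl] : exists l, ~ (`|t 0 l| <= b l) by apply/existsNP.
pose U := [set x : R | l != i \/ b i < `|x|].
have oU : open U.
  have [li|li] := eqVneq l i; last first.
    have -> : U = setT by apply/seteqP; split => // x _; left.
    exact: openT.
  have -> : U = [set x | b i < `|x|].
    by apply/seteqP; split => x /=; [case=> //; rewrite li eqxx|right].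
  apply: (@open_comp _ _ (fun x : R => `|x|) [set y | b i < y]).
    by move=> x _; exact: norm_continuous.
  exact: open_gt.
have Ut : U (t 0 i).
  have [li|li] := eqVneq l i; [right|left] => //.
  by rewrite -li ltNge; exact/negP.
rewrite (derive1_locally_const oU Ut (c := 0)) ?mul0r// => x Ux.
apply/eqP; rewrite -(mulIr_eq0 _ (mulIf P0)); apply/eqP.
pose t' : par := \row_k if k == i then x else t 0 k.
have -> : al i x * P = bump_prod al t'.
  rewrite /bump_prod (bigD1 i)//= mxE eqxx; congr (_ * _).
  by apply: eq_bigr => k ki; rewrite mxE (negbTE ki).
apply: al0 => /(_ l); rewrite mxE; case: ifP => [/eqP li|_ //].
by case: Ux => [|bx]; rewrite ?li ?eqxx// leNgt -li; rewrite li bx.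
Qed.

End OpenSubset.
End GraphTopology.

(** * Conclusion: the compact set K' and the approximating sequence *)

Section Approximation.
Variables (R : realType) (d m : nat).
Local Notation C := (R[i]^o).
Local Notation par := 'rV[R]_(d + (m + m)).
Local Notation N := (d + (m + m))%N.
Local Notation RM := (measurableTypeR R).
Local Notation ltup := (lebesgue_tuple R N).
Variable h : 'rV[R]_d -> 'rV[C]_m -> 'rV[R]_d.
Hypothesis hC1 : C1_graphing h.
Hypothesis hBG : bloom_graham h.
Let dh : forall t, differentiable (h_real h) t := hC1.1.
Implicit Types (t : par) (p : 'rV[C]_(d + m)).
Local Notation gm := (graph_map h).

Lemma cplx_Rintegral_box (b : 'I_N -> R) (D : set par) (F G : par -> C) :
  box b `<=` D -> (forall t, box b t -> F t = G t) ->
  (forall t, ~ box b t -> F t = 0) -> (forall t, ~ box b t -> G t = 0) ->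
  cplx_Rintegral D F = cint ltup (fun s => G (row_tuple s)).
Proof.
move=> bD FG F0 G0; have E (g : C -> R) : g 0 = 0 ->
    \int[ltup]_(s in @row_tuple R N @^-1` D) g (F (row_tuple s)) =
    \int[ltup]_s g (G (row_tuple s)).
  move=> g0; rewrite Rintegral_mkcond; apply: eq_Rintegral => s _; rewrite /patch.
  have [bs|bs] := pselect (box b (row_tuple s)).
    by rewrite mem_set ?FG//; exact: bD.
  by rewrite F0// G0// g0; case: ifP.
by rewrite /cplx_Rintegral /cint; congr (_ +i* _)%C; exact: E.
Qed.

Section Tested.
Variables (W r0 r : R) (V : set 'rV[C]_(d + m)) (f : 'rV[C]_(d + m) -> C).
Local Notation bnd := (bnd hC1 W r0 r).
Local Notation omega := (model_graph h `&` V).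
Hypothesis fCR : continuous_CR h omega f.
Hypothesis bV : forall t, box bnd t -> V (gm t).

Lemma on_box_tested k : exists2 c0 : C, c0 != 0 &
  CR_tested hC1 W r0 r (on_box h f bnd) k c0.
Proof.
have [c0 c00 c0E] := wedge_test_const dh hBG k; exists c0 => //.
move=> al Q L sal al0 rdQ holQ sQ.
have d0 i t := dbump_out i al0 (t := t).
(* Both integrands vanish outside the box, so f may be replaced by its truncation. *)
rewrite -(@cplx_Rintegral_box bnd (gm @^-1` omega) (fun t => f (gm t) *
  (2^-1 * cexp (Q (gm t)) * ((rc (dbump al (iu d k) t) + 'i%C * rc (dbump al (iv d k) t)) * c0 +
  \sum_j rc (dbump al (ix m j) t) * zcoef h k j t)))
  (fun t => on_box h f bnd t *
  (2^-1 * cexp (Q (gm t)) * ((rc (dbump al (iu d k) t) + 'i%C * rc (dbump al (iv d k) t)) * c0 +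
  \sum_j rc (dbump al (ix m j) t) * zcoef h k j t)))).
- apply: (CR_identity sal rdQ holQ sQ c0E fCR (S := gm @` box bnd)).
  + apply: continuous_compact; last exact: compact_box.
    by apply: continuous_subspaceT; exact: continuous_graph_map.
  + by move=> _ [t Bt <-]; split; [exact: graph_map_in|exact: bV].
  + by move=> t nS; apply: al0 => Bt; apply: nS; exists t.
- by move=> t Bt; split; [exact: graph_map_in|exact: bV].
- by move=> t Bt; rewrite on_box_in.
- move=> t Bt; rewrite !d0// rc0 mulr0 add0r mul0r add0r big1 ?mulr0// => j _.
  by rewrite d0// rc0 mul0r.
- by move=> t Bt; rewrite on_box_out// mul0r.
Qed.

End Tested.

Lemma approximation_on_graph (K : set 'rV[C]_(d + m)) : compact K ->
  K `<=` model_graph h -> exists K' : set 'rV[C]_(d + m),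
  [/\ compact K', K' `<=` model_graph h, K `<=` K' &
    forall (omega : set 'rV[C]_(d + m)) (f : 'rV[C]_(d + m) -> C),
      graph_open h omega -> K' `<=` omega -> continuous_CR h omega f ->
      forall e, 0 < e -> exists2 F : 'rV[C]_(d + m) -> C, entire F &
        forall p, K p -> nm (F p - f p) <= e].
Proof.
move=> cK KM; have [r rr rK] := par_of_bounded cK.
have [eta [seta eta0 eta1]] := smooth_step R.
have [M M1 etaM] := eta_bounded seta eta0 eta1.
(* W is the largest loss in the v directions over the box; r0 gives r0 - 1 - r = 1 + 2 (W + 1),
   whose square exceeds 2 (W + 1). *)
pose W : R := 3 / 2 * (m%:R * (2 * r + 1) ^+ 2); pose r0 : R := r + 2 + 2 * (W + 1).
have W0 : 0 <= W.
  by apply: mulr_ge0; [rewrite divr_ge0|rewrite mulr_ge0// sqr_ge0].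
have r0r : r + 2 <= r0 by rewrite lerDl mulr_ge0// addr_ge0.
have r0W : 2 * (W + 1) <= (r0 - 1 - r) ^+ 2.
  have -> : r0 - 1 - r = 1 + 2 * (W + 1) by rewrite /r0; ring.
  have := W0; nra.
pose b := bnd hC1 W r0 r.
have box_r (t : par) : (forall i, `|t 0 i| <= r + 1) -> box b t by exact: box_bnd.
have K_par p : K p -> gm (par_of p) = p by move=> /KM; exact: graph_map_par_of.
have par_r p i : K p -> `|par_of p 0 i| <= r by exact: rK.
(* The box is fixed by K and h before f and omega are given. *)
exists (gm @` box b); split.
- apply: continuous_compact; last exact: compact_box.
  by apply: continuous_subspaceT; exact: continuous_graph_map.
- by move=> _ [t _ <-]; exact: graph_map_in.
- move=> p Kp; exists (par_of p); last exact: K_par.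
  by apply: box_r => i; rewrite (le_trans (par_r p i Kp))// lerDl.
move=> omega f [V oV ->] bV' fCR e e0.
have bV t : box b t -> V (gm t) by move=> Bt; have [] := bV' (gm t) (ex_intro2 _ _ t Bt erefl).
have [A fA] := on_box_bounded hC1 oV fCR bV.
have rW : 3 / 2 * (m%:R * (2 * r + 1) ^+ 2) <= W by exact: lexx.
have modulus e1 : 0 < e1 -> exists2 dl, 0 < dl & forall t (t0 : par),
    (forall i, `|t0 0 i| <= r) -> sqdist t t0 < dl ^+ 2 ->
    nm (on_box h f b t * rc (gcut hC1 eta W r0 t) - on_box h f b t0) <= e1.
  move=> e10.
  have cr : compact (box (fun=> r) : set par) by exact: compact_box.
  have br t : box (fun=> r) t -> box b t.
    by move=> tr; apply: box_r => i; rewrite (le_trans (tr i))// lerDl.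
  have [dl dl0 unif] := compact_uniform_continuity cr
    (fun t tr => continuous_on_graph hC1 oV fCR (bV t (br t tr))) e10.
  (* Capped at 1 so that t stays within r + 1 in every coordinate, where the cutoff is 1 and t lies
     in the box. *)
  exists (Num.min dl 1); first by rewrite lt_min dl0 ltr01.
  move=> t t0 t0r; set dm := Num.min dl 1 => sd.
  have dm0 : 0 < dm by rewrite lt_min dl0 ltr01.
  have ti i : `|t 0 i - t0 0 i| < dm.
    rewrite -(@ltr_pXn2r _ 2) ?nnegrE ?(ltW dm0)// real_normK ?num_real//.
    apply: le_lt_trans sd; rewrite /sqdist (bigD1 i)//= lerDl sumr_ge0// => l _.
    exact: sqr_ge0.
  have tr1 i : `|t 0 i| <= r + 1.
    have := ler_normD (t 0 i - t0 0 i) (t0 0 i); rewrite subrK => /le_trans; apply.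
    rewrite addrC lerD// ltW// (lt_le_trans (ti i))// ge_min lexx orbT//.
  have Bt : box b t by exact: box_r.
  have Bt0 : box b t0 by apply: br => i; exact: t0r.
  rewrite (gcut1 hC1 eta1 (lexx _) r0r tr1) rc1 mulr1 !on_box_in//.
  apply: ltW; apply: unif; first exact: t0r.
  apply: row_norm_lt => // i; rewrite !mxE (lt_le_trans (ti i))// ge_min lexx//.
have [F eF FE] := entire_approximation hBG seta eta0 eta1 M1 etaM rr rW r0r r0W
  (cmfun_on_box hC1 oV fCR bV) fA (@on_box_out _ _ _ h f b)
  (on_box_tested fCR bV) modulus e0.
exists F => // p Kp; have := FE (par_of p) (fun i => par_r p i Kp).
rewrite on_box_in ?K_par//.
by apply: box_r => i; rewrite (le_trans (par_r p i Kp))// lerDl.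
Qed.

End Approximation.

Lemma uniform_cvg_of_nm (R : realType) (n : nat) (K : set 'rV[R[i]^o]_n)
    (F : nat -> 'rV[R[i]^o]_n -> R[i]^o) (f : 'rV[R[i]^o]_n -> R[i]^o) :
  (forall k p, K p -> nm (F k p - f p) <= k.+1%:R^-1) -> {uniform K, F @ \oo --> f}.
Proof.
move=> FE P /uniform_nbhs [E [entE EP]].
move: entE; rewrite -entourage_ballE => -[e /= e0 eE].
have [eR eR0] := gt0_rc e0.
have := near_infty_natSinv_lt (PosNum eR0).
apply: filterS => k /= ke; apply: EP => p Kp; apply: eE.
rewrite /= -ball_normE /ball_ /= eR.
apply: (le_lt_trans (norm_le_nm _)); rewrite ltcR -nmN opprB.
exact: le_lt_trans (FE k p Kp) ke.
Qed.

Theorem theorem1p2 (R : realType) (n d : nat) (hd : (1 <= d <= n - 1)%N)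
  (h : 'rV[R]_d -> 'rV[R[i]^o]_(n - d) -> 'rV[R]_d)
  (h_C1 : C1_graphing h) (h_BG : bloom_graham h)
  (N c : R) (N_ge0 : 0 <= N) (h_growth : polynomial_growth h N c)
  (K : set 'rV[R[i]^o]_(d + (n - d)))
  (K_compact : compact K) (K_sub : K `<=` model_graph h) :
  exists K' : set 'rV[R[i]^o]_(d + (n - d)),
    [/\ compact K', K' `<=` model_graph h, K `<=` K' &
      forall (omega : set 'rV[R[i]^o]_(d + (n - d)))
             (f : 'rV[R[i]^o]_(d + (n - d)) -> R[i]^o),
        graph_open h omega -> K' `<=` omega -> continuous_CR h omega f ->
        exists F : nat -> 'rV[R[i]^o]_(d + (n - d)) -> R[i]^o,
          (forall k, entire (F k)) /\ {uniform K, F @ \oo --> f}].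
Proof.
have [K' [cK' K'M KK' approx]] := approximation_on_graph h_C1 h_BG K_compact K_sub.
exists K'; split => // omega f oo K'o fCR.
have inv0 k : 0 < k.+1%:R^-1 :> R by rewrite invr_gt0 ltr0n.
pose F k := sval (cid2 (approx omega f oo K'o fCR _ (inv0 k))).
exists F; split => [k|]; first by rewrite /F; case: cid2.
apply: uniform_cvg_of_nm => k p Kp; rewrite /F; case: cid2 => g eg /= gE.
exact: gE.
Qed.
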